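(* Let $d\geq 1$ and $1\leq k\leq d$ be integers and let $1\leq p\leq\infty$. (a) If $d=2$ or $k=1$, then $H^p(\mathbb{T}^d)$ enjoys the contractive restriction property of dimension $k$ if and only if $p\neq 2$. (b) If either $d=k=3$, or $d\geq 3$ and $k=2$, then $H^p(\mathbb{T}^d)$ enjoys the contractive restriction property of dimension $k$ if and only if $p\neq 2,4$. (c) If $d\geq 4$ and $k\geq 3$, then $H^p(\mathbb{T}^d)$ enjoys the contractive restriction property of dimension $k$ if and only if $p$ is not an even integer.
   Context: $\mathbb{T}^d$ is the $d$-dimensional torus with normalized Haar measure $m_d$; for $f\in L^p(\mathbb{T}^d)$ and $\alpha\in\mathbb{Z}^d$, $\widehat f(\alpha)=\int_{\mathbb{T}^d} f(z)\overline{z^\alpha}\,dm_d(z)$. $\mathbb{N}_0=\{0,1,2,\dots\}$. $H^p(\mathbb{T}^d)$ is the subspace of $L^p(\mathbb{T}^d)$ of functions with $\widehat f(\alpha)=0$ for all $\alpha\in\mathbb{Z}^d\setminus\mathbb{N}_0^d$. For a nonempty $\Gamma\subseteq\mathbb{N}_0^d$, $P_\Gamma$ is the operator densely defined by $P_\Gamma f(z)=\sum_{\alpha\in\Gamma}\widehat f(\alpha)z^\alpha$; $\Gamma$ is a contractive projection set for $H^p(\mathbb{T}^d)$ if $P_\Gamma$ extends to a contraction on $H^p(\mathbb{T}^d)$. A subset of $\mathbb{Z}^d$ is a coset in $\mathbb{Z}^d$ if it is a coset of a subgroup of $(\mathbb{Z}^d,+)$. The dimension of a set $\Gamma$ is the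 dimension of its affine span. $H^p(\mathbb{T}^d)$ enjoys the contractive restriction property of dimension $k$ if every contractive projection set for $H^p(\mathbb{T}^d)$ of dimension $k$ is of the form $\Lambda\cap\mathbb{N}_0^d$ for some coset $\Lambda$ in $\mathbb{Z}^d$. *)

(* Defs.v *)
From HB Require Import structures.
From mathcomp Require Import all_boot all_order all_algebra.
From mathcomp Require Import all_classical all_reals all_analysis.
From mathcomp Require Import complex.
Import Order.TTheory GRing.Theory Num.Theory.

Set Implicit Arguments.
Unset Strict Implicit.
Unset Printing Implicit Defensive.

Local Open Scope classical_set_scope.
Local Open Scope ring_scope.

Definition mindex (d : nat) := {ffun 'I_d -> nat}.

Section Torus.
Variables (R : realType) (d : nat).

(* The torus T^d is parametrized by theta in [0,1]^d via z_j = exp(2 pi i theta_j);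
   the monomial z^alpha evaluated at theta. *)
Definition monomial (a : mindex d) (theta : 'I_d -> R) : R[i] :=
  let s := 2 * pi * \sum_(j < d) (a j)%:R * theta j in
  (cos s +i* sin s)%C.

Fixpoint iter_int (s : seq 'I_d) (F : ('I_d -> R) -> R) (theta : 'I_d -> R) : R :=
  match s with
  | [::] => F theta
  | j :: s' => Rintegral (@lebesgue_measure R) `[0, 1]
                 (fun t => iter_int s' F (fun l => if l == j then t else theta l))
  end.

Definition torus_int (F : ('I_d -> R) -> R) : R :=
  iter_int (enum 'I_d) F (fun _ => 0).

(* L^p(T^d) norm of a continuous function (used only for trigonometric
   polynomials); p = +oo gives the sup norm. *)
Definition Lpnorm (p : \bar R) (g : ('I_d -> R) -> R[i]) : R :=
  match p with
  | r%:E => powR (torus_int (fun theta => powR (Normc.normc (g theta)) r)) r^-1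
  | +oo%E => sup [set Normc.normc (g theta) | theta in [set: 'I_d -> R]]
  | -oo%E => 0
  end.

Definition trigpoly (S : seq (mindex d)) (G : set (mindex d)) (c : mindex d -> R[i])
  (theta : 'I_d -> R) : R[i] :=
  \sum_(a <- S | a \in G) c a * monomial a theta.

(* Gamma is a contractive projection set for H^p(T^d): P_Gamma, defined on the
   dense subspace of analytic polynomials, is a contraction for the L^p norm. *)
Definition contractive_set (p : \bar R) (G : set (mindex d)) : Prop :=
  forall (S : seq (mindex d)) (c : mindex d -> R[i]), uniq S ->
    Lpnorm p (trigpoly S G c) <= Lpnorm p (trigpoly S setT c).

Definition rvec (a : mindex d) : 'rV[R]_d := \row_j (a j)%:R.

Definition affine_direction (G : set (mindex d)) (V : {vspace 'rV[R]_d}) : Prop :=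
  (forall a b, G a -> G b -> rvec a - rvec b \in V) /\
  (forall W : {vspace 'rV[R]_d},
      (forall a b, G a -> G b -> rvec a - rvec b \in W) -> (V <= W)%VS).

Definition has_dimension (G : set (mindex d)) (k : nat) : Prop :=
  G !=set0 /\ exists V, affine_direction G V /\ \dim V = k.

Definition ivec (a : mindex d) : 'rV[int]_d := \row_j (a j)%:Z.

Definition coset_restriction (G : set (mindex d)) : Prop :=
  exists (H : set 'rV[int]_d) (v : 'rV[int]_d),
    H 0 /\ (forall x y, H x -> H y -> H (x - y)) /\
    (forall a, G a <-> H (ivec a - v)).

Definition contractive_restriction_property (p : \bar R) (k : nat) : Prop :=
  forall G : set (mindex d), has_dimension G k -> contractive_set p G ->
    coset_restriction G.

End Torus.

(* Main.v *)
(* Write D for the set of differences a - b of points of Gamma and call Gamma closed at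
   level n if every point g + h_1 + ... + h_n of N_0^d with g in Gamma and h_i in D lies in
   Gamma; Gamma is a coset restriction as soon as it is closed at every level.

   If p is not one of 2, 4, ..., 2n, a contractive projection set is closed at level n.
   Suppose that alpha = g + sum_(i <= n) (b_i - c_i) is missing and test the contraction on
   z^g (1 + u) + e z^alpha, where u is a combination of the z^(b_i - g) and z^(c_i - g) of
   size r, with phases in {1, i, -1, -i}. Averaged over the phases, the first order term in
   e is, pointwise in z, a nonzero multiple of binom(p/2, n) binom(p/2 - 1, n) r^(2n), up to
   O(r^(2n+1)), and these binomials do not vanish. For p = oo the sum of all these monomials
   with coefficient 1 is perturbed instead.

   Conversely, if p = 2(n+1) and Gamma is closed at level n, then with f = P_Gamma F and
   h = F - f one has |F|^p >= |f|^p + p |f|^(2n) Re(conj f * h), and the last term has no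
   zero frequency.

   What remains is combinatorics in N_0^d: closure at level 1 gives closure at all levels
   when k = 1 or d = 2, closure at level 2 does when k = 2 or d = k = 3, and explicit sets
   that are closed at level n, but are not coset restrictions, settle the other cases. *)

Require Import Defs.
From HB Require Import structures.
From mathcomp Require Import all_boot all_order all_algebra.
From mathcomp Require Import all_classical all_reals all_analysis.
From mathcomp Require Import complex ring lra zify.
Import Order.TTheory GRing.Theory Num.Theory.
Set Implicit Arguments.
Unset Strict Implicit.
Unset Printing Implicit Defensive.
Import numFieldNormedType.Exports.
Local Open Scope classical_set_scope.
Local Open Scope ring_scope.

(** * Extensions of a set by sums of differences *)

(** The points g, b_i, c_i may coincide or satisfy additive relations, so integration over the torus
    alone does not isolate the wanted term of the expansion. The phases do: they make the 2n
    monomials of u behave as independent variables already at each fixed z, and the resulting gain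
    is bounded below uniformly in z. Integrating it contradicts the sum over all phases of the
    contraction inequalities.

    In the combinatorial part the obstacle is that a sum of differences may land in N_0^d while its
    partial sums leave it. On a line and in N_0^2, two terms of a minimal sum are merged into one.
    For a two-dimensional set, a triangle of least area gives integer affine coordinates to all
    points, and reflections of its vertices reach every nonnegative integer combination. In N_0^3,
    two unbounded coordinates leave room for merging; otherwise the set, or its projection along the
    only unbounded coordinate, is bounded. Linear relations between points of a bounded closed set
    have coefficient sum 0, which makes the set too flat to have dimension 3. *)

Section Extensions.
Variable d : nat.
Local Notation vec := 'rV[int]_d.
Implicit Types (G : set (mindex d)) (a b g : mindex d) (X : set vec) (x h v : vec).

Lemma vecD (x y : vec) (j : 'I_d) : (x + y) 0 j = x 0 j + y 0 j.
Proof. by rewrite mxE. Qed.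

Lemma vecN x j : (- x) 0 j = - x 0 j.
Proof. by rewrite mxE. Qed.

Lemma vecZ (m : int) x j : (m *: x) 0 j = m * x 0 j.
Proof. by rewrite mxE. Qed.

Lemma vec0 j : (0 : vec) 0 j = 0.
Proof. by rewrite mxE. Qed.

Lemma vecP x (y : vec) : (forall j, x 0 j = y 0 j) -> x = y.
Proof. by move=> H; apply/rowP. Qed.

Definition vecE := (vecD, vecN, vecZ, vec0).

Definition diffset X : set vec := [set a - b | a in X & b in X].

Definition diffs G := diffset [set ivec a | a in G].

Fixpoint ext G n : set vec :=
  if n is m.+1 then [set x + h | x in ext G m & h in diffs G]
  else [set ivec a | a in G].

Definition ext_closed n G := forall a, ext G n (ivec a) -> G a.

Definition nonneg v := forall j, 0 <= v 0 j.

(** Stated for sets of integer vectors, since it is also applied to projections such as the image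
    under [drop_k]. *)
Definition closed_upto n X := forall x (l : seq vec), X x -> (size l <= n)%N ->
  (forall h, h \in l -> diffset X h) -> nonneg (x + \sum_(h <- l) h) ->
  X (x + \sum_(h <- l) h).

Lemma ivec_inj : injective (@ivec d).
Proof.
move=> a b /rowP E; apply/ffunP => j.
by have := E j; rewrite !mxE => -[].
Qed.

Lemma diffsetI X (x y : vec) : X x -> X y -> diffset X (x - y).
Proof. by move=> Xx Xy; exists x => //; exists y. Qed.

Lemma diffsetN X h : diffset X h -> diffset X (- h).
Proof. by move=> [x Xx [y Xy <-]]; rewrite opprB; exact: diffsetI. Qed.

Lemma nonneg_ivec a : nonneg (ivec a).
Proof. by move=> j; rewrite mxE. Qed.

Lemma nonneg_ivecE v : nonneg v -> exists a, v = ivec a.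
Proof.
move=> v0; exists [ffun j : 'I_d => absz (v 0 j)]; apply/rowP => j.
by rewrite mxE ffunE gez0_abs.
Qed.

Lemma extI G g (l : seq vec) : G g -> (forall h, h \in l -> diffs G h) ->
  ext G (size l) (ivec g + \sum_(h <- l) h).
Proof.
move=> Gg; elim: l => [|h l IH] H /=; first by rewrite big_nil addr0; exists g.
exists (ivec g + \sum_(h <- l) h).
  by apply: IH => k kl; apply: H; rewrite inE kl orbT.
exists h; first by apply: H; rewrite inE eqxx.
by rewrite big_cons addrAC -addrA.
Qed.

Lemma ext_nonempty G n v : ext G n v -> exists g, G g.
Proof. by elim: n v => [|n IH] v /=; [move=> [g Gg _]; exists g|move=> [x /IH]]. Qed.

(** A sum of differences can be padded with the zero difference of a point with itself. *)
Lemma ext_le G m n v : (m <= n)%N -> ext G m v -> ext G n v.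
Proof.
move=> mn Hv; have [g Gg] := ext_nonempty Hv.
rewrite -(subnKC mn); elim: (n - m)%N => [|k IH]; first by rewrite addn0.
rewrite addnS; exists v => //; exists 0; last by rewrite addr0.
by rewrite -(subrr (ivec g)); apply: diffsetI; exists g.
Qed.

Lemma ext_closed_upto n G : ext_closed n G -> closed_upto n [set ivec a | a in G].
Proof.
move=> HG x l [g Gg <-] ln Hl /nonneg_ivecE[a aE].
rewrite aE; exists a => //; apply: HG; apply: (ext_le ln).
by rewrite -aE; exact: extI.
Qed.

Lemma closed_le m n X : (m <= n)%N -> closed_upto n X -> closed_upto m X.
Proof. by move=> mn H x l Xx lm; apply: H => //; exact: leq_trans mn. Qed.

Lemma closed1P X (x y z : vec) : closed_upto 1 X -> X x -> X y -> X z ->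
  nonneg (x + y - z) -> X (x + y - z).
Proof.
move=> H Xx Xy Xz; have := H x [:: y - z] Xx (leqnn _).
rewrite big_seq1 addrA; apply => h; rewrite inE => /eqP ->; exact: diffsetI.
Qed.

Lemma closed2P X x h k : closed_upto 2 X -> X x -> diffset X h -> diffset X k ->
  nonneg (x + h + k) -> X (x + h + k).
Proof.
move=> H Xx Dh Dk; have := H x [:: h; k] Xx (leqnn _).
rewrite !big_cons big_nil addr0 addrA; apply => j.
by rewrite !inE => /orP[] /eqP ->.
Qed.

(** The differences form a symmetric set, so their finite sums form a subgroup; the coset is its
    translate through any point of G. *)
Lemma closed_coset G : G !=set0 -> (forall n, closed_upto n [set ivec a | a in G]) ->
  coset_restriction G.
Proof.
move=> [g Gg] HX; set X := [set ivec a | a in G] in HX.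
exists [set v | exists2 l : seq vec, forall h, h \in l -> diffset X h & v = \sum_(h <- l) h].
exists (ivec g); split; first by exists [::] => //; rewrite big_nil.
split.
  move=> _ _ [l Hl ->] [m Hm ->]; exists (l ++ [seq - h | h <- m]).
    by move=> h; rewrite mem_cat => /orP[/Hl//|/mapP[k /Hm Dk ->]]; exact: diffsetN.
  by rewrite big_cat big_map sumrN.
have Xg : X (ivec g) by exists g.
move=> a; split=> [Ga|[l Hl /eqP]].
  exists [:: ivec a - ivec g]; last by rewrite big_seq1.
  by move=> h; rewrite inE => /eqP ->; apply: diffsetI => //; exists a.
rewrite subr_eq addrC => /eqP E; have := HX (size l) (ivec g) l Xg (leqnn _) Hl.
by rewrite -E => /(_ (nonneg_ivec a))[b Gb /ivec_inj <-].
Qed.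

Lemma sum_rem (h : vec) (l : seq vec) : h \in l ->
  \sum_(k <- l) k = h + \sum_(k <- rem h l) k.
Proof. by move=> hl; rewrite (big_rem h hl). Qed.

(* A minimal sum of differences leaving X admits no intermediate point, so it is
   enough to shorten it by merging two of its terms into a single difference. *)
Lemma closed_of_merge X : closed_upto 1 X ->
  (forall v (l : seq vec), X v -> l != [::] -> (forall h, h \in l -> diffset X h) ->
     nonneg (v + \sum_(h <- l) h) -> (forall h, h \in l -> ~ nonneg (v + h)) ->
     (forall h, h \in l -> ~ nonneg (v + \sum_(k <- rem h l) k)) ->
     exists h k, [/\ h \in l, k \in rem h l & diffset X (h + k)]) ->
  forall n, closed_upto n X.
Proof.
move=> c1 merge; elim=> [|n IH] v l Xv ln Hl Hv.
  by move: ln Hl Hv; case: l => // _ _; rewrite big_nil addr0.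
have [/eqP l0|l0] := boolP (l == [::]); first by move: Hv; rewrite l0 big_nil addr0.
have rem_sub h : h \in l -> forall k, k \in rem h l -> diffset X k.
  by move=> hl k /mem_rem; exact: Hl.
have rem_size h : h \in l -> (size (rem h l) <= n)%N.
  by move=> hl; rewrite size_rem//; case: (l) ln.
have step1 x h : X x -> diffset X h -> nonneg (x + h) -> X (x + h).
  move=> Xx Dh; have := c1 x [:: h] Xx (leqnn _).
  by rewrite big_seq1; apply => k; rewrite inE => /eqP ->.
have [[h hl Hh]|H1] := pselect (exists2 h, h \in l & nonneg (v + h)).
  rewrite (sum_rem hl) addrA; apply: IH; [exact: step1 (Hl h hl) Hh|exact: rem_size|exact: rem_sub|].
  by rewrite -addrA -(sum_rem hl).
have [[h hl Hh]|H2] := pselect (exists2 h, h \in l & nonneg (v + \sum_(k <- rem h l) k)).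
  have E : v + \sum_(k <- l) k = v + \sum_(k <- rem h l) k + h.
    by rewrite (sum_rem hl) addrCA addrC.
  rewrite E; apply: step1; [|exact: Hl|by rewrite -E].
  by apply: IH => //; [exact: rem_size|exact: rem_sub].
have [||h [k [hl kl Dhk]]] := merge v l Xv l0 Hl Hv.
- by move=> h hl Hh; apply: H1; exists h.
- by move=> h hl Hh; apply: H2; exists h.
have E : \sum_(i <- l) i = \sum_(i <- (h + k) :: rem k (rem h l)) i.
  by rewrite big_cons (sum_rem hl) (sum_rem kl) addrA.
rewrite E; apply: IH => //.
- by rewrite /= size_rem// prednK ?rem_size//; case: (rem h l) kl.
- move=> i; rewrite inE => /orP[/eqP ->//|/mem_rem]; exact: rem_sub.
- by rewrite -E.
Qed.

End Extensions.

(** * Integration on the torus *)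

Section UnitInterval.
Variable R : realType.
Local Notation mu := (@lebesgue_measure R).
Implicit Types f g : R -> R.

Definition lip1 f := exists K, forall x y, `|f x - f y| <= K * `|x - y|.

Lemma lip1_continuous f : lip1 f -> continuous f.
Proof.
move=> [K HK] x; apply/cvgrPdist_lt => e e0; near=> y.
apply: le_lt_trans (HK x y) _.
have K1 : 0 < `|K| + 1 by rewrite ltr_wpDl.
apply: (@le_lt_trans _ _ ((`|K| + 1) * `|x - y|)).
  by rewrite ler_wpM2r// (le_trans (ler_norm K))// lerDl.
rewrite mulrC -ltr_pdivlMr//; near: y.
have /cvgrPdist_lt : y @[y --> x] --> x by exact: cvg_id.
by apply; exact: divr_gt0.
Unshelve. all: by end_near. Qed.

Lemma lip1_integrable f : lip1 f -> mu.-integrable `[0, 1] (EFin \o f).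
Proof.
move=> Hf; apply: continuous_compact_integrable; first exact: segment_compact.
by apply: continuous_subspaceT; exact: lip1_continuous.
Qed.

Lemma int01_cst (r : R) : Rintegral mu `[0, 1] (fun=> r) = r.
Proof.
rewrite Rintegral_cst//.
rewrite [X in fine X](_ : _ = 1%E) ?mulr1//.
apply: etrans (lebesgue_measure_itv _) _.
by rewrite /= lte01 oppr0 adde0.
Qed.

Lemma int01_dist f g (K : R) : lip1 f -> lip1 g -> (forall x, `|f x - g x| <= K) ->
  `|Rintegral mu `[0, 1] f - Rintegral mu `[0, 1] g| <= K.
Proof.
move=> lf lg H.
have [] := (lip1_integrable lf, lip1_integrable lg) => /= If Ig.
rewrite -RintegralB//.
have Ifg : mu.-integrable `[0, 1] (EFin \o (f \- g)).
  by apply: (integrableB _ If Ig).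
have IN : mu.-integrable `[0, 1] (EFin \o (fun x => `|f x - g x|)).
  by have := integrable_norm Ifg.
have IK (r : R) : mu.-integrable `[0, 1] (EFin \o (fun=> r)).
  by apply: lip1_integrable; exists 0 => x y; rewrite subrr normr0 mul0r.
apply: le_trans (le_normr_Rintegral _ Ifg) _ => //.
rewrite -[leRHS]int01_cst; apply: le_Rintegral => // x _; exact: H.
Qed.

End UnitInterval.

Section NiceFunctions.
Variables (R : realType) (d : nat).
Local Notation mu := (@lebesgue_measure R).
Local Notation point := ('I_d -> R).
Implicit Types (F G : point -> R) (t u : point) (s : seq 'I_d).

Definition dist1 t u : R := \sum_j `|t j - u j|.

Lemma dist1_ge0 t u : 0 <= dist1 t u.
Proof. by apply: sumr_ge0. Qed.

(** Bounded Lipschitz functions are stable under products, under composition with locally Lipschitz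
    functions and under integration in one variable. Every stage of the iterated integral is
    therefore continuous, and no measurability in several variables is involved. *)
Definition nice F := exists2 K, 0 <= K &
  (forall t, `|F t| <= K) /\ (forall t u, `|F t - F u| <= K * dist1 t u).

Lemma nice_cst (r : R) : nice (fun=> r).
Proof.
exists `|r| => //; split=> // t u.
by rewrite subrr normr0 mulr_ge0// dist1_ge0.
Qed.

Lemma niceD F G : nice F -> nice G -> nice (fun t => F t + G t).
Proof.
move=> [K K0 [BF LF]] [L L0 [BG LG]]; exists (K + L); first exact: addr_ge0.
split=> [t|t u]; first exact: le_trans (ler_normD _ _) (lerD _ _).
rewrite mulrDl opprD addrACA.
exact: le_trans (ler_normD _ _) (lerD _ _).
Qed.

Lemma niceM F G : nice F -> nice G -> nice (fun t => F t * G t).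
Proof.
move=> [K K0 [BF LF]] [L L0 [BG LG]]; exists (K * L *+ 2).
  by rewrite mulrn_wge0 ?mulr_ge0.
split=> [t|t u].
  rewrite normrM (@le_trans _ _ (K * L))//; first exact: ler_pM.
  by rewrite mulr2n lerDl mulr_ge0.
have -> : F t * G t - F u * G u = (F t - F u) * G t + F u * (G t - G u) by ring.
apply: le_trans (ler_normD _ _) _; rewrite !normrM.
have -> : K * L *+ 2 * dist1 t u = K * dist1 t u * L + K * (L * dist1 t u).
  by rewrite mulr2n; ring.
by apply: lerD; apply: ler_pM.
Qed.

Lemma niceN F : nice F -> nice (fun t => - F t).
Proof.
move=> [K K0 [BF LF]]; exists K => //; split=> [t|t u]; first by rewrite normrN.
by rewrite -opprD normrN.
Qed.

Lemma nice_sum (I : Type) (r : seq I) (F : I -> point -> R) :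
  (forall i, nice (F i)) -> nice (fun t => \sum_(i <- r) F i t).
Proof.
move=> H; elim: r => [|i r IH].
  by under eq_fun do rewrite big_nil; exact: nice_cst.
under eq_fun do rewrite big_cons.
exact: niceD.
Qed.

Lemma nice_comp (phi : R -> R) F :
  (forall B, 0 <= B -> exists2 K, 0 <= K & forall x y, `|x| <= B -> `|y| <= B ->
     `|phi x - phi y| <= K * `|x - y|) ->
  nice F -> nice (fun t => phi (F t)).
Proof.
move=> H [B B0 [BF LF]]; have [K K0 HK] := H _ B0.
exists (K * B + `|phi 0|); first by rewrite addr_ge0 ?mulr_ge0.
split=> [t|t u].
  rewrite -[phi (F t)](subrK (phi 0)); apply: le_trans (ler_normD _ _) _.
  rewrite lerD2r; apply: le_trans (HK _ _ (BF t) _) _; rewrite ?normr0//.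
  by rewrite subr0 ler_wpM2l.
apply: le_trans (HK _ _ (BF t) (BF u)) _.
apply: (@le_trans _ _ (K * (B * dist1 t u))); first by rewrite ler_wpM2l.
by rewrite mulrA ler_wpM2r ?dist1_ge0// lerDl.
Qed.

Lemma cos_lip (x y : R) : `|cos x - cos y| <= `|x - y|.
Proof.
wlog: x y / x <= y => [H|].
  by have [/H//|/ltW/H] := leP x y; by rewrite distrC (distrC x).
rewrite le_eqVlt => /orP[/eqP->|xy]; first by rewrite !subrr normr0.
have D z : z \in `]x, y[ -> is_derive z 1 (@cos R) (- sin z).
  by move=> _; exact: is_derive_cos.
have C : {within `[x, y], continuous (@cos R)}.
  by apply: derivable_within_continuous => z _; exact: ex_derive.
have [c _ E] := MVT xy D C.
rewrite distrC E normrM (distrC x) ler_piMl// normrN.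
by rewrite ler_norml sin_geN1 sin_le1.
Qed.

(** The shift c = - pi / 2 turns the cosine into a sine, so real and imaginary parts of characters
    are both covered. *)
Lemma nice_cos (b : 'I_d -> R) (c : R) :
  nice (fun t => cos (\sum_j b j * t j + c)).
Proof.
exists (1 + \sum_j `|b j|); first by rewrite addr_ge0// sumr_ge0.
split=> [t|t u].
  rewrite (@le_trans _ _ 1)// ?lerDl ?sumr_ge0//.
  by rewrite ler_norml cos_geN1 cos_le1.
apply: le_trans (cos_lip _ _) _.
rewrite opprD addrACA subrr addr0 -sumrB.
apply: le_trans (ler_norm_sum _ _ _) _.
rewrite /dist1 mulr_sumr; apply: ler_sum => j _.
rewrite -mulrBr normrM ler_wpM2r// (bigD1 j)//=.
by rewrite addrCA lerDl addr_ge0// sumr_ge0.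
Qed.

(** The same update as in the body of [iter_int], so that [iter_int_cons] holds by conversion. *)
Definition upd t j (x : R) : point := fun l => if l == j then x else t l.

Lemma dist1_upd t u j x : dist1 (upd t j x) (upd u j x) <= dist1 t u.
Proof.
by apply: ler_sum => l _; rewrite /upd; case: eqP => // _; rewrite subrr normr0.
Qed.

Lemma dist1_upd2 t j x y : dist1 (upd t j x) (upd t j y) = `|x - y|.
Proof.
rewrite /dist1 (bigD1 j)//= /upd eqxx big1 ?addr0// => l /negbTE ->.
by rewrite subrr normr0.
Qed.

Lemma nice_upd F t j : nice F -> lip1 (fun x => F (upd t j x)).
Proof.
by move=> [K K0 [_ LF]]; exists K => x y; apply: le_trans (LF _ _) _; rewrite dist1_upd2.
Qed.

Lemma nice_integrable F t j : nice F ->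
  mu.-integrable `[0, 1] (EFin \o (fun x => F (upd t j x))).
Proof. by move=> nF; apply: lip1_integrable; exact: nice_upd. Qed.

Lemma nice_int F j : nice F ->
  nice (fun t => Rintegral mu `[0, 1] (fun x => F (upd t j x))).
Proof.
move=> nF; have [K K0 [BF LF]] := nF; exists K => //; split=> [t|t u].
  rewrite -[X in `|X|]subr0 -[X in _ - X](int01_cst (0 : R)).
  apply: int01_dist; first exact: nice_upd.
    by exists 0 => ? ?; rewrite subrr normr0 mul0r.
  by move=> x; rewrite subr0.
apply: int01_dist => [||x]; [exact: nice_upd..|].
by apply: le_trans (LF _ _) _; rewrite ler_wpM2l// dist1_upd.
Qed.

Lemma iter_int_cons j s F t :
  iter_int (j :: s) F t = Rintegral mu `[0, 1] (fun x => iter_int s F (upd t j x)).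
Proof. by []. Qed.

Lemma nice_iter s F : nice F -> nice (iter_int s F).
Proof. by move=> nF; elim: s => // j s IH; apply: nice_int. Qed.

Lemma iter_intD s F G t : nice F -> nice G ->
  iter_int s (fun t => F t + G t) t = iter_int s F t + iter_int s G t.
Proof.
move=> nF nG; elim: s t => // j s IH t; rewrite !iter_int_cons.
under [LHS]eq_Rintegral do rewrite IH.
by apply: RintegralD => //; apply: nice_integrable; exact: nice_iter.
Qed.

Lemma iter_intZ s r F t : nice F ->
  iter_int s (fun t => r * F t) t = r * iter_int s F t.
Proof.
move=> nF; elim: s t => // j s IH t; rewrite !iter_int_cons.
under [LHS]eq_Rintegral do rewrite IH.
by apply: RintegralZl => //; apply: nice_integrable; exact: nice_iter.
Qed.

Lemma iter_int_cst s r t : iter_int s (fun=> r) t = r.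
Proof.
elim: s t => // j s IH t; rewrite iter_int_cons.
by under eq_Rintegral do rewrite IH; rewrite int01_cst.
Qed.

Lemma iter_int_le s F G t : nice F -> nice G -> (forall u, F u <= G u) ->
  iter_int s F t <= iter_int s G t.
Proof.
move=> nF nG FG; elim: s t => // j s IH t; rewrite !iter_int_cons.
apply: le_Rintegral => //; by apply: nice_integrable; exact: nice_iter.
Qed.

Lemma torus_intD F G : nice F -> nice G ->
  torus_int (fun t => F t + G t) = torus_int F + torus_int G.
Proof. exact: iter_intD. Qed.

Lemma torus_intZ r F : nice F -> torus_int (fun t => r * F t) = r * torus_int F.
Proof. exact: iter_intZ. Qed.

Lemma torus_int_cst r : torus_int (fun _ : point => r) = r.
Proof. exact: iter_int_cst. Qed.

Lemma torus_int_le F G : nice F -> nice G -> (forall u, F u <= G u) ->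
  torus_int F <= torus_int G.
Proof. exact: iter_int_le. Qed.

Lemma torus_int_ge0 F : nice F -> (forall u, 0 <= F u) -> 0 <= torus_int F.
Proof.
by move=> nF F0; rewrite -(torus_int_cst 0); apply: torus_int_le => //; exact: nice_cst.
Qed.

Lemma torus_int_sum (I : Type) (r : seq I) (F : I -> point -> R) :
  (forall i, nice (F i)) ->
  torus_int (fun t => \sum_(i <- r) F i t) = \sum_(i <- r) torus_int (F i).
Proof.
move=> nF; elim: r => [|i r IH].
  by under eq_fun do rewrite big_nil; rewrite torus_int_cst big_nil.
under eq_fun do rewrite big_cons.
by rewrite torus_intD ?big_cons ?IH//; exact: nice_sum.
Qed.

End NiceFunctions.

(** * Unit complex numbers and characters of the torus *)

Section UnitComplex.
Variable R : realType.
Local Notation C := R[i].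
Implicit Types (x y : R) (z w : C).
Local Open Scope complex_scope.
Local Notation "z ^*" := (conjc z) : ring_scope.

Definition expi x : C := (cos x +i* sin x).

Lemma expi0 : expi 0 = 1.
Proof. by rewrite /expi cos0 sin0. Qed.

Lemma expiD x y : expi (x + y) = expi x * expi y.
Proof.
by rewrite /expi cosD sinD; apply/eqP; rewrite eq_complex /=; apply/andP; split;
   apply/eqP; ring.
Qed.

Lemma expiN x : expi (- x) = (expi x)^*.
Proof. by rewrite /expi cosN sinN. Qed.

Lemma normc_expi x : Normc.normc (expi x) = 1.
Proof. by rewrite /= cos2Dsin2 sqrtr1. Qed.

Lemma normc_ge0 z : 0 <= Normc.normc z.
Proof. by case: z => a b; exact: sqrtr_ge0. Qed.

Lemma sqr_normc z : Normc.normc z ^+ 2 = complex.Re z ^+ 2 + complex.Im z ^+ 2.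
Proof. by case: z => a b /=; rewrite sqr_sqrtr// addr_ge0 ?sqr_ge0. Qed.

Lemma normc_conj z : Normc.normc z^* = Normc.normc z.
Proof. by case: z => a b /=; rewrite sqrrN. Qed.

Lemma normcX z n : Normc.normc (z ^+ n) = Normc.normc z ^+ n.
Proof.
by elim: n => [|n IH]; rewrite ?expr0 ?Normc.normc1// !exprS Normc.normcM IH.
Qed.

Lemma normc_realE x : Normc.normc x%:C = `|x|.
Proof. by rewrite /= expr0n addr0 sqrtr_sqr. Qed.

Lemma normc_le z : Normc.normc z <= `|complex.Re z| + `|complex.Im z|.
Proof.
rewrite -(ler_pXn2r (_ : 0 < 2)%N) ?nnegrE ?normc_ge0 ?addr_ge0//.
by rewrite sqr_normc sqrrD !real_normK ?num_real// addrAC lerDl mulrn_wge0 ?mulr_ge0.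
Qed.

Lemma Re_le_normc z : `|complex.Re z| <= Normc.normc z.
Proof.
rewrite -(ler_pXn2r (_ : 0 < 2)%N) ?nnegrE ?normc_ge0//.
by rewrite sqr_normc real_normK ?num_real// lerDl sqr_ge0.
Qed.

Lemma normc_sum (I : Type) (r : seq I) (F : I -> C) :
  Normc.normc (\sum_(i <- r) F i) <= \sum_(i <- r) Normc.normc (F i).
Proof.
elim: r => [|i r IH]; first by rewrite !big_nil Normc.normc0.
by rewrite !big_cons; apply: le_trans (le_normcD _ _) _; rewrite lerD2l.
Qed.

Lemma normc_dist z w : `|Normc.normc z - Normc.normc w| <= Normc.normc (z - w).
Proof.
rewrite ler_distl; apply/andP; split.
  rewrite lerBlDr -[X in X <= _](congr1 (@Normc.normc R) (subrK z w)).
  apply: le_trans (le_normcD _ _) _.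
  by rewrite addrC lerD2l -[X in X <= _]normcN opprB.
rewrite -[X in X <= _](congr1 (@Normc.normc R) (subrK w z)) addrC.
exact: le_normcD.
Qed.

Lemma sin_period x (k : int) : sin (x + 2 * pi * k%:~R) = sin x.
Proof.
have H (n : nat) (y : R) : sin (y + 2 * pi * n%:R) = sin y.
  elim: n y => [|n IH] y; first by rewrite mulr0 addr0.
  rewrite -(natr1 n) mulrDr mulr1 addrA.
  have E : 2 * pi = pi *+ 2 :> R by rewrite mulr_natl.
  by rewrite [X in _ + X]E sinD2pi IH.
case: k => n; first exact: H.
by rewrite -[LHS](H n.+1) NegzE mulrNz mulrN addrNK.
Qed.

End UnitComplex.

Section NiceComplex.
Variables (R : realType) (d : nat).
Local Notation C := R[i].
Local Notation point := ('I_d -> R).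
Implicit Types (f g : point -> C) (b c : 'rV[int]_d).
Local Open Scope complex_scope.
Local Notation "z ^*" := (conjc z) : ring_scope.

Definition niceC f := nice (fun t => complex.Re (f t)) /\ nice (fun t => complex.Im (f t)).

Lemma niceC_cst (z : C) : niceC (fun=> z).
Proof. by split; exact: nice_cst. Qed.

Lemma niceCD f g : niceC f -> niceC g -> niceC (fun t => f t + g t).
Proof.
move=> [f1 f2] [g1 g2]; split.
  rewrite (_ : (fun t => _) = (fun t => complex.Re (f t) + complex.Re (g t))).
    exact: niceD.
  by apply: funext => t; case: (f t) (g t) => [? ?] [].
rewrite (_ : (fun t => _) = (fun t => complex.Im (f t) + complex.Im (g t))).
  exact: niceD.
by apply: funext => t; case: (f t) (g t) => [? ?] [].
Qed.

Lemma niceCM f g : niceC f -> niceC g -> niceC (fun t => f t * g t).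
Proof.
move=> [f1 f2] [g1 g2]; split.
  rewrite (_ : (fun t => _) = (fun t => complex.Re (f t) * complex.Re (g t) +
    - (complex.Im (f t) * complex.Im (g t)))).
    by apply: niceD; [|apply: niceN]; exact: niceM.
  by apply: funext => t; case: (f t) (g t) => [? ?] [].
rewrite (_ : (fun t => _) = (fun t => complex.Re (f t) * complex.Im (g t) +
    complex.Im (f t) * complex.Re (g t))).
  by apply: niceD; exact: niceM.
by apply: funext => t; case: (f t) (g t) => [? ?] [].
Qed.

Lemma niceC_sum (I : Type) (r : seq I) (F : I -> point -> C) :
  (forall i, niceC (F i)) -> niceC (fun t => \sum_(i <- r) F i t).
Proof.
move=> H; elim: r => [|i r IH].
  by under eq_fun do rewrite big_nil; exact: niceC_cst.
under eq_fun do rewrite big_cons.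
exact: niceCD.
Qed.

Lemma niceC_sumP (I : Type) (r : seq I) (P : pred I) (F : I -> point -> C) :
  (forall i, niceC (F i)) -> niceC (fun t => \sum_(i <- r | P i) F i t).
Proof.
move=> H; rewrite (_ : (fun t => _) = (fun t => \sum_(i <- [seq i <- r | P i]) F i t)).
  exact: niceC_sum.
by apply: funext => t; rewrite big_filter.
Qed.

Lemma nice_normc f : niceC f -> nice (fun t => Normc.normc (f t)).
Proof.
move=> [[K K0 [BK LK]] [L L0 [BL LL]]]; exists (K + L); first exact: addr_ge0.
split=> [t|t u].
  rewrite ger0_norm ?normc_ge0//; apply: le_trans (normc_le _) _.
  exact: lerD.
apply: le_trans (normc_dist _ _) _; apply: le_trans (normc_le _) _.
rewrite mulrDl; apply: le_trans (lerD (LK t u) (LL t u)).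
by case: (f t) (f u) => [? ?] [].
Qed.

(** Monomials with exponents in Z^d, as required by conjugates and by division by z^g. *)
Definition chi b (t : point) : C := expi (2 * pi * \sum_j (b 0 j)%:~R * t j).

Lemma monomial_chi (a : mindex d) t : monomial a t = chi (ivec a) t.
Proof.
rewrite /monomial /chi /expi.
have -> : \sum_j (ivec a 0 j)%:~R * t j = \sum_(j < d) (a j)%:R * t j => //.
by apply: eq_bigr => j _; rewrite mxE.
Qed.

Lemma chi0 t : chi 0 t = 1.
Proof. by rewrite /chi big1 ?mulr0 ?expi0// => j _; rewrite mxE mul0r. Qed.

Lemma chiD b c t : chi (b + c) t = chi b t * chi c t.
Proof.
rewrite /chi -expiD -mulrDr -big_split/=; congr (expi (_ * _)).
by apply: eq_bigr => j _; rewrite mxE intrD mulrDl.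
Qed.

Lemma chiN b t : chi (- b) t = (chi b t)^*.
Proof.
rewrite /chi -expiN -mulrN -sumrN; congr (expi (_ * _)).
by apply: eq_bigr => j _; rewrite mxE mulrNz mulNr.
Qed.

Lemma normc_chi b t : Normc.normc (chi b t) = 1.
Proof. exact: normc_expi. Qed.

Lemma niceC_chi b : niceC (chi b).
Proof.
split.
  rewrite (_ : (fun t => _) = (fun t => cos (\sum_j (2 * pi * (b 0 j)%:~R) * t j + 0))).
    exact: nice_cos.
  apply: funext => t /=; rewrite addr0 mulr_sumr; congr cos.
  by apply: eq_bigr => j _; rewrite mulrA.
rewrite (_ : (fun t => _) = (fun t => cos (\sum_j (2 * pi * (b 0 j)%:~R) * t j + (- (pi / 2))))).
  exact: nice_cos.
apply: funext => t /=; rewrite cosBpihalf mulr_sumr; congr sin.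
by apply: eq_bigr => j _; rewrite mulrA.
Qed.

Lemma int01_cos (k : int) (c : R) : k != 0 ->
  Rintegral (@lebesgue_measure R) `[0, 1] (fun x => cos (2 * pi * k%:~R * x + c)) = 0.
Proof.
move=> k0; set A := 2 * pi * k%:~R.
have A0 : A != 0.
  by rewrite !mulf_neq0 ?intr_eq0// ?pnatr_eq0// gt_eqF// pi_gt0.
pose F x : R := sin (A * x + c) / A.
have dF (x : R) : is_derive x 1 F (cos (A * x + c)).
  rewrite /F; apply: is_derive_eq; rewrite /GRing.scale /=.
  by field.
have cF (x : R) : {for x, continuous F}.
  by apply: differentiable_continuous; apply/derivable1_diffP; exact: ex_derive.
rewrite /Rintegral (@continuous_FTC2 R _ F) //; last 3 first.
- by apply: derivable_within_continuous => z _; exact: ex_derive.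
- split; first by move=> x _; exact: ex_derive.
  + by apply: cvg_at_right_filter; exact: cF.
  + by apply: cvg_at_left_filter; exact: cF.
- by move=> x _; rewrite derive1E derive_val.
by rewrite /F mulr1 mulr0 add0r [A + c]addrC sin_period -EFinB subrr.
Qed.

Lemma iter_int_cos (s : seq 'I_d) b (c : R) (t : point) : uniq s ->
  has (fun j => b 0 j != 0) s ->
  iter_int s (fun t => cos (2 * pi * \sum_j (b 0 j)%:~R * t j + c)) t = 0.
Proof.
elim: s t => // j s IH t /= /andP[js us].
(* If no later coordinate has a nonzero frequency, the inner integrals leave the cosine unchanged
   and the integral in coordinate j kills it; otherwise the inner integral is already 0. *)
case Hs : (has _ s); first last.
  rewrite orbF => bj.
  have H u : iter_int s (fun t => cos (2 * pi * \sum_j (b 0 j)%:~R * t j + c)) u =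
             cos (2 * pi * \sum_j (b 0 j)%:~R * u j + c).
    elim: s {IH js us} Hs u => // l s IH /= /negbT; rewrite negb_or negbK => /andP[/eqP bl /negbTE Hs] u.
    under eq_Rintegral do rewrite (IH Hs).
    rewrite -[RHS]int01_cst; apply: eq_Rintegral => x _.
    congr (cos (_ * _ + _)); apply: eq_bigr => m _; rewrite /upd.
    by case: eqP => // ->; rewrite bl !mul0r.
  under eq_Rintegral do rewrite H.
  rewrite -[RHS](int01_cos (c + 2 * pi * \sum_(l | l != j) (b 0 l)%:~R * t l) bj).
  apply: eq_Rintegral => x _; rewrite (bigD1 j)//= eqxx mulrDr mulrA -addrA (addrC c).
  congr (cos (_ + (_ * _ + _))); apply: eq_bigr => l /negbTE lj.
  by rewrite lj.
move=> _; rewrite -[RHS](int01_cst 0); apply: eq_Rintegral => x _.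
exact: IH.
Qed.

Lemma torus_int_chi b (z : C) : b != 0 ->
  torus_int (fun t => complex.Re (z * chi b t)) = 0.
Proof.
move=> b0.
have hb : has (fun j => b 0 j != 0) (enum 'I_d).
  apply/hasP; have [j bj] : exists j, b 0 j != 0.
    apply/existsP; apply: contraNT b0; rewrite negb_exists => /forallP H.
    by apply/eqP/rowP => j; rewrite mxE; apply/eqP; have := H j; rewrite negbK.
  by exists j; rewrite ?mem_enum.
have co (c : R) : torus_int (fun t => cos (2 * pi * \sum_j (b 0 j)%:~R * t j + c)) = 0.
  by apply: iter_int_cos => //; exact: enum_uniq.
have nco (c : R) : nice (fun t : point => cos (2 * pi * \sum_j (b 0 j)%:~R * t j + c)).
  rewrite (_ : (fun t => _) = (fun t => cos (\sum_j (2 * pi * (b 0 j)%:~R) * t j + c))).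
    exact: nice_cos.
  apply: funext => t; rewrite mulr_sumr; congr (cos (_ + _)).
  by apply: eq_bigr => j _; rewrite mulrA.
case: z => x y.
rewrite (_ : (fun t => _) = (fun t => x * cos (2 * pi * \sum_j (b 0 j)%:~R * t j + 0) +
   (- y) * cos (2 * pi * \sum_j (b 0 j)%:~R * t j + - (pi / 2)))).
  rewrite torus_intD; first by rewrite !torus_intZ// !co !mulr0 addr0.
    by apply: niceM => //; exact: nice_cst.
  by apply: niceM => //; exact: nice_cst.
by apply: funext => t /=; rewrite addr0 cosBpihalf mulNr.
Qed.

End NiceComplex.

(** * Even exponents: closed sets are contractive *)

Section ListPolynomials.
Variables (R : realType) (d : nat).
Local Notation C := R[i].
Local Notation point := ('I_d -> R).
Implicit Types (G : set (mindex d)) (f g : point -> C) (b c : 'rV[int]_d).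
Local Open Scope complex_scope.
Local Notation "z ^*" := (conjc z) : ring_scope.

(** Exponents may be repeated: the points g, b_i, c_i of the test polynomial need not be distinct.
    [contractive_list] collects the coefficients of equal exponents. *)
Definition lpoly (l : seq (mindex d * C)) : point -> C :=
  fun t => \sum_(q <- l) q.2 * chi (ivec q.1) t.

Lemma niceC_lpoly l : niceC (lpoly l).
Proof.
by apply: niceC_sum => q; apply: niceCM; [exact: niceC_cst|exact: niceC_chi].
Qed.

Lemma contractive_list (p : \bar R) G (l : seq (mindex d * C)) :
  contractive_set p G ->
  Lpnorm p (lpoly [seq q <- l | q.1 \in G]) <= Lpnorm p (lpoly l).
Proof.
move=> H.
pose S := undup [seq q.1 | q <- l].
pose c a : C := \sum_(q <- l | q.1 == a) q.2.
have E G' : trigpoly S G' c = lpoly [seq q <- l | q.1 \in G'].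
  apply: funext => t; rewrite /trigpoly /lpoly big_filter.
  transitivity (\sum_(a <- S | a \in G') \sum_(q <- l | q.1 == a) q.2 * chi (ivec q.1) t).
    by apply: eq_bigr => a _; rewrite /c mulr_suml; apply: eq_bigr => q /eqP ->;
       rewrite monomial_chi.
  rewrite (exchange_big_dep (fun q : mindex d * C => q.1 \in G'))/=; last first.
    by move=> a q aG /eqP ->.
  rewrite big_seq_cond [RHS]big_seq_cond; apply: eq_bigr => q /andP[ql qG].
  rewrite (eq_bigl (pred1 q.1)) => [|a /=]; last first.
    by rewrite [a == _]eq_sym; case: eqP => [<-|_]; rewrite ?qG ?andbF.
  rewrite big_mkcond (bigD1_seq q.1)/= ?undup_uniq ?mem_undup ?map_f//.
  by rewrite eqxx big1 ?addr0// => a /negbTE ->.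
have {H} := H S c (undup_uniq _); rewrite !E.
by rewrite (_ : [seq q <- l | q.1 \in setT] = l)//; apply/all_filterP/allP => q _; rewrite in_setT.
Qed.

(** Trigonometric polynomials with spectrum in S. Only the location of the frequencies is tracked
    through products and conjugates, never the coefficients. *)
Definition inspec (S : set 'rV[int]_d) f := exists2 l : seq (C * 'rV[int]_d),
  forall q, q \in l -> S q.2 & f = fun t => \sum_(q <- l) q.1 * chi q.2 t.

Lemma inspecM (S T : set 'rV[int]_d) f g : inspec S f -> inspec T g ->
  inspec [set x + y | x in S & y in T] (fun t => f t * g t).
Proof.
move=> [l lS ->] [m mT ->].
exists [seq (q.1 * r.1, q.2 + r.2) | q <- l, r <- m].
  move=> _ /allpairsP[[q r] /= [ql rm ->]] /=.
  by exists q.2; [exact: lS|exists r.2; [exact: mT|]].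
apply: funext => t; rewrite big_allpairs_dep/= big_distrlr/=.
apply: eq_bigr => q _; apply: eq_bigr => r _.
by rewrite chiD; ring.
Qed.

Lemma inspec_conj (S : set 'rV[int]_d) f : inspec S f ->
  inspec [set - x | x in S] (fun t => (f t)^*).
Proof.
move=> [l lS ->]; exists [seq (q.1^*, - q.2) | q <- l].
  by move=> _ /mapP[q ql ->] /=; exists q.2 => //; exact: lS.
apply: funext => t; rewrite big_map rmorph_sum/=.
by apply: eq_bigr => q _; rewrite chiN rmorphM.
Qed.

Lemma inspec_sub (S T : set 'rV[int]_d) f : S `<=` T -> inspec S f -> inspec T f.
Proof. by move=> ST [l lS ->]; exists l => // q /lS /ST. Qed.

Lemma torus_int_inspec (S : set 'rV[int]_d) f : inspec S f -> ~ S 0 ->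
  torus_int (fun t => complex.Re (f t)) = 0.
Proof.
move=> [l lS ->] S0.
rewrite (_ : (fun t => _) = (fun t => \sum_(q <- l) complex.Re (q.1 * chi q.2 t))).
  rewrite torus_int_sum => [|q]; last first.
    by have [] := niceCM (niceC_cst d q.1) (niceC_chi R q.2).
  rewrite big_seq big1// => q ql; apply: torus_int_chi.
  by apply: contra_notN S0 => /eqP <-; exact: lS.
apply: funext => t; elim: (l) => [|q l' IH]; first by rewrite !big_nil.
by rewrite !big_cons -IH; case: (_ * _) (\sum_(_ <- _) _) => [? ?] [].
Qed.

Lemma inspec_trigpoly (S : seq (mindex d)) (P : pred (mindex d)) (c : mindex d -> C) :
  inspec [set ivec a | a in [set a | P a]]
    (fun t => \sum_(a <- S | P a) c a * chi (ivec a) t).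
Proof.
exists [seq (c a, ivec a) | a <- S & P a].
  by move=> _ /mapP[a + ->]; rewrite mem_filter => /andP[Pa _]; exists a.
by apply: funext => t; rewrite big_map big_filter.
Qed.

(** The convex function x^(n+1) lies above its tangent at A. Multiplying the bound for n by B leaves
    the excess (n+1) A^n (B - A)^2. *)
Lemma bernoulli_tangent (A B : R) n : 0 <= A -> 0 <= B ->
  A ^+ n.+1 + n.+1%:R * A ^+ n * (B - A) <= B ^+ n.+1.
Proof.
move=> A0 B0; elim: n => [|n IH]; first by rewrite !expr1 expr0; lra.
rewrite [leRHS]exprS; apply: le_trans (ler_wpM2l B0 IH).
have : 0 <= n.+1%:R * A ^+ n * (B - A) ^+ 2.
  by rewrite mulr_ge0 ?sqr_ge0// mulr_ge0 ?exprn_ge0.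
move=> H; rewrite -subr_ge0; apply: le_trans H _.
rewrite -(natr1 n.+1) !exprS le_eqVlt; apply/orP; left; apply/eqP; ring.
Qed.

Lemma ext_closed_contractive n G : ext_closed n G ->
  contractive_set ((2 * n.+1%:R)%:E : \bar R) G.
Proof.
move=> HG S c _.
set f := trigpoly S G c; set g := trigpoly S setT c.
pose h t := \sum_(a <- S | a \notin G) c a * chi (ivec a) t.
have fE : f = fun t => \sum_(a <- S | a \in G) c a * chi (ivec a) t.
  by apply: funext => t; apply: eq_bigr => a _; rewrite monomial_chi.
have gE t : g t = f t + h t.
  rewrite /g /f /trigpoly (bigID (fun a => a \in G))/=; congr (_ + _).
    by apply: eq_bigl => a; rewrite in_setT.
  by apply: eq_big => [a|a _]; rewrite ?in_setT ?monomial_chi.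
have nf : niceC f.
  by rewrite fE; apply: niceC_sumP => q; apply: niceCM; [exact: niceC_cst|exact: niceC_chi].
have nh : niceC h.
  by apply: niceC_sumP => q; apply: niceCM; [exact: niceC_cst|exact: niceC_chi].
have ng : niceC g.
  by rewrite (_ : g = fun t => f t + h t); [exact: niceCD|apply: funext].
have powE (u : point -> C) : (fun t => Normc.normc (u t) `^ (2 * n.+1%:R)) =
    (fun t => (Normc.normc (u t) ^+ 2) ^+ n.+1).
  by apply: funext => t; rewrite -natrM powR_mulrn ?normc_ge0// exprM.
have niceX (F : point -> R) m : nice F -> nice (fun t => F t ^+ m).
  move=> nF; elim: m => [|m IH]; first by under eq_fun do rewrite expr0; exact: nice_cst.
  under eq_fun do rewrite exprS.
  exact: niceM.
have npow (u : point -> C) m : niceC u -> nice (fun t => (Normc.normc (u t) ^+ 2) ^+ m).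
  by move=> nu; apply/niceX/niceX/nice_normc.
(* This is |f|^(2n) conj(f) h, written as a product whose spectrum can be read off. *)
pose k t : C := ((f t * (f t)^*) ^+ n * (f t)^*) * h t.
have kE t : complex.Re (k t) = (Normc.normc (f t) ^+ 2) ^+ n * complex.Re ((f t)^* * h t).
  rewrite /k -mulrA.
  have -> : f t * (f t)^* = (Normc.normc (f t) ^+ 2)%:C.
    rewrite sqr_normc; case: (f t) => x y; apply/eqP; rewrite eq_complex/=.
    by apply/andP; split; apply/eqP; ring.
  rewrite -rmorphXn/=; case: ((f t)^* * h t) => x y /=.
  by rewrite mul0r subr0.
have nk : nice (fun t => (Normc.normc (f t) ^+ 2) ^+ n * complex.Re ((f t)^* * h t)).
  apply: niceM; first exact: npow.
  have nfc : niceC (fun t => (f t)^*).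
    have [f1 f2] := nf; split.
      by rewrite (_ : (fun t => _) = (fun t => complex.Re (f t)))//; apply: funext => t; case: (f t).
    by rewrite (_ : (fun t => _) = (fun t => - complex.Im (f t)));
       [exact: niceN|apply: funext => t; case: (f t)].
  by have [] := niceCM nfc nh.
(* The frequencies of |f|^(2n) f lie in [ext G n], whose points in N_0^d belong to G by closure,
   while those of h are outside G; hence 0 is not a frequency of k. *)
have k0 : torus_int (fun t => complex.Re (k t)) = 0.
  have sf := @inspec_trigpoly S (fun a => a \in G) c; rewrite -fE in sf.
  have sh := @inspec_trigpoly S (fun a => a \notin G) c; rewrite -/h in sh.
  have sff : inspec (diffs G) (fun t => f t * (f t)^*).
    apply: inspec_sub (inspecM sf (inspec_conj sf)).
    move=> _ [_ [a /= aG <-]] [_ [_ [b /= bG <-]] <-] <-.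
    by apply: diffsetI; [exists a => //|exists b => //]; exact: set_mem.
  have sX m : inspec (ext G m) (fun t => (f t * (f t)^*) ^+ m * f t).
    elim: m => [|m IH].
      under eq_fun do rewrite expr0 mul1r.
      apply: inspec_sub sf => _ [a /= aG <-]; exists a => //; exact: set_mem.
    rewrite (_ : (fun t => _) = (fun t => ((f t * (f t)^*) ^+ m * f t) * (f t * (f t)^*))).
      exact: (inspecM IH sff).
    by apply: funext => t; rewrite exprS; ring.
  have sXc : inspec [set - x | x in ext G n] (fun t => (f t * (f t)^*) ^+ n * (f t)^*).
    rewrite (_ : (fun t => _) = (fun t => ((f t * (f t)^*) ^+ n * f t)^*)).
      exact: inspec_conj.
    apply: funext => t; rewrite rmorphM rmorphXn rmorphM/=; congr (_ ^+ _ * _).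
    by rewrite conjcK mulrC.
  apply: (torus_int_inspec (inspecM sXc sh)).
  move=> [_ [x xn <-] [_ [a /= /negP aG <-]]] /eqP.
  rewrite addrC subr_eq0 => /eqP E; apply: aG; apply: mem_set; apply: HG.
  by rewrite E.
(* Tangent inequality with A = |f|^2 and B = |g|^2, together with B - A >= 2 Re(conj(f) h). *)
have pt t : (Normc.normc (f t) ^+ 2) ^+ n.+1 + (n.+1%:R * 2) * complex.Re (k t) <=
    (Normc.normc (g t) ^+ 2) ^+ n.+1.
  apply: le_trans (bernoulli_tangent n (sqr_ge0 (Normc.normc (f t))) (sqr_ge0 _)).
  rewrite lerD2l kE -!mulrA ler_wpM2l// mulrCA ler_wpM2l ?exprn_ge0 ?sqr_ge0//.
    exact: normc_ge0.
  rewrite !sqr_normc gE; case: (f t) (h t) => [x y] [z w] /=.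
  have := sqr_ge0 z; have := sqr_ge0 w; lra.
rewrite /Lpnorm !powE; apply: ge0_ler_powR.
- by rewrite invr_ge0 mulr_ge0.
- by rewrite nnegrE; apply: torus_int_ge0 => [|t]; [exact: npow|rewrite exprn_ge0 ?sqr_ge0].
- by rewrite nnegrE; apply: torus_int_ge0 => [|t]; [exact: npow|rewrite exprn_ge0 ?sqr_ge0].
rewrite -[leLHS]addr0 -[X in _ + X](mulr0 (n.+1%:R * 2)) -k0.
rewrite -torus_intZ; last by rewrite (funext kE).
rewrite -torus_intD; last 2 first.
- exact: npow.
- by apply: niceM; [exact: nice_cst|rewrite (funext kE)].
apply: torus_int_le => //; last exact: npow.
apply: niceD; first exact: npow.
by apply: niceM; [exact: nice_cst|rewrite (funext kE)].
Qed.

End ListPolynomials.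

(** * Binomial expansions and averages over phases *)

Section BinomialSeries.
Variable R : realType.
Implicit Types (s x : R) (k n : nat).

(** The binomial coefficient binom(s, k) of a real number s. *)
Fixpoint gbin s k : R := if k is k'.+1 then gbin s k' * (s - k'%:R) / k%:R else 1.

Lemma gbinS s k : gbin s k.+1 * k.+1%:R = gbin s k * (s - k%:R).
Proof. by rewrite /= divfK ?pnatr_eq0. Qed.

(** Coefficientwise, the derivative of (1 + x)^s is s (1 + x)^(s-1). *)
Lemma gbin_diff s k : gbin s k.+1 * k.+1%:R = s * gbin (s - 1) k.
Proof.
elim: k => [|k IH]; first by rewrite /= subr0 divr1 mul1r.
rewrite gbinS; apply: (@mulIf _ k.+1%:R); first by rewrite pnatr_eq0.
rewrite -[RHS]mulrA gbinS mulrAC IH -(natr1 k); ring.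
Qed.

Lemma gbin_pascal s k : gbin s k.+1 = gbin (s - 1) k.+1 + gbin (s - 1) k.
Proof.
apply: (@mulIf _ k.+1%:R); first by rewrite pnatr_eq0.
by rewrite mulrDl gbin_diff gbinS -(natr1 k); ring.
Qed.

(** Regroups the double sum that arises when powers of a two-term sum are expanded inside the
    binomial series. *)
Lemma gbin_bin s j l : gbin s (j + l) * 'C(j + l, j)%:R = gbin s j * gbin (s - j%:R) l.
Proof.
elim: l => [|l IH]; first by rewrite addn0 binn.
apply: (@mulIf _ l.+1%:R); first by rewrite pnatr_eq0.
rewrite -mulrA -natrM addnS -[RHS]mulrA gbinS mulrA -IH.
have -> : ('C((j + l).+1, j) * l.+1 = (j + l).+1 * 'C(j + l, j))%N.
  by have := mul_bin_down (j + l).+1 j; rewrite subSn ?leq_addr// addKn /= => ->; rewrite mulnC.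
rewrite natrM mulrA gbinS natrD; ring.
Qed.

Lemma powR_bound s : exists2 M : R, 0 <= M & forall x, `|x| <= 1 / 2 -> (1 + x) `^ s <= M.
Proof.
have [s0|s0] := leP 0 s.
  exists (2 `^ s) => [|x]; first exact: powR_ge0.
  rewrite ler_norml => /andP[x1 x2].
  by apply: ge0_ler_powR; rewrite ?nnegrE; lra.
exists ((1 / 2) `^ s) => [|x]; first exact: powR_ge0.
rewrite ler_norml => /andP[x1 x2].
rewrite -(opprK s) powRN [leRHS]powRN lef_pV2 ?posrE ?powR_gt0//; try lra.
by apply: ge0_ler_powR; rewrite ?nnegrE; lra.
Qed.

(** The derivative of the remainder of order n+1 for s is s times the remainder of order n for s -
    1, so the bound follows by induction from the mean value theorem. *)
Lemma powR_taylor s n : exists2 M : R, 0 <= M & forall x, `|x| <= 1 / 2 ->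
  `|(1 + x) `^ s - \sum_(k < n) gbin s k * x ^+ k| <= M * `|x| ^+ n.
Proof.
elim: n s => [|n IH] s.
  have [M M0 HM] := powR_bound s; exists M => // x x2.
  by rewrite big_ord0 subr0 expr0 mulr1 ger0_norm ?powR_ge0//; exact: HM.
have [M M0 HM] := IH (s - 1).
exists (`|s| * M) => [|x x2]; first by rewrite mulr_ge0.
pose g (z : R) := (1 + z) `^ s - \sum_(k < n.+1) gbin s k * z ^+ k.
pose dg (z : R) := s * ((1 + z) `^ (s - 1) - \sum_(k < n) gbin (s - 1) k * z ^+ k).
have dgE (z : R) : `|z| <= 1 / 2 -> is_derive z 1 g (dg z).
  rewrite ler_norml => /andP[z1 z2].
  pose h (k : nat) : R -> R := gbin s k \*: ((id : R -> R) ^+ k).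
  have dh k : is_derive z 1 (h k) (gbin s k * (k%:R * z ^+ k.-1)).
    have D0 : is_derive z 1 (id : R -> R) 1 by exact: is_derive_id.
    have D1 := is_deriveX k D0.
    have D2 := is_deriveZ (gbin s k) D1.
    by apply: is_derive_eq; rewrite /GRing.scale/= mulr1.
  have gE : g = (fun w => (1 + w) `^ s) - \sum_(k < n.+1) h k.
    apply: funext => w; rewrite /g /= fct_sumE; congr (_ - _).
    by apply: eq_bigr => k _; rewrite /h exprfctE.
  rewrite gE /dg mulrBr; apply: is_deriveB; last first.
    have DS := is_derive_sum (fun k : 'I_n.+1 => dh k).
    apply: is_derive_eq.
    rewrite big_ord_recl /= mul0r mulr0 add0r mulr_sumr; apply: eq_bigr => k _.
    by rewrite /bump /= add1n mulrA gbin_diff mulrA.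
  have z0 : 0 < 1 + z by lra.
  have D1 : is_derive z 1 (fun w : R => 1 + w) 1.
    have D0 : is_derive z 1 (id : R -> R) 1 by exact: is_derive_id.
    have D2 := is_deriveD (is_derive_cst (1 : R) z 1) D0.
    by rewrite add0r in D2.
  have := @is_derive1_comp R (fun y => y `^ s) (fun w => 1 + w) z _ _ (is_derive1_powR s z0) D1.
  by rewrite mulr1; apply.
have g0 : g 0 = 0.
  rewrite /g addr0 powR1 big_ord_recl expr0 /= mulr1 big1 ?addr0 ?subrr// => k _.
  by rewrite /bump/= expr0n mulr0.
have bound z : `|z| <= `|x| -> `|dg z| <= `|s| * M * `|x| ^+ n.
  move=> zx; rewrite normrM -mulrA ler_wpM2l//.
  apply: le_trans (HM _ (le_trans zx x2)) _.
  by rewrite ler_wpM2l// lerXn2r ?nnegrE.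
suff [c cx E] : exists2 c, `|c| <= `|x| & g x = dg c * x.
  rewrite -/(g x) E normrM exprSr mulrA ler_wpM2r//; exact: bound.
have [x0|x0] := leP 0 x.
  have xE : `|x| = x by rewrite ger0_norm.
  have D z : z \in `]0, x[ -> is_derive z 1 g (dg z).
    rewrite in_itv/= => /andP[z0 zx]; apply: dgE.
    by rewrite ger0_norm ?(ltW z0)// (le_trans (ltW zx))// -xE.
  have Cg : {within `[0, x], continuous g}.
    apply: derivable_within_continuous => z; rewrite in_itv/= => /andP[z0 zx].
    have Dz : is_derive z 1 g (dg z) by apply: dgE; rewrite ger0_norm// (le_trans zx)// -xE.
    exact: ex_derive.
  have [c] := MVT_segment x0 D Cg.
  rewrite in_itv/= g0 !subr0 => /andP[c0 cx] E; exists c => //.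
  by rewrite xE ger0_norm.
have xE : `|x| = - x by rewrite ltr0_norm.
have zb z : z <= 0 -> x <= z -> `|z| <= `|x| by move=> z0 xz; rewrite xE ler0_norm// lerN2.
have D z : z \in `]x, 0[ -> is_derive z 1 g (dg z).
  rewrite in_itv/= => /andP[xz z0]; apply: dgE; apply: le_trans x2.
  by apply: zb; exact: ltW.
have Cg : {within `[x, 0], continuous g}.
  apply: derivable_within_continuous => z; rewrite in_itv/= => /andP[xz z0].
  have Dz : is_derive z 1 g (dg z) by apply: dgE; apply: le_trans x2; exact: zb.
  exact: ex_derive.
have [c] := MVT_segment (ltW x0) D Cg.
rewrite in_itv/= g0 !sub0r => /andP[xc c0] E; exists c; first exact: zb.
by apply: oppr_inj; rewrite E mulrN.
Qed.

Lemma gbin_eq0 s n : gbin s n = 0 -> exists2 k, (k < n)%N & s = k%:R.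
Proof.
elim: n => [/eqP|n IH]; first by rewrite oner_eq0.
move/eqP; rewrite /= !mulf_eq0 invr_eq0 pnatr_eq0 orbF => /orP[/eqP/IH[k kn ->]|].
  by exists k => //; exact: ltnW.
by rewrite subr_eq0 => /eqP ->; exists n.
Qed.

End BinomialSeries.

Arguments gbin : simpl never.

(** * Truncated binomial series in a complex variable and its conjugate *)

Section ComplexExpansion.
Variable R : realType.
Local Notation C := R[i].
Local Notation normc := Normc.normc.
Implicit Types (s : R) (u : C) (f g : C -> C).
Local Open Scope complex_scope.
Local Notation "z ^*" := (conjc z) : ring_scope.

Definition bigO K f := exists2 M : R, 0 <= M & forall u, normc u <= 1 ->
  normc (f u) <= M * normc u ^+ K.

Lemma bigO0 K : bigO K (fun=> 0).
Proof. by exists 0 => // u _; rewrite Normc.normc0 mul0r. Qed.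

Lemma bigOD K f g : bigO K f -> bigO K g -> bigO K (fun u => f u + g u).
Proof.
move=> [M M0 HM] [N N0 HN]; exists (M + N) => [|u u1]; first exact: addr_ge0.
by apply: le_trans (le_normcD _ _) _; rewrite mulrDl; apply: lerD; [exact: HM|exact: HN].
Qed.

Lemma bigOM K L f g : bigO K f -> bigO L g -> bigO (K + L) (fun u => f u * g u).
Proof.
move=> [M M0 HM] [N N0 HN]; exists (M * N) => [|u u1]; first exact: mulr_ge0.
rewrite Normc.normcM exprD mulrACA.
by apply: ler_pM; rewrite ?normc_ge0//; [exact: HM|exact: HN].
Qed.

Lemma bigON K f : bigO K f -> bigO K (fun u => - f u).
Proof. by move=> [M M0 HM]; exists M => // u u1; rewrite normcN; exact: HM. Qed.

Lemma bigO_le K L f : (K <= L)%N -> bigO L f -> bigO K f.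
Proof.
move=> KL [M M0 HM]; exists M => // u u1; apply: le_trans (HM u u1) _.
by rewrite ler_wpM2l// ler_wiXn2l// normc_ge0.
Qed.

Lemma bigO_cst (z : C) : bigO 0 (fun=> z).
Proof. by exists (normc z) => [|u _]; rewrite ?normc_ge0// expr0 mulr1. Qed.

Lemma bigO_X K : bigO K (fun u => u ^+ K).
Proof. by exists 1 => // u _; rewrite normcX mul1r. Qed.

Lemma bigO_Xc K : bigO K (fun u => u^* ^+ K).
Proof. by exists 1 => // u _; rewrite normcX normc_conj mul1r. Qed.

Lemma bigO_sum K (I : Type) (r : seq I) (F : I -> C -> C) :
  (forall i, bigO K (F i)) -> bigO K (fun u => \sum_(i <- r) F i u).
Proof.
move=> H; elim: r => [|i r IH].
  by under eq_fun do rewrite big_nil; exact: bigO0.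
under eq_fun do rewrite big_cons.
exact: bigOD.
Qed.

(** The series of (1 + u)^s, cut off before degree K; complex powers themselves are never formed. *)
Definition gsum s K u : C := \sum_(k < K) (gbin s k)%:C * u ^+ k.

Lemma bigO_gsum s K : bigO 0 (gsum s K).
Proof.
apply: bigO_sum => k; rewrite -[0%N]addn0; apply: bigOM; first exact: bigO_cst.
by apply: bigO_le (bigO_X k).
Qed.

Lemma bigO_gsumB s K L : (K <= L)%N -> bigO K (fun u => gsum s L u - gsum s K u).
Proof.
move=> KL; rewrite (_ : (fun u => _) = (fun u =>
    \sum_(k <- index_iota K L) (gbin s k)%:C * u ^+ k)); last first.
  apply: funext => u; rewrite /gsum -!(big_mkord xpredT (fun k => (gbin s k)%:C * u ^+ k)).
  by rewrite (big_cat_nat (leq0n K) KL)/= addrAC subrr add0r.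
rewrite (_ : (fun u => _) = (fun u => \sum_(k <- index_iota K L)
    if (K <= k)%N then (gbin s k)%:C * u ^+ k else 0)); last first.
  apply: funext => u; rewrite -[RHS]big_mkcond big_seq_cond [RHS]big_seq_cond.
  by apply: eq_bigl => k; rewrite mem_index_iota; case: (K <= k)%N; rewrite ?andbF ?andbT.
apply: bigO_sum => k; case Kk : (K <= k)%N; last exact: bigO0.
rewrite -[K]add0n; apply: bigOM; first exact: bigO_cst.
exact: bigO_le (bigO_X k).
Qed.

(** By Pascal's rule, the truncation error in (1 + u) (1 + u)^(s-1) = (1 + u)^s is a single monomial
    of degree K. *)
Lemma bigO_pascal s K : bigO K (fun u => (1 + u) * gsum (s - 1) K u - gsum s K u).
Proof.
case: K => [|K].
  by under eq_fun do rewrite /gsum !big_ord0 mulr0 subr0; exact: bigO0.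
have E u : (1 + u) * gsum (s - 1) K.+1 u - gsum s K.+1 u =
    (gbin (s - 1) K)%:C * u ^+ K.+1.
  elim: K => [|K IH].
    rewrite /gsum !big_ord_recr !big_ord0 /= !expr0 expr1 /gbin; ring.
  rewrite /gsum ![\sum_(k < K.+2) _]big_ord_recr/= -/(gsum _ _ _) -/(gsum s _ _).
  rewrite (gbin_pascal s) rmorphD/= mulrDr opprD addrACA IH !exprS; ring.
under eq_fun do rewrite E.
rewrite -[K.+1]add0n; apply: bigOM; [exact: bigO_cst|exact: bigO_X].
Qed.

Lemma bigO_pascalX s j K :
  bigO K (fun u => (1 + u) ^+ j * gsum (s - j%:R) K u - gsum s K u).
Proof.
elim: j s => [|j IH] s.
  by under eq_fun do rewrite subr0 expr0 mul1r subrr; exact: bigO0.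
rewrite (_ : (fun u => _) = (fun u => (1 + u) * ((1 + u) ^+ j *
   gsum (s - 1 - j%:R) K u - gsum (s - 1) K u) +
   ((1 + u) * gsum (s - 1) K u - gsum s K u))); last first.
  apply: funext => u; rewrite -(natr1 j) exprS.
  have -> : s - (j%:R + 1) = s - 1 - j%:R by ring.
  ring.
apply: bigOD (bigO_pascal _ _).
rewrite -[K]add0n; apply: bigOM (IH _).
apply: bigOD (bigO_cst _) _; exact: bigO_le (bigO_X 1).
Qed.

(* With X = u + u^* + u u^*, i.e. 1 + X = |1 + u|^2, this is the formal identity
   (1 + X)^s = (1 + u)^s (1 + u^* )^s, truncated at order K. *)
Lemma bigO_factor s K :
  bigO K (fun u => gsum s K (u + u^* + u * u^*) - gsum s K u * gsum s K u^*).
Proof.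
(* With X = u + conj(u) (1 + u), this collects the terms with the j-th power of conj(u) (1 + u); the
   factor (1 + u)^j (1 + u)^(s-j) then gives (1 + u)^s up to order K - j. *)
pose g j u : C := (gbin s j)%:C * (u^* ^+ j * ((1 + u) ^+ j * gsum (s - j%:R) (K - j) u)).
have E u : gsum s K (u + u^* + u * u^*) = \sum_(j < K) g j u.
  have -> : u + u^* + u * u^* = u + u^* * (1 + u) by ring.
  transitivity (\sum_(k < K) \sum_(j < K)
      (gbin s k)%:C * (u ^+ (k - j) * (u^* * (1 + u)) ^+ j *+ 'C(k, j))).
    apply: eq_bigr => k _; rewrite exprDn mulr_sumr.
    rewrite (big_ord_widen K (fun j => (gbin s k)%:C *
      (u ^+ (k - j) * (u^* * (1 + u)) ^+ j *+ 'C(k, j))))//.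
    rewrite big_mkcond; apply: eq_bigr => j _; case: ltnP => // kj.
    by rewrite bin_small// mulr0n mulr0.
  rewrite exchange_big/=; apply: eq_bigr => j _.
  rewrite -(big_mkord xpredT (fun k => (gbin s k)%:C *
      (u ^+ (k - j) * (u^* * (1 + u)) ^+ j *+ 'C(k, j)))).
  rewrite (big_cat_nat (leq0n j))/=; last exact: ltnW.
  rewrite big_nat_cond big1 ?add0r; last first.
    by move=> k /andP[/andP[_ kj] _]; rewrite bin_small// mulr0n mulr0.
  rewrite -[X in index_iota X]add0n big_addn big_mkord /g /gsum !mulr_sumr.
  apply: eq_bigr => l _; rewrite addnK addnC.
  rewrite exprMn -mulr_natr.
  transitivity ((gbin s (j + l) * 'C(j + l, j)%:R)%:C * (u ^+ l * (u^* ^+ j * (1 + u) ^+ j))).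
    by rewrite rmorphM/= rmorph_nat; ring.
  by rewrite gbin_bin rmorphM/=; ring.
rewrite (_ : (fun u => _) = (fun u => \sum_(j < K) (g j u -
    (gbin s j)%:C * (u^* ^+ j * gsum s K u)))); last first.
  apply: funext => u; rewrite E sumrB; congr (_ - _).
  by rewrite mulrC {1}/gsum mulr_suml; apply: eq_bigr => j _; rewrite mulrA.
have : forall j : 'I_K, (j <= K)%N by move=> j; exact: ltnW.
move=> H; apply: bigO_sum => j.
rewrite (_ : (fun u => _) = (fun u => (gbin s j)%:C * (u^* ^+ j *
   (((1 + u) ^+ j * gsum (s - j%:R) (K - j) u - gsum s (K - j) u) +
    - (gsum s K u - gsum s (K - j) u))))); last first.
  by apply: funext => u; rewrite /g; ring.
rewrite -[K in bigO K]add0n; apply: bigOM; first exact: bigO_cst.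
rewrite -{1}(subnKC (H j)); apply: bigOM; first exact: bigO_Xc.
apply: bigOD; first exact: bigO_pascalX.
by apply: bigON; apply: bigO_gsumB; exact: leq_subr.
Qed.

(** Truncated form of |1 + u|^(2(s-1)) (1 + conj u) = (1 + u)^(s-1) (1 + conj u)^s. The left side,
    up to the factor 2s, gives the derivative of |1 + u|^(2s). *)
Lemma bigO_gradient s K : bigO K (fun u =>
  (1 + u^*) * gsum (s - 1) K (u + u^* + u * u^*) - gsum (s - 1) K u * gsum s K u^*).
Proof.
have O1 : bigO 0 (fun u => 1 + u^*).
  by apply: bigOD (bigO_cst _) _; apply: bigO_le (bigO_Xc 1).
have Op : bigO K (fun u => (1 + u^*) * gsum (s - 1) K u^* - gsum s K u^*).
  have [M M0 HM] := bigO_pascal s K; exists M => // u u1.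
  by have := HM u^*; rewrite !normc_conj; exact.
rewrite (_ : (fun u => _) = (fun u => (1 + u^*) * (gsum (s - 1) K (u + u^* + u * u^*) -
    gsum (s - 1) K u * gsum (s - 1) K u^*) +
    gsum (s - 1) K u * ((1 + u^*) * gsum (s - 1) K u^* - gsum s K u^*))); last first.
  by apply: funext => u; ring.
apply: bigOD; rewrite -[K in bigO K]add0n; apply: bigOM => //.
  exact: bigO_factor.
exact: bigO_gsum.
Qed.

End ComplexExpansion.

Section TangentBound.
Variable R : realType.
Local Notation C := R[i].
Local Notation normc := Normc.normc.
Implicit Types (s : R) (u : C).
Local Open Scope complex_scope.
Local Notation "z ^*" := (conjc z) : ring_scope.

(** First order expansion in e, with the derivative replaced by its polynomial truncation in u. The
    truncation costs |e| |u|^K and the second order remainder costs |e|^2. *)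
Lemma power_tangent_bound s K : 0 < s -> exists2 M : R, 0 <= M &
  forall u e : C, normc u <= 1 / 16 -> normc e <= 1 / 16 ->
  normc (1 + u + e) `^ (2 * s) <= normc (1 + u) `^ (2 * s) +
    2 * s * complex.Re (e * (gsum (s - 1) K u * gsum s K u^*)) +
    M * (normc e * normc u ^+ K + normc e ^+ 2).
Proof.
move=> s0.
have [M1 M10 T1] := powR_taylor s 2.
have [M2 M20 B2] := powR_bound s.
have [M3 M30 B3] := powR_bound (s - 1).
have [M4 M40 T4] := powR_taylor (s - 1) K.
have [M5 M50 O5] := bigO_gradient s K.
exists (M2 * M1 * 18 + s * M3 + 2 * s * (2 * M4 * 3 ^+ K) + 2 * s * M5).
  by rewrite !addr_ge0 ?mulr_ge0 ?exprn_ge0// ltW.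
move=> u e u16 e16.
have v0 := normc_ge0 u; have d0 := normc_ge0 e.
set v := normc u in u16 v0 *; set d := normc e in e16 d0 *.
pose X := 2 * complex.Re u + v ^+ 2.
have XE : normc (1 + u) ^+ 2 = 1 + X.
  by rewrite /X /v !sqr_normc; case: (u) => a b /=; ring.
have v2 : v ^+ 2 <= v by rewrite expr2 ler_piMl//; lra.
have Xv : `|X| <= 3 * v.
  have := Re_le_normc u; rewrite -/v => Hu; have := sqr_ge0 v.
  move: Hu; rewrite !ler_norml /X => /andP[Hu1 Hu2] v2'.
  by apply/andP; clear - v2 v2' v0 Hu1 Hu2; split; lra.
have X2 : `|X| <= 1 / 2 by clear - Xv u16; lra.
pose rho := complex.Re (e * (1 + u^*)).
pose D := 2 * rho + d ^+ 2.
have DE : normc (1 + u + e) ^+ 2 = 1 + X + D.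
  by rewrite -XE /D /rho /d !sqr_normc; case: (u) (e) => a b [a' b'] /=; ring.
have rhod : `|rho| <= 2 * d.
  apply: le_trans (Re_le_normc _) _; rewrite Normc.normcM -/d mulrC ler_wpM2r//.
  apply: le_trans (le_normcD _ _) _; rewrite Normc.normc1 normc_conj -/v.
  by clear - u16; lra.
have d2 : d ^+ 2 <= d / 16 by rewrite expr2 ler_wpM2l//; clear - e16; lra.
have Dd3 : `|D| <= 3 * d.
  have r1 : `|rho| <= 17 / 16 * d.
    apply: le_trans (Re_le_normc _) _; rewrite Normc.normcM -/d mulrC ler_wpM2r//.
    apply: le_trans (le_normcD _ _) _; rewrite Normc.normc1 normc_conj -/v.
    by clear - u16; lra.
  have d2' := sqr_ge0 d; move: r1; rewrite !ler_norml /D => /andP[r1 r2].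
  by apply/andP; clear - d2 d2' d0 r1 r2; split; lra.
have a0 : 13 / 16 <= 1 + X.
  by move: Xv; rewrite ler_norml => /andP[X1 _]; clear - u16 X1; lra.
have ap : 0 < 1 + X by clear - a0; lra.
(* The relative increment; the radius 1/16 keeps both X and [del] in the range of [powR_taylor]. *)
pose del := D / (1 + X).
have del2 : `|del| <= 1 / 2.
  rewrite normrM normfV (gtr0_norm ap) ler_pdivrMr//; clear - Dd3 e16 a0; lra.
have sqE (z : C) : normc z `^ (2 * s) = (normc z ^+ 2) `^ s.
  by rewrite powRrM powR_mulrn ?normc_ge0.
rewrite !sqE DE XE.
have -> : 1 + X + D = (1 + X) * (1 + del) by rewrite /del; field; rewrite gt_eqF.
have del1 : 0 <= 1 + del.
  by move: del2; rewrite ler_norml => /andP[e1 _]; clear - e1; lra.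
rewrite powRM ?(ltW ap)//.
have H1 : (1 + del) `^ s <= 1 + s * del + M1 * del ^+ 2.
  have := T1 del del2; rewrite !big_ord_recr big_ord0 /= expr0 expr1 /gbin/=.
  rewrite real_normK ?num_real// ler_norml => /andP[_]; clear; lra.
apply: le_trans (ler_wpM2l (powR_ge0 _ _) H1) _.
have A1 : (1 + X) `^ s * del = (1 + X) `^ (s - 1) * D.
  by rewrite -(mulr_powRB1 (ltW ap) s0) /del; field; rewrite gt_eqF.
have del18 : del ^+ 2 <= 18 * d ^+ 2.
  rewrite /del expr_div_n ler_pdivrMr ?exprn_gt0//.
  have E1 : D ^+ 2 <= 9 * d ^+ 2.
    rewrite -[D ^+ 2]real_normK ?num_real//.
    have -> : 9 * d ^+ 2 = (3 * d) ^+ 2 by ring.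
    by rewrite ler_pXn2r// nnegrE mulr_ge0.
  apply: le_trans E1 _.
  have -> : 18 * d ^+ 2 * (1 + X) ^+ 2 = 9 * d ^+ 2 * (2 * (1 + X) ^+ 2) by ring.
  rewrite -[leLHS]mulr1 ler_wpM2l ?mulr_ge0 ?sqr_ge0//.
  by clear - a0; nra.
have P2 : (1 + X) `^ s <= M2 by exact: B2.
have P3 : (1 + X) `^ (s - 1) <= M3 by exact: B3.
have Q1 : (1 + X) `^ s * (M1 * del ^+ 2) <= M2 * M1 * 18 * d ^+ 2.
  rewrite -!mulrA; apply: ler_pM => //; first exact: powR_ge0.
    by rewrite mulr_ge0 ?sqr_ge0.
  by rewrite ler_wpM2l.
have Q2 : s * ((1 + X) `^ (s - 1) * d ^+ 2) <= s * M3 * d ^+ 2.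
  by rewrite -mulrA ler_wpM2l ?(ltW s0)// ler_wpM2r ?sqr_ge0.
pose G := \sum_(k < K) gbin (s - 1) k * X ^+ k.
have GE : G%:C = gsum (s - 1) K (u + u^* + u * u^*).
  rewrite /G rmorph_sum/=; apply: eq_bigr => k _; rewrite rmorphM rmorphXn/=.
  congr (_ * _ ^+ _); rewrite /X /v sqr_normc; case: (u) => a b.
  by apply/eqP; rewrite eq_complex /=; apply/andP; split; apply/eqP; ring.
have Xk : `|X| ^+ K <= 3 ^+ K * v ^+ K.
  by rewrite -exprMn lerXn2r// nnegrE mulr_ge0.
have vK : 0 <= v ^+ K by exact: exprn_ge0.
have Q3 : (1 + X) `^ (s - 1) * rho <= G * rho + 2 * M4 * 3 ^+ K * (d * v ^+ K).
  rewrite -lerBlDl -mulrBl; apply: le_trans (ler_norm _) _; rewrite normrM.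
  have -> : 2 * M4 * 3 ^+ K * (d * v ^+ K) = (M4 * (3 ^+ K * v ^+ K)) * (2 * d) by ring.
  apply: ler_pM => //; apply: le_trans (T4 _ X2) _; exact: ler_wpM2l.
have Q4 : G * rho <= complex.Re (e * (gsum (s - 1) K u * gsum s K u^*)) + M5 * (d * v ^+ K).
  have -> : G * rho = complex.Re (e * ((1 + u^*) * gsum (s - 1) K (u + u^* + u * u^*))).
    by rewrite mulrA -GE mulrC /rho; case: (e * (1 + u^*)) => a b /=; ring.
  set p1 := (1 + u^*) * _; set p2 := gsum _ _ _ * _.
  have -> : e * p1 = e * p2 + e * (p1 - p2) by ring.
  have ReD (z1 z2 : C) : complex.Re (z1 + z2) = complex.Re z1 + complex.Re z2.
    by case: z1 z2 => ? ? [].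
  rewrite ReD lerD2l; apply: le_trans (ler_norm _) _.
  apply: le_trans (Re_le_normc _) _; rewrite Normc.normcM -/d mulrCA ler_wpM2l//.
  by apply: O5; rewrite -/v; clear - u16; lra.
have Q34 : 2 * s * ((1 + X) `^ (s - 1) * rho) <=
    2 * s * (complex.Re (e * (gsum (s - 1) K u * gsum s K u^*)) + M5 * (d * v ^+ K) +
             2 * M4 * 3 ^+ K * (d * v ^+ K)).
  by rewrite ler_wpM2l ?mulr_ge0 ?(ltW s0)//; clear - Q3 Q4; lra.
have -> : (1 + X) `^ s * (1 + s * del + M1 * del ^+ 2) = (1 + X) `^ s +
   2 * s * ((1 + X) `^ (s - 1) * rho) + s * ((1 + X) `^ (s - 1) * d ^+ 2) +
   (1 + X) `^ s * (M1 * del ^+ 2).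
  rewrite 2!mulrDr mulr1 mulrCA A1 /D; ring.
have pos1 : 0 <= (M2 * M1 * 18 + s * M3) * (d * v ^+ K).
  by clear - M10 M20 M30 s0 d0 vK; rewrite !(mulr_ge0, addr_ge0)// ltW.
have pos2 : 0 <= (2 * s * (2 * M4 * 3 ^+ K) + 2 * s * M5) * d ^+ 2.
  by clear - M40 M50 s0 d0; rewrite !(mulr_ge0, addr_ge0, sqr_ge0, exprn_ge0)// ltW.
move: Q1 Q2 Q34 pos1 pos2; clear; lra.
Qed.

End TangentBound.

(** * Averages over fourth roots of unity *)

Section Averaging.
Variable R : realType.
Local Notation C := R[i].
Local Notation normc := Normc.normc.
Implicit Types (s : R) (u y w : C) (l : seq (bool * C)).
Local Open Scope complex_scope.
Local Notation "z ^*" := (conjc z) : ring_scope.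

Definition imu : C := Complex 0 1.

Arguments imu : simpl never.

(** Signs alone would not do: the sum of w^2 over the phases has to vanish while that of |w|^2 does
    not. Fourth roots of unity achieve this with integer coordinates. *)
Definition roots4 : seq C := [:: 1; imu; -1; - imu].

Fixpoint phases J : seq (seq C) :=
  if J is J'.+1 then [seq w :: ws | w <- roots4, ws <- phases J'] else [:: [::]].

Definition wsum (ws : seq C) l : C := \sum_(q <- zip ws l) q.1 * q.2.2.

(** The flag is true for the b_i and false for the c_i, which enter alpha with a minus sign and
    hence appear conjugated. *)
Definition wchar (ws : seq C) l : C :=
  \prod_(q <- zip ws l) (if q.2.1 then q.1 * q.2.2 else (q.1 * q.2.2)^*).

(** Left unnormalised; the number of phases is the power of 4 in [wmeanE]. *)
Definition wmean l a b : C :=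
  \sum_(ws <- phases (size l)) wchar ws l * (wsum ws l ^+ a * (wsum ws l)^* ^+ b).

Definition flip l : seq (bool * C) := [seq (~~ q.1, q.2) | q <- l].

Lemma wsum_flip ws l : wsum ws (flip l) = wsum ws l.
Proof.
by elim: l ws => [|q l IH] [|w ws]; rewrite /wsum/= ?big_nil// !big_cons -!/(wsum _ _) IH.
Qed.

Lemma wchar_flip ws l : wchar ws (flip l) = (wchar ws l)^*.
Proof.
elim: l ws => [|[b y] l IH] [|w ws]; rewrite /wchar/= ?big_nil ?rmorph1//.
rewrite !big_cons -!/(wchar _ _) IH [RHS]rmorphM/=; congr (_ * _).
by case: b => //=; rewrite conjcK.
Qed.

Lemma wmean_flip l a b : wmean (flip l) a b = (wmean l b a)^*.
Proof.
rewrite /wmean size_map rmorph_sum/=; apply: eq_bigr => ws _.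
rewrite wsum_flip wchar_flip 2!rmorphM !rmorphXn/= conjcK; congr (_ * _); exact: mulrC.
Qed.

(** Expand both powers in the first letter. Lower moments of l vanish, so the degree in that letter
    is at most 1, and the sum over its phase kills everything except one conjugated factor, which
    can be chosen in b ways. *)
Lemma wmean_cons_true l y a b : normc y = 1 ->
  (forall i m, (i + m < size l)%N -> wmean l i m = 0) -> (a + b <= (size l).+1)%N ->
  wmean ((true, y) :: l) a b = 4%:R * b%:R * wmean l a b.-1.
Proof.
move=> y1 H ab.
pose P (i m : nat) : C := \sum_(w <- roots4) (w * y) * ((w * y) ^+ i * (w * y)^* ^+ m).
pose T i m := P (a - i)%N (b - m)%N * ('C(a, i)%:R * 'C(b, m)%:R) * wmean l i m.
have yy : y * y^* = 1.
  by apply/eqP; rewrite eq_complex; move: (sqr_normc y); rewrite y1 expr1n;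
    case: (y) => p q /= H1; apply/andP; split; apply/eqP; [rewrite H1|]; ring.
have ii : imu * imu = -1.
  by apply/eqP; rewrite eq_complex/= !(mul0r, mulr0, mul1r, addr0, sub0r, oppr0) !eqxx.
have ic : Complex 0 (-1) = - imu by apply/eqP; rewrite eq_complex/= oppr0 !eqxx.
have P00 : P 0%N 0%N = 0.
  by rewrite /P /roots4 !big_cons big_nil !expr0; ring.
have P10 : P 1%N 0%N = 0.
  rewrite /P /roots4 !big_cons big_nil !expr0 !expr1.
  transitivity (2%:R * y * y * (1 + imu * imu)); first by ring.
  by rewrite ii subrr mulr0.
have P01 : P 0%N 1%N = 4%:R.
  rewrite /P /roots4 !big_cons big_nil !expr0 !expr1 !rmorphM !rmorphN rmorph1/= ic.
  transitivity (2%:R * (y * y^*) * (1 - imu * imu)); first by ring.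
  by rewrite yy ii; ring.
have E : wmean ((true, y) :: l) a b = \sum_(i < a.+1) \sum_(m < b.+1) T i m.
  rewrite {1}/wmean -[phases _]/([seq w :: ws | w <- roots4, ws <- phases (size l)]).
  rewrite big_allpairs_dep.
  transitivity (\sum_(w <- roots4) \sum_(i < a.+1) \sum_(m < b.+1)
     (w * y) * ((w * y) ^+ (a - i) * (w * y)^* ^+ (b - m)) *
     ('C(a, i)%:R * 'C(b, m)%:R) * wmean l i m).
    apply: eq_bigr => w _.
    transitivity (\sum_(ws <- phases (size l)) \sum_(i < a.+1) \sum_(m < b.+1)
     (w * y) * ((w * y) ^+ (a - i) * (w * y)^* ^+ (b - m)) *
     ('C(a, i)%:R * 'C(b, m)%:R) * (wchar ws l * (wsum ws l ^+ i * (wsum ws l)^* ^+ m))).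
      apply: eq_bigr => ws _.
      rewrite /wchar /wsum /= !big_cons/= -!/(wsum _ _) -!/(wchar _ _).
      rewrite rmorphD/= !exprDn big_distrlr/= mulr_sumr; apply: eq_bigr => i _.
      rewrite mulr_sumr; apply: eq_bigr => m _.
      by rewrite -(mulr_natr _ 'C(a, i)) -(mulr_natr _ 'C(b, m)); ring.
    rewrite exchange_big/=; apply: eq_bigr => i _.
    rewrite exchange_big/=; apply: eq_bigr => m _.
    by rewrite -mulr_sumr.
  rewrite exchange_big/=; apply: eq_bigr => i _.
  rewrite exchange_big/=; apply: eq_bigr => m _.
  by rewrite -mulr_suml -mulr_suml.
have T0 i m : (i <= a)%N -> (m <= b)%N -> (i, m) != (a, b.-1) -> (i, m) != (a, b) -> T i m = 0.
  move=> ia mb n1 n2; rewrite /T.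
  have [Hi|Hi] := ltnP (i + m)%N (size l); first by rewrite H// mulr0.
  have /eqP e1 : (a - i == 1)%N.
    by move: n1 n2; rewrite !xpair_eqE; lia.
  have /eqP e2 : (b - m == 0)%N.
    by move: n1 n2; rewrite !xpair_eqE; lia.
  by rewrite e1 e2 P10 !mul0r.
have Tab : T a b = 0 by rewrite /T !subnn P00 !mul0r.
rewrite E big_ord_recr/= big1 ?add0r; last first.
  move=> i _; apply: big1 => m _; apply: T0.
  - exact: ltnW.
  - by rewrite -ltnS.
  - by rewrite xpair_eqE ltn_eqF.
  - by rewrite xpair_eqE ltn_eqF.
rewrite big_ord_recr/= Tab addr0.
case: b => [|b] in ab T T0 Tab E *; first by rewrite big_ord0 mulr0 mul0r.
rewrite big_ord_recr/= big1 ?add0r; last first.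
  move=> m _; apply: T0 => //.
  - by have := ltn_ord m; lia.
  - by rewrite xpair_eqE eqxx/= ltn_eqF.
  - by have := ltn_ord m; rewrite xpair_eqE eqxx/=; lia.
by rewrite /T subnn subSnn P01 binn binSn mul1r.
Qed.

(** In a surviving term each letter occurs exactly once and cancels its occurrence in [wchar]: true
    letters come from conj(u), false ones from u. The factorials count the orders of the factors. A
    false letter is reduced to a true one by conjugation. *)
Lemma wmeanE l a b : (forall q, q \in l -> normc q.2 = 1) -> (a + b <= size l)%N ->
  wmean l a b = if (a == count (fun q => ~~ q.1) l) && (b == count (fun q => q.1) l)
                then (4 ^ size l * (a`! * b`!))%:R else 0.
Proof.
elim: l a b => [|[sg y] l IH] a b H /=.
  rewrite leqn0 addn_eq0 => /andP[/eqP-> /eqP->].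
  by rewrite /wmean/= big_seq1 /wchar/= big_nil !expr0 !mulr1.
move=> ab.
have y1 : normc y = 1 by apply: (H (sg, y)); rewrite inE eqxx.
have Hl q : q \in l -> normc q.2 = 1 by move=> ql; apply: H; rewrite inE ql orbT.
have {}IH i m : (i + m <= size l)%N -> _ := IH i m Hl.
have cl : (count (fun q => ~~ q.1) l + count (fun q => q.1) l)%N = size l.
  by rewrite addnC -(count_predC (fun q : bool * C => q.1)).
have small i m : (i + m < size l)%N -> wmean l i m = 0.
  move=> im; rewrite (IH _ _ (ltnW im)); case: ifP => [/andP[/eqP i1 /eqP m1]|_ //].
  by move: im; rewrite i1 m1 cl ltnn.
case: sg H => H.
  rewrite wmean_cons_true//= add0n.
  case: b ab => [|b] ab; first by rewrite mulr0 mul0r andbF.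
  rewrite addnS ltnS in ab; rewrite [_.-1]/= (IH _ _ ab) add1n eqSS.
  case: ifP => _; last by rewrite mulr0.
  rewrite expnS factS -!natrM; congr _%:R; ring.
have -> : wmean ((false, y) :: l) a b = (wmean ((true, y) :: flip l) b a)^*.
  by rewrite -wmean_flip/= /flip -map_comp; congr (wmean (_ :: _) a b);
     rewrite -[LHS]map_id; apply: eq_map => -[q z]/=; rewrite negbK.
rewrite wmean_cons_true ?size_map//; last first.
- by rewrite addnC.
- by move=> i m im; rewrite wmean_flip small ?rmorph0// addnC.
rewrite wmean_flip 2!rmorphM !rmorph_nat add0n [X in _ * X = _]conjcK.
case: a ab => [|a] ab; first by rewrite mulr0 mul0r.
rewrite addSn ltnS in ab; rewrite [_.-1]/= (IH _ _ ab) add1n eqSS.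
case: ifP => _; last by rewrite mulr0.
rewrite expnS factS -!natrM; congr _%:R; ring.
Qed.

Lemma phases_unit J ws w : ws \in phases J -> w \in ws -> normc w = 1.
Proof.
elim: J ws => [|J IH] ws; first by rewrite inE => /eqP ->.
rewrite [phases _]/([seq w :: ws | w <- roots4, ws <- phases J]).
move=> /allpairsP[[w' ws'] /= [w1 w2 ->]]; rewrite inE => /orP[/eqP->|]; last exact: IH.
have n1 : normc (1 : C) = 1 by exact: Normc.normc1.
have ni : normc imu = 1 by rewrite /imu /= expr0n expr1n add0r sqrtr1.
by move: w1; rewrite !inE => /or4P[]/eqP->; rewrite ?normcN.
Qed.

Lemma phases_size J ws : ws \in phases J -> size ws = J.
Proof.
elim: J ws => [|J IH] ws; first by rewrite inE => /eqP ->.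
rewrite [phases _]/([seq w :: ws | w <- roots4, ws <- phases J]).
by move=> /allpairsP[[w' ws'] /= [w1 w2 ->]] /=; rewrite IH.
Qed.

Lemma normc_wsum ws l : (forall w, w \in ws -> normc w = 1) ->
  (forall q, q \in l -> normc q.2 = 1) -> normc (wsum ws l) <= (size l)%:R.
Proof.
elim: l ws => [|q l IH] [|w ws] Hw Hl; rewrite /wsum/= ?big_nil ?Normc.normc0//.
rewrite big_cons -/(wsum _ _); apply: le_trans (le_normcD _ _) _.
rewrite -natr1 addrC; apply: lerD.
  apply: IH => z zs; [apply: Hw|apply: Hl]; by rewrite inE zs orbT.
by rewrite Normc.normcM Hw ?Hl ?mulr1// inE eqxx.
Qed.

Lemma normc_wchar ws l : (forall w, w \in ws -> normc w = 1) ->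
  (forall q, q \in l -> normc q.2 = 1) -> normc (wchar ws l) = 1.
Proof.
elim: l ws => [|q l IH] [|w ws] Hw Hl; rewrite /wchar/= ?big_nil ?Normc.normc1//.
rewrite big_cons -/(wchar _ _) Normc.normcM IH; last 2 first.
- by move=> z zs; apply: Hw; rewrite inE zs orbT.
- by move=> z zs; apply: Hl; rewrite inE zs orbT.
rewrite mulr1; case: ifP => _; rewrite ?normc_conj Normc.normcM Hw ?Hl ?mulr1// inE eqxx //.
Qed.

End Averaging.

Section AveragedGap.
Variable R : realType.
Local Notation C := R[i].
Local Notation normc := Normc.normc.
Implicit Types (s r : R) (l : seq (bool * C)).
Local Open Scope complex_scope.
Local Notation "z ^*" := (conjc z) : ring_scope.

Definition balanced n l := [/\ size l = (2 * n)%N, count (fun q => q.1) l = n &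
  forall q, q \in l -> normc q.2 = 1].

Definition avg_const s n : R :=
  gbin (s - 1) n * gbin s n * (4 ^ (2 * n) * (n`! * n`!))%:R.

(* Averaging over the phases kills every monomial of degree at most 2n in u, u^*
   except u^n (u^* )^n, which carries the coefficient [avg_const]. *)
Lemma avg_gradient s n : exists2 M : R, 0 <= M & forall r l, 0 < r <= 1 -> balanced n l ->
  normc (\sum_(ws <- phases R (2 * n)) wchar ws l *
     (gsum (s - 1) (2 * n).+1 (r%:C * wsum ws l) *
      gsum s (2 * n).+1 (r%:C * wsum ws l)^*) - (avg_const s n * r ^+ (2 * n))%:C)
  <= M * r ^+ (2 * n).+1.
Proof.
set J := (2 * n)%N; set K := J.+1.
pose N := \sum_(ws <- phases R J) (1 : R).
pose M := \sum_(i < K) \sum_(j < K) `|gbin (s - 1) i| * `|gbin s j| * (N * (J%:R ^+ i * J%:R ^+ j)).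
have N0 : 0 <= N by apply: sumr_ge0.
exists M => [|r l /andP[r0 r1] [sl cl ul]].
  by apply: sumr_ge0 => i _; apply: sumr_ge0 => j _; rewrite !mulr_ge0 ?exprn_ge0.
have cl' : count (fun q => ~~ q.1) l = n.
  have H := count_predC (fun q : bool * C => q.1) l; rewrite cl sl in H.
  by apply: (@addnI n); rewrite [LHS]H; lia.
pose T i j : C := (gbin (s - 1) i * gbin s j * r ^+ (i + j))%:C * wmean l i j.
have E : \sum_(ws <- phases R J) wchar ws l * (gsum (s - 1) K (r%:C * wsum ws l) *
    gsum s K (r%:C * wsum ws l)^*) = \sum_(i < K) \sum_(j < K) T i j.
  transitivity (\sum_(ws <- phases R J) \sum_(i < K) \sum_(j < K)
     (gbin (s - 1) i * gbin s j * r ^+ (i + j))%:C *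
     (wchar ws l * (wsum ws l ^+ i * (wsum ws l)^* ^+ j))).
    apply: eq_bigr => ws _; rewrite /gsum big_distrlr/= mulr_sumr; apply: eq_bigr => i _.
    rewrite mulr_sumr; apply: eq_bigr => j _.
    have -> : (r%:C * wsum ws l)^* = r%:C * (wsum ws l)^*.
      by rewrite rmorphM; congr (_ * _); exact: conjc_real.
    by rewrite !exprMn exprD !rmorphM !rmorphXn/=; ring.
  rewrite exchange_big/=; apply: eq_bigr => i _.
  rewrite exchange_big/=; apply: eq_bigr => j _.
  by rewrite -mulr_sumr /T /wmean sl.
have nK : (n < K)%N by rewrite /K /J; lia.
have Tnn : T n n = (avg_const s n * r ^+ J)%:C.
  rewrite /T wmeanE ?sl ?cl ?cl' ?eqxx//=; last by rewrite /J; lia.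
  rewrite /avg_const -[in LHS](rmorph_nat (real_complex R)) -rmorphM/=.
  by congr (_%:C); rewrite addnn -mul2n; ring.
have Tb i j : (i != n) || (j != n) ->
    normc (T i j) <= `|gbin (s - 1) i| * `|gbin s j| * (N * (J%:R ^+ i * J%:R ^+ j)) * r ^+ K.
  move=> ij.
  have [Hij|Hij] := leqP (i + j)%N J.
    rewrite /T wmeanE ?sl ?cl ?cl'// ifF; last by apply/negbTE; rewrite negb_and.
    by rewrite mulr0 Normc.normc0 !mulr_ge0 ?exprn_ge0 ?(ltW r0).
  rewrite /T Normc.normcM normc_realE !normrM normrX (gtr0_norm r0).
  have W : normc (wmean l i j) <= N * (J%:R ^+ i * J%:R ^+ j).
    rewrite /wmean; apply: le_trans (normc_sum _ _) _; rewrite sl /N mulr_suml.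
    rewrite big_seq [leRHS]big_seq; apply: ler_sum => ws wsP.
    have uw w : w \in ws -> normc w = 1 by exact: phases_unit wsP.
    rewrite !Normc.normcM !normcX normc_conj (normc_wchar uw ul) !mul1r.
    have S1 := normc_wsum uw ul; rewrite sl in S1.
    by apply: ler_pM; rewrite ?exprn_ge0 ?normc_ge0//; apply: lerXn2r => //; rewrite nnegrE ?normc_ge0.
  have rK : r ^+ (i + j) <= r ^+ K by rewrite ler_wiXn2l// ltW.
  rewrite -[leLHS]mulrA -[leRHS]mulrA ler_wpM2l ?mulr_ge0// [leRHS]mulrC.
  by apply: ler_pM => //; rewrite ?normc_ge0// exprn_ge0// ltW.
rewrite E -Tnn.
have -> : \sum_(i < K) \sum_(j < K) T i j - T n n =
    \sum_(i < K) \sum_(j < K) (if (i == n :> nat) && (j == n :> nat) then 0 else T i j).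
  pose nn := Ordinal nK.
  rewrite (bigD1 nn)//= (bigD1 nn (P := xpredT) (F := fun j : 'I_K => T n j))//=.
  rewrite [RHS](bigD1 nn)//= [X in _ = X + _](bigD1 nn)//= !eqxx/= add0r.
  have shuffle (x y z : C) : x + y + z - x = y + z by ring.
  rewrite shuffle; congr (_ + _).
    apply: eq_bigr => j jn; rewrite ifF//; apply/negbTE; apply: contra jn => /eqP jn.
    by apply/eqP/val_inj.
  apply: eq_bigr => i ni; apply: eq_bigr => j _.
  rewrite ifF//; apply/negbTE; rewrite negb_and; apply/orP; left.
  by apply: contra ni => /eqP ni; apply/eqP/val_inj.
apply: le_trans (normc_sum _ _) _; rewrite /M mulr_suml; apply: ler_sum => i _.
apply: le_trans (normc_sum _ _) _; rewrite mulr_suml; apply: ler_sum => j _.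
case: ifP => [_|/negbT]; last by rewrite negb_and; exact: Tb.
by rewrite Normc.normc0 !mulr_ge0 ?exprn_ge0// ltW.
Qed.

(** The numbers r, e, delta are chosen before l, hence later before the point of the torus, so the
    gap survives integration. *)
Lemma avg_gap s n : 0 < s -> gbin (s - 1) n != 0 -> gbin s n != 0 ->
  exists r e delta : R, 0 < delta /\ forall l, balanced n l ->
  \sum_(ws <- phases R (2 * n))
     normc (1 + r%:C * wsum ws l + e%:C * wchar ws l) `^ (2 * s) + delta <=
  \sum_(ws <- phases R (2 * n)) normc (1 + r%:C * wsum ws l) `^ (2 * s).
Proof.
move=> s0 g1 g2; set J := (2 * n)%N; set K := J.+1.
have [M M0 HM] := power_tangent_bound K s0.
have [M2 M20 HM2] := avg_gradient s n; rewrite -/J -/K in HM2.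
pose c := avg_const s n.
have c0 : c != 0.
  by rewrite !mulf_neq0// pnatr_eq0 -lt0n !muln_gt0 expn_gt0 fact_gt0.
pose a := `|c|; have a0 : 0 < a by rewrite normr_gt0.
pose N := \sum_(ws <- phases R J) (1 : R).
have N0 : 0 <= N by apply: sumr_ge0.
pose M3 := 2 * s * M2 + N * M * (J%:R ^+ K + 1).
have M30 : 0 <= M3 by rewrite !(mulr_ge0, addr_ge0, exprn_ge0)// ltW.
(* The first summand keeps |u| below 1/16. The second makes the total error M3 r^(2K) at most half
   of the gain 2 s a r^(K+J), where K = J + 1. *)
pose r := (16 * K%:R + M3 / (s * a))^-1.
have q0 : 0 <= M3 / (s * a) by rewrite divr_ge0// mulr_ge0// ltW.
have rp : 0 < 16 * K%:R + M3 / (s * a) by rewrite ltr_wpDr// mulr_gt0// ltr0n.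
have r0 : 0 < r by rewrite invr_gt0.
have rM : r * M3 <= s * a.
  rewrite /r mulrC ler_pdivrMr// mulrDr; apply: (@le_trans _ _ (s * a * (M3 / (s * a)))).
    by rewrite mulrCA divff ?mulr1// mulf_neq0 ?gt_eqF.
  by rewrite lerDr !mulr_ge0// ltW.
have rK : r * K%:R <= 1 / 16.
  rewrite /r mulrC ler_pdivrMr//; lra.
have r16 : r <= 1 / 16.
  by apply: le_trans rK; rewrite -[leLHS]mulr1 ler_wpM2l ?(ltW r0)// ler1n.
have r1 : r <= 1 by lra.
have sgE : Num.sg c * c = a by rewrite -normrEsg.
(* The sign makes the first order term negative; with size r^K, the errors |e| |u|^K and |e|^2 are
   both of order r^(2K). *)
pose e := - Num.sg c * r ^+ K.
have en : `|e| <= r ^+ K.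
  by rewrite normrM normrN normrX (gtr0_norm r0) ler_piMl ?exprn_ge0 ?(ltW r0)// normr_sg c0.
have rKr : r ^+ K <= r by rewrite exprS ler_piMr ?(ltW r0)// exprn_ile1// ltW.
exists r, e, (s * a * r ^+ (K + J)); split; first by rewrite !mulr_gt0// exprn_gt0.
move=> l bl; have [sl _ ul] := bl.
have rr : 0 < r <= 1 by rewrite r0.
have {}HM2 := HM2 r l rr bl.
set S := \sum_(ws <- _) _ * _ in HM2.
have main : \sum_(ws <- phases R J)
     normc (1 + r%:C * wsum ws l + e%:C * wchar ws l) `^ (2 * s) <=
   \sum_(ws <- phases R J) (normc (1 + r%:C * wsum ws l) `^ (2 * s) +
     2 * s * (e * complex.Re (wchar ws l * (gsum (s - 1) K (r%:C * wsum ws l) *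
      gsum s K (r%:C * wsum ws l)^*))) + M * (J%:R ^+ K + 1) * r ^+ (K + K)).
  rewrite big_seq [leRHS]big_seq; apply: ler_sum => ws wsP.
  have uw w : w \in ws -> normc w = 1 by exact: phases_unit wsP.
  have S1 : normc (r%:C * wsum ws l) <= r * J%:R.
    rewrite Normc.normcM normc_realE (gtr0_norm r0) ler_wpM2l ?(ltW r0)//.
    by have := normc_wsum uw ul; rewrite sl.
  have eN : normc (e%:C * wchar ws l) = `|e|.
    by rewrite Normc.normcM normc_realE (normc_wchar uw ul) mulr1.
  have JK : r * J%:R <= r * K%:R by rewrite ler_wpM2l ?(ltW r0)// ler_nat.
  have u16 : normc (r%:C * wsum ws l) <= 1 / 16 by lra.
  have e16 : normc (e%:C * wchar ws l) <= 1 / 16 by rewrite eN; lra.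
  apply: le_trans (HM _ _ u16 e16) _; rewrite -addrA -[leRHS]addrA lerD2l.
  apply: lerD.
    rewrite le_eqVlt; apply/orP; left; apply/eqP; congr (_ * _).
    by rewrite -mulrA; case: (wchar ws l * _) => p q /=; ring.
  rewrite -mulrA ler_wpM2l// eN mulrDl mul1r exprD; apply: lerD.
    have -> : J%:R ^+ K * (r ^+ K * r ^+ K) = r ^+ K * (r * J%:R) ^+ K.
      by rewrite exprMn; ring.
    apply: ler_pM; rewrite ?exprn_ge0 ?normc_ge0//.
    by apply: lerXn2r => //; rewrite nnegrE ?normc_ge0// mulr_ge0// ltW.
  by rewrite expr2; apply: ler_pM.
have ReS : \sum_(ws <- phases R J) 2 * s * (e * complex.Re (wchar ws l *
      (gsum (s - 1) K (r%:C * wsum ws l) * gsum s K (r%:C * wsum ws l)^*))) =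
    2 * s * (e * complex.Re S).
  rewrite -mulr_sumr -mulr_sumr; congr (_ * (_ * _)); rewrite /S.
  elim: (phases R J) => [|ws q IH]; first by rewrite !big_nil.
  by rewrite !big_cons IH; case: (wchar ws l * _) (\sum_(_ <- q) _) => [? ?] [].
have eS : e * complex.Re S <= - (a * r ^+ (K + J)) + M2 * r ^+ (K + K).
  have Sd : `|complex.Re S - c * r ^+ J| <= M2 * r ^+ K.
    apply: le_trans HM2; apply: le_trans (Re_le_normc _).
    by case: (S) => p q /=.
  have -> : e * complex.Re S = - (a * r ^+ (K + J)) + e * (complex.Re S - c * r ^+ J).
    by rewrite exprD -sgE /e; ring.
  rewrite lerD2l; apply: le_trans (ler_norm _) _; rewrite normrM exprD mulrCA mulrC [leRHS]mulrC.
  by rewrite mulrC [leRHS]mulrC; apply: ler_pM => //.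
have rKK : r ^+ (K + K) = r * r ^+ (K + J) by rewrite -exprS addnS.
have p0 : 0 <= r ^+ (K + J) by rewrite exprn_ge0// ltW.
apply: le_trans (lerD main (lexx _)) _.
rewrite !big_split/= ReS -addrA -addrA gerDl.
have -> : \sum_(ws <- phases R J) M * (J%:R ^+ K + 1) * r ^+ (K + K) =
   N * M * (J%:R ^+ K + 1) * r ^+ (K + K).
  by rewrite /N -!mulrA mulr_suml; apply: eq_bigr => ws _; rewrite mul1r.
have H1 : 2 * s * (e * complex.Re S) <= 2 * s * (- (a * r ^+ (K + J)) + M2 * r ^+ (K + K)).
  by rewrite ler_wpM2l// mulr_ge0// ltW.
have H2 : r * M3 * r ^+ (K + J) <= s * a * r ^+ (K + J) by rewrite ler_wpM2r.
rewrite rKK in H1 *.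
have H3 : r * M3 * r ^+ (K + J) = 2 * s * M2 * (r * r ^+ (K + J)) +
   N * M * (J%:R ^+ K + 1) * (r * r ^+ (K + J)) by rewrite /M3; ring.
have H4 : 2 * s * (- (a * r ^+ (K + J)) + M2 * (r * r ^+ (K + J))) =
   - (s * a * r ^+ (K + J)) *+ 2 + 2 * s * M2 * (r * r ^+ (K + J)) by ring.
rewrite H4 in H1; rewrite H3 in H2; move: H1 H2; clear.
move: (s * a * _) (2 * s * M2 * _) (N * M * _ * _) (2 * s * _) => A B D F H1 H2.
rewrite mulr2n in H1; lra.
Qed.

End AveragedGap.

(** * Contractive sets are closed *)

Section ContractiveClosed.
Variables (R : realType) (d : nat).
Local Notation C := R[i].
Local Notation normc := Normc.normc.
Local Notation point := ('I_d -> R).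
Implicit Types (G : set (mindex d)) (a g : mindex d).
Local Open Scope complex_scope.
Local Notation "z ^*" := (conjc z) : ring_scope.

(** Makes |f|^p Lipschitz even near the zeros of f; p >= 1 keeps the derivative of x^p bounded near
    0. *)
Lemma powR_lip (p : R) : 1 <= p -> forall B, 0 <= B -> exists2 K : R, 0 <= K &
  forall x y : R, `|x| <= B -> `|y| <= B -> `| `|x| `^ p - `|y| `^ p| <= K * `|x - y|.
Proof.
move=> p1 B B0; have p0 : 0 < p by lra.
have K0 : 0 <= p * B `^ (p - 1) by rewrite mulr_ge0 ?powR_ge0// ltW.
exists (p * B `^ (p - 1)) => // x y.
wlog yx : x y / `|y| <= `|x|.
  move=> H xB yB; have [yx|xy] := leP `|y| `|x|; first exact: H.
  by rewrite distrC [`|x - y|]distrC; apply: H => //; exact: ltW.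
move=> xB yB; apply: (@le_trans _ _ (p * B `^ (p - 1) * (`|x| - `|y|))); last first.
  by rewrite ler_wpM2l// lerB_dist.
rewrite ger0_norm; last by rewrite subr_ge0; apply: ge0_ler_powR => //; exact: ltW.
have BX z : 0 <= z -> z <= B -> z `^ (p - 1) <= B `^ (p - 1).
  by move=> z0 zB; apply: ge0_ler_powR => //; rewrite subr_ge0.
move: yx xB yB (normr_ge0 y) (normr_ge0 x); move: `|x| `|y| => X Y YX XB YB Y0 X0.
move: YX; rewrite le_eqVlt => /orP[/eqP->|YX]; first by rewrite !subrr mulr0.
(* The derivative of the real power is only available at positive points, so Y = 0 is treated by
   hand. *)
have [->|Yn0] := eqVneq Y 0.
  rewrite powR0 ?gt_eqF// !subr0 -(mulr_powRB1 X0 p0) mulrC ler_wpM2r//.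
  apply: le_trans (BX X X0 XB) _; by rewrite ler_peMl ?powR_ge0.
have Yp : 0 < Y by rewrite lt_def Yn0.
have D z : z \in `]Y, X[ -> is_derive z 1 (fun w : R => w `^ p) (p * z `^ (p - 1)).
  by rewrite in_itv/= => /andP[Yz _]; apply: is_derive1_powR; exact: lt_trans Yz.
have Cg : {within `[Y, X], continuous (fun w : R => w `^ p)}.
  apply: derivable_within_continuous => z; rewrite in_itv/= => /andP[Yz _].
  have D1 := is_derive1_powR p (lt_le_trans Yp Yz).
  exact: ex_derive.
have [c + ->] := MVT YX D Cg; rewrite in_itv/= => /andP[Yc cX].
rewrite ler_wpM2r ?subr_ge0 ?(ltW YX)// ler_wpM2l ?(ltW p0)//.
by apply: BX; [apply: ltW; exact: lt_trans Yc|apply: le_trans XB; exact: ltW].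
Qed.

Lemma nice_power (p : R) (f : point -> C) : 1 <= p -> niceC f ->
  nice (fun t => normc (f t) `^ p).
Proof.
move=> p1 nf.
rewrite (_ : (fun t => _) = (fun t => (fun x => `|x| `^ p) (normc (f t)))).
  exact: (nice_comp (phi := fun x => `|x| `^ p) (powR_lip p1) (nice_normc nf)).
by apply: funext => t; rewrite ger0_norm ?normc_ge0.
Qed.

Lemma Lpnorm_le_int (p : R) (f g : point -> C) : 1 <= p -> niceC f -> niceC g ->
  Lpnorm p%:E f <= Lpnorm p%:E g ->
  torus_int (fun t => normc (f t) `^ p) <= torus_int (fun t => normc (g t) `^ p).
Proof.
move=> p1 nf ng H; rewrite leNgt; apply/negP => lt.
have p0 : 0 < p^-1 by rewrite invr_gt0 (lt_le_trans ltr01).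
have ge0 (h : point -> C) : niceC h -> 0 <= torus_int (fun t => normc (h t) `^ p).
  by move=> nh; apply: torus_int_ge0 => [|t]; [exact: nice_power|exact: powR_ge0].
suff : Lpnorm p%:E g < Lpnorm p%:E f by rewrite ltNge H.
by apply: gt0_ltr_powR => //; rewrite nnegrE ge0.
Qed.

Lemma ext_seq G n v : ext G n v -> exists g (l : seq (mindex d * mindex d)),
  [/\ G g, size l = n, forall q, q \in l -> G q.1 /\ G q.2 &
   v = ivec g + \sum_(q <- l) (ivec q.1 - ivec q.2)].
Proof.
elim: n v => [|n IH] v /=.
  by move=> [g Gg <-]; exists g, [::]; split=> //; rewrite big_nil addr0.
move=> [x /IH[g [l [Gg <- Hl ->]]] [_ [_ [a Ga <-] [_ [b Gb <-] <-]] <-]].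
exists g, ((a, b) :: l); split=> // [q|].
  by rewrite inE => /orP[/eqP->//|]; exact: Hl.
by rewrite big_cons/= [RHS]addrCA [LHS]addrC.
Qed.

Definition signed_pts (l : seq (mindex d * mindex d)) : seq (bool * mindex d) :=
  [seq (true, q.1) | q <- l] ++ [seq (false, q.2) | q <- l].

(** The phase given to z^alpha, chosen so that this monomial divided by z^g becomes [wchar]. *)
Definition twist (ws : seq C) (zs : seq (bool * mindex d)) : C :=
  \prod_(q <- zip ws zs) (if q.2.1 then q.1 else q.1^*).

Definition char_pts g (zs : seq (bool * mindex d)) (t : point) : seq (bool * C) :=
  [seq (q.1, chi (ivec q.2 - ivec g) t) | q <- zs].

Lemma balanced_char_pts g l t : balanced (size l) (char_pts g (signed_pts l) t).
Proof.
split.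
- by rewrite size_map size_cat !size_map addnn mul2n.
- rewrite count_map count_cat !count_map.
  rewrite (eq_count (a2 := predT))// count_predT (eq_count (a2 := pred0))// count_pred0.
  by rewrite addn0.
- by move=> _ /mapP[q _ ->] /=; exact: normc_chi.
Qed.

Lemma mem_zip_snd (S T : eqType) (s : seq S) (t : seq T) q : q \in zip s t -> q.2 \in t.
Proof.
elim: t s => [|y t IH] [|x s] //=; rewrite !inE => /orP[/eqP->|/IH ->]; rewrite ?eqxx ?orbT//.
Qed.

Lemma wsum_char_pts g zs ws t : chi (ivec g) t * wsum ws (char_pts g zs t) =
  \sum_(q <- zip ws zs) q.1 * chi (ivec q.2.2) t.
Proof.
rewrite /wsum mulr_sumr; elim: zs ws => [|z zs IH] [|w ws] /=; rewrite ?big_nil//.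
rewrite !big_cons IH/=; congr (_ + _); rewrite mulrCA -chiD.
by congr (_ * chi _ _); rewrite addrC subrK.
Qed.

Lemma wchar_char_pts g zs ws t : size ws = size zs ->
  wchar ws (char_pts g zs t) = twist ws zs *
   chi (\sum_(q <- zs) (if q.1 then ivec q.2 - ivec g else - (ivec q.2 - ivec g))) t.
Proof.
rewrite /wchar /twist; elim: zs ws => [|z zs IH] [|w ws]//= => [_|[sz]].
  by rewrite !big_nil chi0 mulr1.
rewrite !big_cons IH//= (chiD (if z.1 then _ else _)) [RHS]mulrACA; congr (_ * _).
by case: ifP => // _; rewrite (chiN (ivec z.2 - ivec g)) rmorphM.
Qed.

(** The test polynomial z^g (1 + u) + e z^alpha; r is small for finite p and equal to 1 for the sup
    norm. *)
Definition perturbed g a (r e : C) (ws : seq C) zs : seq (mindex d * C) :=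
  (g, 1) :: (a, e * twist ws zs) :: [seq (q.2.2, r * q.1) | q <- zip ws zs].

Lemma lpoly_pts g (r : C) ws zs t : lpoly [seq (q.2.2, r * q.1) | q <- zip ws zs] t =
  r * (chi (ivec g) t * wsum ws (char_pts g zs t)).
Proof.
rewrite wsum_char_pts /lpoly big_map mulr_sumr; apply: eq_bigr => q _ /=.
by rewrite mulrA.
Qed.

Lemma normc_perturbed g a r e ws l t : size ws = size (signed_pts l) ->
  ivec a = ivec g + \sum_(q <- l) (ivec q.1 - ivec q.2) ->
  normc (lpoly (perturbed g a r e ws (signed_pts l)) t) =
  normc (1 + r * wsum ws (char_pts g (signed_pts l) t) +
         e * wchar ws (char_pts g (signed_pts l) t)).
Proof.
move=> sz aE; set zs := signed_pts l in sz *.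
have aE' : \sum_(q <- zs) (if q.1 then ivec q.2 - ivec g else - (ivec q.2 - ivec g)) =
    ivec a - ivec g.
  rewrite aE addrC addKr /zs /signed_pts big_cat/= !big_map/= -big_split/=.
  by apply: eq_bigr => q _; rewrite opprB addrA subrK.
rewrite -[RHS]mul1r -[X in X * _](normc_chi (ivec g) t) -Normc.normcM; congr normc.
rewrite /lpoly /perturbed !big_cons -/(lpoly _ _) (lpoly_pts g)/= wchar_char_pts// aE'.
rewrite chiD chiN.
have cc : chi (ivec g) t * (chi (ivec g) t)^* = 1 :> C by rewrite -chiN -chiD subrr chi0.
transitivity (chi (ivec g) t * (1 + r * wsum ws (char_pts g zs t)) +
  e * twist ws zs * chi (ivec a) t * (chi (ivec g) t * (chi (ivec g) t)^*)); last by ring.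
by rewrite cc; ring.
Qed.

Lemma normc_unperturbed G g a r e ws l t : G g -> ~ G a ->
  (forall q, q \in l -> G q.1 /\ G q.2) ->
  normc (lpoly [seq q <- perturbed g a r e ws (signed_pts l) | q.1 \in G] t) =
  normc (1 + r * wsum ws (char_pts g (signed_pts l) t)).
Proof.
move=> Gg nGa Hl; set zs := signed_pts l.
have zsG q : q \in zs -> G q.2.
  by rewrite mem_cat => /orP[] /mapP[q' /Hl[G1 G2] ->].
rewrite /perturbed /= mem_set// ifF; last by apply/negbTE; rewrite notin_setE.
rewrite (_ : [seq q <- _ | _] = [seq (q.2.2, r * q.1) | q <- zip ws zs]); last first.
  apply/all_filterP/allP => _ /mapP[[w z] /mem_zip_snd zz ->] /=.
  by apply: mem_set; exact: zsG.
rewrite -[RHS]mul1r -[X in X * _](normc_chi (ivec g) t) -Normc.normcM; congr normc.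
by rewrite /lpoly big_cons -/(lpoly _ _) (lpoly_pts g)/=; ring.
Qed.

Lemma contractive_ext_closed (p : R) n G : 1 <= p ->
  gbin (p / 2 - 1) n != 0 -> gbin (p / 2) n != 0 ->
  contractive_set p%:E G -> ext_closed n G.
Proof.
move=> p1 g1 g2 HG a /ext_seq[g [l [Gg sl Hl aE]]]; apply: contrapT => nGa.
have s0 : 0 < p / 2 by lra.
have [r [e [delta [d0 Hgap]]]] := avg_gap s0 g1 g2.
have pE : 2 * (p / 2) = p by field.
rewrite pE in Hgap.
pose zs := signed_pts l.
have szs : size zs = (2 * n)%N by rewrite size_cat !size_map sl addnn mul2n.
pose P ws := perturbed g a r%:C e%:C ws zs.
pose F ws t := normc (lpoly [seq q <- P ws | q.1 \in G] t) `^ p.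
pose H ws t := normc (lpoly (P ws) t) `^ p.
have nF ws : nice (F ws) by apply: nice_power => //; exact: niceC_lpoly.
have nH ws : nice (H ws) by apply: nice_power => //; exact: niceC_lpoly.
(* The contraction inequalities are summed over all phases, since the gap [le2] holds only for the
   sum. *)
have le1 : torus_int (fun t => \sum_(ws <- phases R (2 * n)) F ws t) <=
           torus_int (fun t => \sum_(ws <- phases R (2 * n)) H ws t).
  rewrite !torus_int_sum//; apply: ler_sum => ws _.
  by apply: (Lpnorm_le_int p1 (niceC_lpoly _) (niceC_lpoly _)); exact: contractive_list.
have le2 : torus_int (fun t => \sum_(ws <- phases R (2 * n)) H ws t) + delta <=
           torus_int (fun t => \sum_(ws <- phases R (2 * n)) F ws t).
  rewrite -[X in _ + X](torus_int_cst d) -torus_intD; [|exact: nice_sum|exact: nice_cst].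
  apply: torus_int_le.
  - by apply: niceD; [exact: nice_sum|exact: nice_cst].
  - exact: nice_sum.
  move=> t; have bl : balanced n (char_pts g zs t) by rewrite -sl; exact: balanced_char_pts.
  have := Hgap _ bl; congr (_ + _ <= _).
    rewrite big_seq [RHS]big_seq; apply: eq_bigr => ws /phases_size sw.
    by rewrite /H /P normc_perturbed ?sw ?szs.
  by apply: eq_bigr => ws _; rewrite /F /P normc_unperturbed.
by move: (le_trans le2 le1); rewrite gerDl leNgt d0.
Qed.

End ContractiveClosed.

(** * The sup norm *)

Section SupNorm.
Variables (R : realType) (d : nat).
Local Notation C := R[i].
Local Notation normc := Normc.normc.
Local Notation point := ('I_d -> R).
Implicit Types (G : set (mindex d)) (l : seq (bool * C)).
Local Open Scope complex_scope.
Local Notation "z ^*" := (conjc z) : ring_scope.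

Lemma wsum1 l : wsum (nseq (size l) 1) l = \sum_(q <- l) q.2.
Proof.
by rewrite /wsum; elim: l => [|q l IH] /=; rewrite ?big_nil// !big_cons IH mul1r.
Qed.

Lemma wchar1_dist l : (forall q, q \in l -> normc q.2 = 1) ->
  normc (1 - wchar (nseq (size l) 1) l) <= \sum_(q <- l) normc (1 - q.2).
Proof.
elim: l => [|q l IH] H /=; first by rewrite /wchar/= !big_nil subrr Normc.normc0.
rewrite /wchar/= !big_cons -/(wchar _ _) mul1r.
set c := if _ then _ else _; set w := wchar _ _.
have c1 : normc c = 1.
  by rewrite /c; case: ifP; rewrite ?normc_conj (H q)// inE eqxx.
have -> : 1 - c * w = (1 - c) + c * (1 - w) by ring.
apply: le_trans (le_normcD _ _) _; rewrite Normc.normcM c1 mul1r; apply: lerD.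
  rewrite /c; case: ifP => // _.
  by rewrite -[leRHS]normc_conj rmorphB rmorph1.
by apply: IH => z zl; apply: H; rewrite inE zl orbT.
Qed.

(** By the parallelogram law, |1 + y|^2 = 4 - |1 - y|^2. *)
Lemma normc_add1_gap (y : C) (eta : R) : normc y = 1 -> 0 <= eta <= 1 ->
  eta <= normc (1 - y) -> normc (1 + y) <= 2 - eta ^+ 2 / 4.
Proof.
move=> y1 /andP[e0 e1] H.
have e2 : eta ^+ 2 <= 1 by rewrite expr_le1.
have H2 : eta ^+ 2 <= normc (1 - y) ^+ 2 by rewrite lerXn2r// nnegrE normc_ge0.
rewrite -(ler_pXn2r (_ : 0 < 2)%N)// ?nnegrE ?normc_ge0//; last by lra.
have Y : normc (1 + y) ^+ 2 = 4 - normc (1 - y) ^+ 2.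
  have := sqr_normc y; rewrite y1 !sqr_normc; case: (y) => p q /=; lra.
rewrite Y; have := sqr_ge0 (eta ^+ 2 / 4); move: H2; lra.
Qed.

(** Either some letter is at distance at least eta from 1, and the sum of the letters loses more
    than the perturbation adds, or all letters are near 1; then so is their product, and subtracting
    it reduces the modulus. *)
Lemma sup_norm_gap J : exists e delta : R, 0 < delta /\ forall l, size l = J ->
  (forall q, q \in l -> normc q.2 = 1) ->
  normc (1 + wsum (nseq J 1) l + e%:C * wchar (nseq J 1) l) <= 1 + J%:R - delta.
Proof.
(* Chosen so that J letters within eta of 1 have a product within 1/2 of 1. *)
pose eta : R := (2 * J.+1%:R)^-1.
have J1 : 1 <= J.+1%:R :> R by rewrite ler1n.
have J0 : 0 <= J%:R :> R by [].
have eta0 : 0 < eta by rewrite invr_gt0; lra.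
have eta1 : eta <= 1 / 2 by rewrite /eta -[1 / 2]invf_div lef_pV2 ?posrE; lra.
have etaJ : eta * J%:R <= 1 / 2.
  by rewrite /eta mulrC ler_pdivrMr; move: J1; rewrite -(natr1 J); lra.
(* Half of the loss eta^2 / 4 caused by a letter far from 1. *)
pose e := eta ^+ 2 / 8.
have e0 : 0 < e by rewrite divr_gt0// exprn_gt0.
have e1 : e <= 1.
  have : eta ^+ 2 <= 1 by rewrite expr_le1// ?ltW//; lra.
  by rewrite /e; lra.
exists (- e), (e / 2); split; first by rewrite divr_gt0.
move=> l sl ul; rewrite -sl.
set S := wsum _ l; set w := wchar _ l.
have wn : normc w = 1.
  by apply: normc_wchar => // z; rewrite mem_nseq => /andP[_ /eqP ->]; exact: Normc.normc1.
have [/hasP[q ql qe]|] := boolP (has (fun q => eta <= normc (1 - q.2)) l).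
  have HS : normc (1 + S) <= 2 - eta ^+ 2 / 4 + ((size l)%:R - 1).
    rewrite /S wsum1 (big_rem q ql)/= addrA; apply: le_trans (le_normcD _ _) _.
    apply: lerD; first by apply: normc_add1_gap => //; [exact: ul|apply/andP; split; lra].
    apply: le_trans (normc_sum _ _) _; rewrite big_seq.
    apply: (@le_trans _ _ (\sum_(i <- rem q l | i \in rem q l) 1)).
      by apply: ler_sum => i /mem_rem /ul ->.
    rewrite -big_seq big_const_seq count_predT iter_addr addr0 size_rem//.
    by case: (l) ql => //= ? ? _; rewrite -(natr1 (size _)) addrK.
  apply: le_trans (le_normcD _ _) _; rewrite Normc.normcM normc_realE wn normrN.
  by rewrite (gtr0_norm e0) mulr1; have := sqr_ge0 eta; move: HS; rewrite /e; lra.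
move=> /hasPn H.
have Hw : normc (1 - w) <= 1 / 2.
  apply: le_trans (wchar1_dist ul) _; apply: le_trans etaJ; rewrite big_seq.
  apply: (@le_trans _ _ (\sum_(i <- l | i \in l) eta)).
    by apply: ler_sum => i il; rewrite ltW// ltNge; exact: H.
  by rewrite -big_seq big_const_seq count_predT iter_addr addr0 sl mulr_natr.
have -> : 1 + S + (- e)%:C * w = ((1 - e)%:C + S) + e%:C * (1 - w).
  by rewrite rmorphN rmorphB rmorph1/=; ring.
have Sn : normc S <= (size l)%:R.
  by apply: normc_wsum => // z; rewrite mem_nseq => /andP[_ /eqP ->]; exact: Normc.normc1.
apply: le_trans (le_normcD _ _) _.
have He : normc (e%:C * (1 - w)) <= e * (1 / 2).
  by rewrite Normc.normcM normc_realE (gtr0_norm e0) ler_wpM2l// ltW.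
have H1 : normc ((1 - e)%:C + S) <= (1 - e) + (size l)%:R.
  apply: le_trans (le_normcD _ _) _; rewrite normc_realE ger0_norm ?subr_ge0//.
  by rewrite lerD2l.
by move: He H1; lra.
Qed.

Lemma contractive_infty_ext_closed n G : contractive_set (+oo%E : \bar R) G ->
  ext_closed n G.
Proof.
move=> HG a /ext_seq[g [l [Gg sl Hl aE]]]; apply: contrapT => nGa.
have [e [delta [d0 Hgap]]] := sup_norm_gap (2 * n).
pose zs := signed_pts l.
have szs : size zs = (2 * n)%N by rewrite size_cat !size_map sl addnn mul2n.
pose ws : seq C := nseq (2 * n) 1.
have sw : size ws = size zs by rewrite size_nseq szs.
have := contractive_list (perturbed g a 1 e%:C ws zs) HG.
rewrite leNgt => /negP; apply; rewrite /Lpnorm.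
apply: (@le_lt_trans _ _ (1 + (2 * n)%:R - delta)).
  apply: ge_sup; first by exists (normc (lpoly (perturbed g a 1 e%:C ws zs) (fun=> 0))), (fun=> 0).
  move=> _ [t _ <-]; rewrite normc_perturbed// mul1r.
  have [sb _ ub] := balanced_char_pts g l t.
  by apply: Hgap => //; rewrite sb sl.
apply: (@lt_le_trans _ _ (1 + (2 * n)%:R)); first by rewrite ltrBlDr ltrDl.
apply: ub_le_sup.
  exists (1 + (2 * n)%:R) => _ [t _ <-]; rewrite normc_unperturbed// mul1r.
  have [sb _ ub] := balanced_char_pts g l t.
  apply: le_trans (le_normcD _ _) _; rewrite Normc.normc1 lerD2l.
  rewrite -sl -sb; apply: normc_wsum => // z.
  by rewrite mem_nseq => /andP[_ /eqP ->]; exact: Normc.normc1.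
(* At z = 1 all monomials equal 1, so the projected polynomial attains 1 + 2n. *)
exists (fun=> 0) => //; rewrite normc_unperturbed// mul1r.
have -> : wsum ws (char_pts g (signed_pts l) (fun=> 0 : R)) = ((2 * n)%:R)%:C.
  have -> : ws = nseq (size (char_pts g (signed_pts l) (fun=> 0 : R))) 1.
    by rewrite /ws size_map szs.
  rewrite wsum1 big_map (eq_bigr (fun=> 1)); last first.
    move=> q _ /=; rewrite /chi big1 ?mulr0 ?expi0// => j _.
    by rewrite mulr0.
  by rewrite big_const_seq count_predT iter_addr addr0 szs rmorph_nat.
have -> : 1 + ((2 * n)%:R : R)%:C = (1 + (2 * n)%:R)%:C.
  by apply/eqP; rewrite eq_complex/= addr0 !eqxx.
by rewrite normc_realE ger0_norm// addr_ge0.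
Qed.

End SupNorm.

(** * Closed sets of small dimension *)

Section LowDimension.
Variable d : nat.
Local Notation vec := 'rV[int]_d.
Implicit Types (X : set vec) (x h v : vec).

Lemma coord_sum (l : seq vec) j : (\sum_(h <- l) h) 0 j = \sum_(h <- l) h 0 j.
Proof. by rewrite summxE. Qed.

Lemma sum_coord_le (S : vec) (l : seq vec) (j : 'I_d) (h : vec) : S = \sum_(k <- l) k ->
  h \in l -> (forall k : vec, k \in l -> k 0 j <= 0) -> S 0 j <= h 0 j.
Proof.
move=> -> hl H; rewrite (sum_rem hl) vecE gerDl coord_sum big_seq sumr_le0// => k /mem_rem.
exact: H.
Qed.

Lemma not_nonneg v : ~ nonneg v -> exists j, v 0 j < 0.
Proof. by move=> /existsNP[j /negP]; rewrite -ltNge; exists j. Qed.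

Lemma exists_head (l : seq vec) : l != [::] -> exists h, h \in l.
Proof. by case: l => // h l _; exists h; rewrite inE eqxx. Qed.

Lemma mem_rem_neq (l : seq vec) h k : h \in l -> k \in l -> k != h -> k \in rem h l.
Proof.
move=> hl kl kh; have := perm_to_rem hl => /perm_mem /(_ k).
by rewrite kl inE (negbTE kh) => /esym.
Qed.

(** v + h divides the segment from v to v + s in the ratio given by hj / sj, which lies in (0,
    1]. *)
Lemma segment_ge0 (v s h sj hj : int) : hj * s = sj * h -> 0 <= v -> 0 <= v + s ->
  0 < hj -> hj <= sj -> 0 <= v + h.
Proof.
move=> E v0 vs hj0 hs; rewrite -(pmulr_lge0 _ (lt_le_trans hj0 hs)).
have -> : (v + h) * sj = v * (sj - hj) + hj * (v + s).
  by rewrite mulrDl [h * _]mulrC -E; ring.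
by rewrite addr_ge0// mulr_ge0// ?subr_ge0// ltW.
Qed.

Lemma parallel_merge X (j : 'I_d) : (forall x, X x -> nonneg x) -> closed_upto 1 X ->
  (forall h k, diffset X h -> diffset X k -> forall i, h 0 j * k 0 i = k 0 j * h 0 i) ->
  (forall h, diffset X h -> h 0 j = 0 -> h = 0) ->
  forall n, closed_upto n X.
Proof.
move=> X0 c1 par inj; apply: closed_of_merge => // v l Xv l0 Hl Hv H1 _.
have hj0 h : h \in l -> h 0 j != 0.
  move=> hl; apply/eqP => /(inj _ (Hl _ hl)) h0; apply: (H1 _ hl).
  by rewrite h0 addr0; exact: X0.
pose S : vec := \sum_(h <- l) h; rewrite -/S in Hv.
have Spar h : h \in l -> forall i, h 0 j * S 0 i = S 0 j * h 0 i.
  move=> hl i; rewrite /S !coord_sum mulr_sumr mulr_suml big_seq [RHS]big_seq.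
  by apply: eq_bigr => k kl; apply: par; exact: Hl.
(* If all terms pointed the same way, each would be at most as long as their sum S, and v + h would
   lie between v and v + S. *)
have between (e : int) : (e == 1) || (e == -1) -> exists2 h : vec, h \in l & 0 < e * h 0 j.
  move=> e1; apply: contrapT => H.
  have neg h : h \in l -> e * h 0 j < 0.
    move=> hl; rewrite lt_neqAle leNgt; apply/andP; split; last first.
      by apply/negP => h0; apply: H; exists h.
    by rewrite mulf_neq0// ?hj0//; case/orP: e1 => /eqP ->.
  have [h hl] := exists_head l0; apply: (H1 _ hl) => i.
  have hS : e * S 0 j <= e * h 0 j.
    rewrite /S (sum_rem hl) vecE mulrDr gerDl coord_sum mulr_sumr big_seq sumr_le0// => k.
    by move=> /mem_rem /neg /ltW.
  have hn := neg _ hl; have P := Spar _ hl i; have := Hv i; have v0 := X0 _ Xv i.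
  rewrite !vecE => vS; move: hS hn; case/orP: e1 => /eqP ->; rewrite ?mul1r ?mulN1r => hS hn.
    by apply: (@segment_ge0 _ (S 0 i) _ (- S 0 j) (- h 0 j)); rewrite ?mulNr ?P //; lia.
  by apply: (@segment_ge0 _ (S 0 i) _ (S 0 j) (h 0 j)) => //; lia.
have [h hl hp] := between 1 isT; have [k kl kn] := between (-1) isT.
rewrite mul1r in hp; rewrite mulN1r oppr_gt0 in kn.
exists h, k; split=> //.
  apply: mem_rem_neq => //; apply: contraTneq kn => ->; by rewrite -leNgt ltW.
have Dh := Hl h hl; have Dk := Hl k kl; have P := par _ _ Dh Dk.
move: Dh Dk => [a Xa [b Xb ab]] [c Xc [e Xe ce]].
(* h and k are opposite. If h is the longer one, a + k lies between a and b = a - h; otherwise c + h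
   lies between c and e = c - k. *)
have [hk|hk] := leP (- k 0 j) (h 0 j).
  have Xt : X (a + c - e).
    apply: closed1P => // i; have Xai := X0 _ Xa i; have Xbi := X0 _ Xb i; have Pi := P i.
    have ki : (c - e) 0 i = k 0 i by rewrite ce.
    have hi : (a - b) 0 i = h 0 i by rewrite ab.
    rewrite -addrA vecE ki; apply: (@segment_ge0 _ (- h 0 i) _ (h 0 j) (- k 0 j)) => //.
    - by rewrite mulrNN -Pi.
    - by rewrite -hi !vecE opprB addrC subrK.
    - by rewrite oppr_gt0.
  have -> : h + k = (a + c - e) - b by rewrite -ab -ce; apply: vecP => i; rewrite !vecE; lia.
  exact: diffsetI.
have Xt : X (c + a - b).
  apply: closed1P => // i; have Xci := X0 _ Xc i; have Xei := X0 _ Xe i; have Pi := P i.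
  have ki : (c - e) 0 i = k 0 i by rewrite ce.
  have hi : (a - b) 0 i = h 0 i by rewrite ab.
  rewrite -addrA vecE hi; apply: (@segment_ge0 _ (- k 0 i) _ (- k 0 j) (h 0 j)) => //.
  - by rewrite mulrN Pi mulNr.
  - by rewrite -ki !vecE opprB addrC subrK.
  - exact: ltW.
have -> : h + k = (c + a - b) - e by rewrite -ab -ce; apply: vecP => i; rewrite !vecE; lia.
exact: diffsetI.
Qed.

End LowDimension.

Lemma planar_merge (X : set 'rV[int]_2) : (forall x, X x -> nonneg x) ->
  closed_upto 1 X -> forall n, closed_upto n X.
Proof.
move=> X0 c1; apply: closed_of_merge => // v l Xv l0 Hl Hv H1 _.
pose S : 'rV[int]_2 := \sum_(h <- l) h; rewrite -/S in Hv.
pose o : 'I_2 := ord0; pose p : 'I_2 := ord_max.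
have ord2 (i : 'I_2) : i = o \/ i = p.
  by case: i => -[|[|//]] Hi; [left|right]; apply: val_inj.
(* Otherwise every term is negative in coordinate j. As v + S is nonnegative there, so is each v +
   h, which must then fail in coordinate i; the same comparison with S in coordinate i is a
   contradiction. *)
have key (i j : 'I_2) : (forall m, m = i \/ m = j) ->
    exists2 h : 'rV[int]_2, h \in l & (0 <= h 0 j) && (h 0 i < 0).
  move=> ij; apply: contrapT => H.
  have neg (h : 'rV[int]_2) : h \in l -> h 0 j < 0.
    move=> hl; rewrite ltNge; apply/negP => hj; apply: (H1 _ hl) => m; rewrite vecE.
    have hi : 0 <= h 0 i by rewrite leNgt; apply/negP => hi; apply: H; exists h; rewrite ?hj.
    have := X0 _ Xv m; case: (ij m) => ->; lia.
  have bad (h : 'rV[int]_2) : h \in l -> h 0 i < 0 /\ v 0 i + h 0 i < 0.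
    move=> hl; have [m] := not_nonneg (H1 _ hl); rewrite vecE => hm.
    have hj : S 0 j <= h 0 j by apply: (@sum_coord_le _ S l) => // k /neg /ltW.
    have := Hv j; rewrite vecE; have := X0 _ Xv i.
    move=> vi vS; case: (ij m) hm => ->  hm; split; lia.
  have [h hl] := exists_head l0.
  have hi : S 0 i <= h 0 i by apply: (@sum_coord_le _ S l) => // k /bad[/ltW].
  by have := Hv i; rewrite vecE; have [] := bad _ hl; lia.
have [h hl /andP[h1 h0]] := key o p ord2.
have [k kl /andP[k1 k0]] := key p o (fun m => proj1 (or_comm _ _) (ord2 m)).
exists h, k; split=> //.
  by apply: mem_rem_neq => //; apply: contraTneq k1 => ->; rewrite -ltNge.
have Dh := Hl h hl; have Dk := Hl k kl.
move: Dh Dk => [a Xa [b Xb ab]] [c Xc [e Xe ce]].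
(* One of a + k, c + h, e - h is nonnegative, hence in X, and h + k is then (a + k) - b, (c + h) - e
   or c - (e - h). *)
have [qs|qs] := leP (- k 0 p) (h 0 p).
  have Xt : X (a + c - e).
    apply: closed1P => // i; have := X0 _ Xa i; have := X0 _ Xb i.
    by move: qs h0 h1 k0 k1; rewrite -ab -ce !vecE; case: (ord2 i) => ->; lia.
  have -> : h + k = (a + c - e) - b by rewrite -ab -ce; apply: vecP => i; rewrite !vecE; lia.
  exact: diffsetI.
have [rp|rp] := leP (- h 0 o) (k 0 o).
  have Xt : X (c + a - b).
    apply: closed1P => // i; have := X0 _ Xc i; have := X0 _ Xe i.
    by move: rp h0 h1 k0 k1; rewrite -ab -ce !vecE; case: (ord2 i) => ->; lia.
  have -> : h + k = (c + a - b) - e by rewrite -ab -ce; apply: vecP => i; rewrite !vecE; lia.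
  exact: diffsetI.
have Xt : X (e + b - a).
  apply: closed1P => // i; have := X0 _ Xc i; have := X0 _ Xe i.
  by move: rp qs h0 h1 k0 k1; rewrite -ab -ce !vecE; case: (ord2 i) => ->; lia.
have -> : h + k = c - (e + b - a) by rewrite -ab -ce; apply: vecP => i; rewrite !vecE; lia.
exact: diffsetI.
Qed.

(** * Two-dimensional sets *)

Section Plane.
Variable d : nat.
Local Notation vec := 'rV[int]_d.
Variable X : set vec.
Hypothesis X0 : forall x : vec, X x -> nonneg x.
Hypothesis c2 : closed_upto 2 X.
Implicit Types (a b c x y z : vec) (A N s t m ma mb mc na nb nc : int) (k : 'I_d).

Definition comb a b c ma mb mc : vec := ma *: a + mb *: b + mc *: c.

Lemma closed_sub a b c : X a -> X b -> X c -> nonneg (a + b - c) -> X (a + b - c).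
Proof. by apply: closed1P; exact: closed_le c2. Qed.

Lemma closed_sub2 a b c e f : X a -> X b -> X c -> X e -> X f ->
  nonneg (a + b + c - e - f) -> X (a + b + c - e - f).
Proof.
move=> Xa Xb Xc Xe Xf.
have -> : a + b + c - e - f = a + (b - e) + (c - f) by apply: vecP => i; rewrite !vecE; lia.
by apply: closed2P => //; exact: diffsetI.
Qed.

Lemma nonneg_scale z s : 0 < s -> (forall i, 0 <= s * z 0 i) -> nonneg z.
Proof. by move=> s0 H i; rewrite -(pmulr_rge0 _ s0). Qed.

Definition comb_closed N := forall a b c ma mb mc, X a -> X b -> X c ->
  ma + mb + mc = 1 -> `|ma| + `|mb| + `|mc| < N -> nonneg (comb a b c ma mb mc) ->
  X (comb a b c ma mb mc).

(** Replace c by a + b - c, or by 2a - c when mb = 0. A positive multiple of the new vertex is the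
    given combination plus nonnegative multiples of a and b, so it is nonnegative, and the total
    size of the coefficients drops. *)
Lemma comb_one_neg N a b c ma mb mc : comb_closed N -> X a -> X b -> X c ->
  ma + mb + mc = 1 -> `|ma| + `|mb| + `|mc| <= N -> 0 <= ma -> 0 <= mb -> mc < 0 ->
  nonneg (comb a b c ma mb mc) -> X (comb a b c ma mb mc).
Proof.
move=> IH Xa Xb Xc m1 mN ma0 mb0 mc0 y0.
wlog mab : a b ma mb Xa Xb m1 mN ma0 mb0 y0 / mb <= ma.
  move=> H; have [mab|/ltW mab] := leP mb ma; first exact: H.
  have E : comb a b c ma mb mc = comb b a c mb ma mc by apply: vecP => i; rewrite !vecE; lia.
  by rewrite E; apply: H => //; [lia|lia|rewrite -E].
have Y i : 0 <= ma * a 0 i + mb * b 0 i + mc * c 0 i by have := y0 i; rewrite !vecE.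
have [mb1|mb1] := eqVneq mb 0.
  have Xz : X (a + a - c).
    apply: closed_sub => //; apply: (@nonneg_scale _ (- mc)); first lia.
    move=> i; rewrite !vecE; have := Y i; have := X0 Xa i.
    have -> : - mc * (a 0 i + a 0 i - c 0 i) =
      (ma * a 0 i + mb * b 0 i + mc * c 0 i) + (- mc - 1) * a 0 i.
      by rewrite mb1 (_ : ma = 1 - mc); [ring|lia].
    by move=> ai yi; rewrite addr_ge0// mulr_ge0//; lia.
  have E : comb a b c ma mb mc = comb a b (a + a - c) (ma + 2 * mc) 0 (- mc).
    by apply: vecP => i; rewrite !vecE mb1; ring.
  by rewrite E; apply: IH => //; [lia|lia|rewrite -E].
have Xz : X (a + b - c).
  apply: closed_sub => //; apply: (@nonneg_scale _ (- mc)); first lia.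
  move=> i; rewrite !vecE; have := Y i; have := X0 Xa i; have := X0 Xb i.
  have -> : - mc * (a 0 i + b 0 i - c 0 i) =
      (ma * a 0 i + mb * b 0 i + mc * c 0 i) + ((- mc - ma) * a 0 i + (- mc - mb) * b 0 i) by ring.
  by move=> bi ai yi; rewrite addr_ge0// addr_ge0// mulr_ge0//; lia.
have E : comb a b c ma mb mc = comb a b (a + b - c) (ma + mc) (mb + mc) (- mc).
  by apply: vecP => i; rewrite !vecE; ring.
by rewrite E; apply: IH => //; [lia|lia|rewrite -E].
Qed.

(** The vertex with the more negative coefficient is reflected in a. When both coefficients agree
    this may leave N_0^d, and c is replaced by 3a - b - c instead: here level 2 enters. *)
Lemma comb_two_neg N a b c ma mb mc : comb_closed N -> X a -> X b -> X c ->
  ma + mb + mc = 1 -> `|ma| + `|mb| + `|mc| <= N -> mb < 0 -> mc < 0 ->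
  nonneg (comb a b c ma mb mc) -> X (comb a b c ma mb mc).
Proof.
move=> IH Xa Xb Xc m1 mN mb0 mc0 y0.
wlog mbc : b c mb mc Xb Xc m1 mN mb0 mc0 y0 / mb <= mc.
  move=> H; have [mab|/ltW mab] := leP mb mc; first exact: H.
  have E : comb a b c ma mb mc = comb a c b ma mc mb by apply: vecP => i; rewrite !vecE; lia.
  by rewrite E; apply: H => //; [lia|lia|rewrite -E].
have Y i : 0 <= ma * a 0 i + mb * b 0 i + mc * c 0 i by have := y0 i; rewrite !vecE.
have maE : ma = 1 - mb - mc by lia.
have [bc|bc] := eqVneq mb mc.
  have Xz : X (a + a + a - b - c).
    apply: closed_sub2 => //; apply: (@nonneg_scale _ (- mc)); first lia.
    move=> i; rewrite !vecE; have := Y i; have := X0 Xa i.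
    have -> : - mc * (a 0 i + a 0 i + a 0 i - b 0 i - c 0 i) =
      (ma * a 0 i + mb * b 0 i + mc * c 0 i) + (- mc - 1) * a 0 i.
      by rewrite maE bc; ring.
    by move=> ai yi; rewrite addr_ge0// mulr_ge0//; lia.
  have E : comb a b c ma mb mc = comb a b (a + a + a - b - c) (ma + 3 * mc) 0 (- mc).
    by apply: vecP => i; rewrite !vecE bc; ring.
  by rewrite E; apply: IH => //; [lia|lia|rewrite -E].
have Xz : X (a + a - b).
  apply: closed_sub => //; apply: (@nonneg_scale _ (- mb)); first lia.
  move=> i; rewrite !vecE; have := Y i; have := X0 Xa i; have := X0 Xc i.
  have -> : - mb * (a 0 i + a 0 i - b 0 i) =
      (ma * a 0 i + mb * b 0 i + mc * c 0 i) + ((- mb + mc - 1) * a 0 i + (- mc) * c 0 i).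
    by rewrite maE; ring.
  by move=> ci ai yi; rewrite addr_ge0// addr_ge0// mulr_ge0//; lia.
have E : comb a b c ma mb mc = comb a (a + a - b) c (ma + 2 * mb) (- mb) mc.
  by apply: vecP => i; rewrite !vecE; ring.
by rewrite E; apply: IH => //; [lia|lia|rewrite -E].
Qed.

Lemma comb_perm1 a b c ma mb mc : comb a b c ma mb mc = comb b c a mb mc ma.
Proof. by apply: vecP => i; rewrite !vecE; lia. Qed.

Lemma affine_comb_closed a b c ma mb mc : X a -> X b -> X c -> ma + mb + mc = 1 ->
  nonneg (comb a b c ma mb mc) -> X (comb a b c ma mb mc).
Proof.
suff H (n : nat) : comb_closed n%:Z.
  move=> Xa Xb Xc m1; apply: (H (absz ma + absz mb + absz mc).+1) => //.
  by rewrite -addn1 !PoszD !abszE; lia.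
elim: n => [|n IH] {}a {}b {}c {}ma {}mb {}mc Xa Xb Xc m1 mN y0; first by lia.
have mN' : `|ma| + `|mb| + `|mc| <= n%:Z by lia.
have P1 := comb_perm1 a b c ma mb mc; have P2 := comb_perm1 b c a mb mc ma.
have y1 : nonneg (comb b c a mb mc ma) by rewrite -P1.
have y2 : nonneg (comb c a b mc ma mb) by rewrite -P2.
have [ma0|ma0] := leP 0 ma; have [mb0|mb0] := leP 0 mb; have [mc0|mc0] := leP 0 mc.
- have [ma1|[mb1|mc1]] : ma = 1 \/ mb = 1 \/ mc = 1 by lia.
  + have [-> -> ->] : [/\ ma = 1, mb = 0 & mc = 0] by split; lia.
    by rewrite /comb scale1r !scale0r !addr0.
  + have [-> -> ->] : [/\ ma = 0, mb = 1 & mc = 0] by split; lia.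
    by rewrite /comb scale1r !scale0r add0r addr0.
  + have [-> -> ->] : [/\ ma = 0, mb = 0 & mc = 1] by split; lia.
    by rewrite /comb scale1r !scale0r !add0r.
- by apply: (comb_one_neg IH).
- by rewrite P1 P2; apply: (comb_one_neg IH) => //; lia.
- by apply: (comb_two_neg IH).
- by rewrite P1; apply: (comb_one_neg IH) => //; lia.
- by rewrite P1; apply: (comb_two_neg IH) => //; lia.
- by rewrite P1 P2; apply: (comb_two_neg IH) => //; lia.
- by lia.
Qed.

Variables i j : 'I_d.

(** Twice the signed area of the triangle projected to the coordinates i and j. *)
Definition area a b c : int :=
  (b 0 i - a 0 i) * (c 0 j - a 0 j) - (b 0 j - a 0 j) * (c 0 i - a 0 i).

Variable A : int.
Hypothesis A0 : 0 < A.
Hypothesis Amin : forall a b c, X a -> X b -> X c -> area a b c = 0 \/ A <= `|area a b c|.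

Definition lattice_pts N := forall a b c x ma mb mc, X a -> X b -> X c -> X x ->
  `|area a b c| = A -> A *: x = comb a b c ma mb mc -> ma + mb + mc = A ->
  `|ma| + `|mb| + `|mc| < N ->
  exists na nb nc, [/\ ma = A * na, mb = A * nb & mc = A * nc].

(** By Cramer's rule each coefficient is, up to sign, the area of the triangle in which x replaces a
    vertex, so the minimality of A applies to it. *)
Lemma area_coeff a b c x ma mb mc : X a -> X b -> X c -> X x ->
  `|area a b c| = A -> A *: x = comb a b c ma mb mc -> ma + mb + mc = A ->
  [/\ ma = 0 \/ A <= `|ma|, mb = 0 \/ A <= `|mb| & mc = 0 \/ A <= `|mc| ].
Proof.
move=> Xa Xb Xc Xx Aabc Ex ms.
have Ei : A * x 0 i = ma * a 0 i + mb * b 0 i + mc * c 0 i.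
  by have := congr1 (fun v : vec => v 0 i) Ex; rewrite !vecE.
have Ej : A * x 0 j = ma * a 0 j + mb * b 0 j + mc * c 0 j.
  by have := congr1 (fun v : vec => v 0 j) Ex; rewrite !vecE.
have aux m (r : int) : A * r = m * area a b c -> r = 0 \/ A <= `|r| -> m = 0 \/ A <= `|m|.
  move=> /(congr1 (@Num.norm _ _)); rewrite !normrM Aabc (gtr0_norm A0) mulrC.
  by move=> /(mulIf (lt0r_neq0 A0)) rm; lia.
split.
- apply: (aux _ (area x b c)); last exact: Amin.
  transitivity (A * (b 0 i * c 0 j - b 0 j * c 0 i) + (A * x 0 i) * (b 0 j - c 0 j) -
    (A * x 0 j) * (b 0 i - c 0 i)); first by rewrite /area; ring.
  by rewrite Ei Ej -ms /area; ring.
- apply: (aux _ (area a x c)); last exact: Amin.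
  transitivity (A * (c 0 i * a 0 j - c 0 j * a 0 i) + (A * x 0 i) * (c 0 j - a 0 j) -
    (A * x 0 j) * (c 0 i - a 0 i)); first by rewrite /area; ring.
  by rewrite Ei Ej -ms /area; ring.
- apply: (aux _ (area a b x)); last exact: Amin.
  transitivity (A * (a 0 i * b 0 j - a 0 j * b 0 i) + (A * x 0 i) * (a 0 j - b 0 j) -
    (A * x 0 j) * (a 0 i - b 0 i)); first by rewrite /area; ring.
  by rewrite Ei Ej -ms /area; ring.
Qed.

(** The reflections of [comb_one_neg] preserve the absolute area, so the new triangle is still
    minimal. The gap from [area_coeff] plays the role of integrality. *)
Lemma lattice_one_neg N a b c x ma mb mc : lattice_pts N -> X a -> X b -> X c -> X x ->
  `|area a b c| = A -> A *: x = comb a b c ma mb mc -> ma + mb + mc = A ->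
  `|ma| + `|mb| + `|mc| <= N -> 0 <= ma -> 0 <= mb -> mc < 0 ->
  exists na nb nc, [/\ ma = A * na, mb = A * nb & mc = A * nc].
Proof.
move=> IH Xa Xb Xc Xx Aabc Ex ms mN ma0 mb0 mc0.
wlog mab : a b ma mb Xa Xb Aabc Ex ms mN ma0 mb0 / mb <= ma.
  move=> H; have [mab|/ltW mab] := leP mb ma; first exact: (H a b ma mb Xa Xb Aabc Ex).
  have F1 : `|area b a c| = A by rewrite -Aabc -normrN; congr (`| _ |); rewrite /area; ring.
  have F2 : A *: x = comb b a c mb ma mc.
    by rewrite Ex; apply: vecP => k; rewrite !vecE; lia.
  have F3 : mb + ma + mc = A by lia.
  have F4 : `|mb| + `|ma| + `|mc| <= N by lia.
  have [na [nb [nc [D1 D2 D3]]]] := H b a mb ma Xb Xa F1 F2 F3 F4 mb0 ma0 mab.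
  by exists nb, na, nc.
have [Ca Cb Cc] := area_coeff Xa Xb Xc Xx Aabc Ex ms.
have Y k : A * x 0 k = ma * a 0 k + mb * b 0 k + mc * c 0 k.
  by have := congr1 (fun v : vec => v 0 k) Ex; rewrite !vecE.
have [mb1|mb1] := eqVneq mb 0.
  have Xz : X (a + a - c).
    apply: closed_sub => //; apply: (@nonneg_scale _ (- mc)); first lia.
    move=> k; rewrite !vecE.
    have -> : - mc * (a 0 k + a 0 k - c 0 k) = A * x 0 k + (- mc - A) * a 0 k.
      by rewrite Y mb1 (_ : ma = A - mc); [ring|lia].
    by rewrite addr_ge0// mulr_ge0// ?X0//; lia.
  have [||||na [nb [nc [E1 E2 E3]]]] := IH a b (a + a - c) x (ma + 2 * mc) 0 (- mc) Xa Xb Xz Xx.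
  - by rewrite -Aabc -normrN; congr (`| _ |); rewrite /area !vecE; ring.
  - by rewrite Ex; apply: vecP => k; rewrite !vecE mb1; ring.
  - by lia.
  - by lia.
  by exists (na + 2 * nc), nb, (- nc); rewrite mulrDr mulrCA mulrN; split; lia.
have Xz : X (a + b - c).
  apply: closed_sub => //; apply: (@nonneg_scale _ (- mc)); first lia.
  move=> k; rewrite !vecE.
  have -> : - mc * (a 0 k + b 0 k - c 0 k) =
      A * x 0 k + ((- mc - ma) * a 0 k + (- mc - mb) * b 0 k) by rewrite Y; ring.
  by rewrite addr_ge0 ?addr_ge0 ?mulr_ge0 ?X0//; lia.
have [||||na [nb [nc [E1 E2 E3]]]] :=
   IH a b (a + b - c) x (ma + mc) (mb + mc) (- mc) Xa Xb Xz Xx.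
- by rewrite -Aabc -normrN; congr (`| _ |); rewrite /area !vecE; ring.
- by rewrite Ex; apply: vecP => k; rewrite !vecE; ring.
- by lia.
- by lia.
by exists (na + nc), (nb + nc), (- nc); rewrite !mulrDr mulrN; split; lia.
Qed.

(** The descent of [comb_two_neg] works unless mb and mc are within A of each other and both small;
    that remaining case is settled directly. *)
Lemma lattice_two_neg N a b c x ma mb mc : lattice_pts N -> X a -> X b -> X c -> X x ->
  `|area a b c| = A -> A *: x = comb a b c ma mb mc -> ma + mb + mc = A ->
  `|ma| + `|mb| + `|mc| <= N -> mb < 0 -> mc < 0 ->
  exists na nb nc, [/\ ma = A * na, mb = A * nb & mc = A * nc].
Proof.
move=> IH Xa Xb Xc Xx Aabc Ex ms mN mb0 mc0.
wlog mbc : b c mb mc Xb Xc Aabc Ex ms mN mb0 mc0 / mb <= mc.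
  move=> H; have [mab|/ltW mab] := leP mb mc; first exact: (H b c mb mc Xb Xc Aabc Ex).
  have F1 : `|area a c b| = A by rewrite -Aabc -normrN; congr (`| _ |); rewrite /area; ring.
  have F2 : A *: x = comb a c b ma mc mb.
    by rewrite Ex; apply: vecP => k; rewrite !vecE; lia.
  have F3 : ma + mc + mb = A by lia.
  have F4 : `|ma| + `|mc| + `|mb| <= N by lia.
  have [na [nb [nc [D1 D2 D3]]]] := H c b mc mb Xc Xb F1 F2 F3 F4 mc0 mb0 mab.
  by exists na, nc, nb.
have [Ca Cb Cc] := area_coeff Xa Xb Xc Xx Aabc Ex ms.
have Y k : A * x 0 k = ma * a 0 k + mb * b 0 k + mc * c 0 k.
  by have := congr1 (fun v : vec => v 0 k) Ex; rewrite !vecE.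
have maE : ma = A - mb - mc by lia.
have [far|near] := leP mb (mc - A).
  have Xz : X (a + a - b).
    apply: closed_sub => //; apply: (@nonneg_scale _ (- mb)); first lia.
    move=> k; rewrite !vecE.
    have -> : - mb * (a 0 k + a 0 k - b 0 k) =
        A * x 0 k + ((- mb + mc - A) * a 0 k + (- mc) * c 0 k) by rewrite Y maE; ring.
    by rewrite addr_ge0 ?addr_ge0 ?mulr_ge0 ?X0//; lia.
  have [||||na [nb [nc [E1 E2 E3]]]] :=
    IH a (a + a - b) c x (ma + 2 * mb) (- mb) mc Xa Xz Xc Xx.
  - by rewrite -Aabc -normrN; congr (`| _ |); rewrite /area !vecE; ring.
  - by rewrite Ex; apply: vecP => k; rewrite !vecE; ring.
  - by lia.
  - by lia.
  by exists (na + 2 * nb), (- nb), nc; rewrite mulrDr mulrCA mulrN; split; lia.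
have [big|small] := leP mc (- (2 * A)).
  have Xz : X (a + a + a - b - c).
    apply: closed_sub2 => //; apply: (@nonneg_scale _ (- mc)); first lia.
    move=> k; rewrite !vecE.
    have -> : - mc * (a 0 k + a 0 k + a 0 k - b 0 k - c 0 k) =
       A * x 0 k + ((- 2 * mc + mb - A) * a 0 k + (mc - mb) * b 0 k) by rewrite Y maE; ring.
    by rewrite addr_ge0 ?addr_ge0 ?mulr_ge0 ?X0//; lia.
  have [||||na [nb [nc [E1 E2 E3]]]] :=
    IH a b (a + a + a - b - c) x (ma + 3 * mc) (mb - mc) (- mc) Xa Xb Xz Xx.
  - by rewrite -Aabc -normrN; congr (`| _ |); rewrite /area !vecE; ring.
  - by rewrite Ex; apply: vecP => k; rewrite !vecE; ring.
  - by lia.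
  - by lia.
  by exists (na + 3 * nc), (nb - nc), (- nc); rewrite mulrDr mulrBr mulrCA mulrN; split; lia.
(* Here x is moved instead of a vertex: the new point has coefficients A + mb and A + mc in (-A, 0],
   so the gap forces both to be 0. *)
have Xz : X (x + b + c - a - a).
  apply: closed_sub2 => //; apply: (@nonneg_scale _ (A * ma)); first by rewrite mulr_gt0//; lia.
  move=> k; rewrite !vecE.
  have -> : A * ma * (x 0 k + b 0 k + c 0 k - a 0 k - a 0 k) =
     A * ((ma - 2 * A) * x 0 k + (ma + 2 * mb) * b 0 k + (ma + 2 * mc) * c 0 k).
    transitivity (A * (ma * x 0 k + ma * b 0 k + ma * c 0 k - 2 * (ma * a 0 k))); first by ring.
    congr (_ * _); have -> : ma * a 0 k = A * x 0 k - mb * b 0 k - mc * c 0 k by rewrite Y; ring.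
    by ring.
  by rewrite mulr_ge0 ?(ltW A0)// !addr_ge0 ?mulr_ge0 ?X0//; lia.
have Ez : A *: (x + b + c - a - a) = comb a b c (ma - 2 * A) (A + mb) (A + mc).
  apply: vecP => k; rewrite !vecE.
  transitivity (A * x 0 k + A * b 0 k + A * c 0 k - 2 * A * a 0 k); first by ring.
  by rewrite Y; ring.
have [|Za Zb Zc] := area_coeff Xa Xb Xc Xz Aabc Ez; first by lia.
have mcE : mc = - A by lia.
have mbE : mb = - A by lia.
by exists 3, (-1), (-1); rewrite mulrN1; split; lia.
Qed.

Lemma lattice_coords a b c x ma mb mc : X a -> X b -> X c -> X x ->
  `|area a b c| = A -> A *: x = comb a b c ma mb mc -> ma + mb + mc = A ->
  exists na nb nc, [/\ ma = A * na, mb = A * nb & mc = A * nc].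
Proof.
suff H (n : nat) : lattice_pts n%:Z.
  move=> Xa Xb Xc Xx Aabc Ex ms.
  apply: (H (absz ma + absz mb + absz mc).+1 a b c x) => //.
  by rewrite -addn1 !PoszD !abszE; lia.
elim: n => [|n IH] {}a {}b {}c {}x {}ma {}mb {}mc Xa Xb Xc Xx Aabc Ex ms mN; first by lia.
have mN' : `|ma| + `|mb| + `|mc| <= n%:Z by lia.
have P1 := comb_perm1 a b c ma mb mc; have P2 := comb_perm1 b c a mb mc ma.
have E1 := Ex; rewrite P1 in E1; have E2 := E1; rewrite P2 in E2.
have A1 : `|area b c a| = A by rewrite -Aabc; congr (`| _ |); rewrite /area; ring.
have A2 : `|area c a b| = A by rewrite -Aabc; congr (`| _ |); rewrite /area; ring.
have s1 : mb + mc + ma = A by lia.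
have s2 : mc + ma + mb = A by lia.
have n1 : `|mb| + `|mc| + `|ma| <= n%:Z by lia.
have n2 : `|mc| + `|ma| + `|mb| <= n%:Z by lia.
have [ma0|ma0] := leP 0 ma; have [mb0|mb0] := leP 0 mb; have [mc0|mc0] := leP 0 mc.
- have [Ca Cb Cc] := area_coeff Xa Xb Xc Xx Aabc Ex ms.
  have [?|[?|?]] : ma = A \/ mb = A \/ mc = A by lia.
  + by exists 1, 0, 0; rewrite mulr1 mulr0; split; lia.
  + by exists 0, 1, 0; rewrite mulr1 mulr0; split; lia.
  + by exists 0, 0, 1; rewrite mulr1 mulr0; split; lia.
- exact: (lattice_one_neg IH Xa Xb Xc Xx Aabc Ex).
- have [na [nb [nc [D1 D2 D3]]]] := lattice_one_neg IH Xc Xa Xb Xx A2 E2 s2 n2 mc0 ma0 mb0.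
  by exists nb, nc, na.
- exact: (lattice_two_neg IH Xa Xb Xc Xx Aabc Ex).
- have [na [nb [nc [D1 D2 D3]]]] := lattice_one_neg IH Xb Xc Xa Xx A1 E1 s1 n1 mb0 mc0 ma0.
  by exists nc, na, nb.
- have [na [nb [nc [D1 D2 D3]]]] := lattice_two_neg IH Xb Xc Xa Xx A1 E1 s1 n1 mc0 ma0.
  by exists nc, na, nb.
- have [na [nb [nc [D1 D2 D3]]]] := lattice_two_neg IH Xc Xa Xb Xx A2 E2 s2 n2 ma0 mb0.
  by exists nb, nc, na.
- by lia.
Qed.

End Plane.

(** Relative to a triangle of least nonzero area all points of X are integer affine combinations of
    the vertices, hence so is a point plus any sum of differences, and [affine_comb_closed]
    applies. *)
Lemma plane_closed d (X : set 'rV[int]_d) (i j : 'I_d) :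
  (forall x : 'rV[int]_d, X x -> nonneg x) -> closed_upto 2 X ->
  (forall a b c x : 'rV[int]_d, X a -> X b -> X c -> X x -> area i j a b c *: x =
     comb a b c (area i j x b c) (area i j a x c) (area i j a b x)) ->
  (exists a b c : 'rV[int]_d, [/\ X a, X b, X c & area i j a b c != 0]) ->
  forall n, closed_upto n X.
Proof.
move=> X0 c2 plan [a0 [b0 [c0 [Xa0 Xb0 Xc0 ar0]]]].
pose P n := `[< exists a b c : 'rV[int]_d,
   [/\ X a, X b, X c & area i j a b c != 0 /\ absz (area i j a b c) = n] >].
have exP : exists n, P n.
  by exists (absz (area i j a0 b0 c0)); apply/asboolP; exists a0, b0, c0.
have [m /asboolP[a [b [c [Xa Xb Xc [ar arm]]]]] mmin] := ex_minnP exP.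
pose A : int := m%:Z.
have arA : `|area i j a b c| = A by rewrite -abszE arm.
have A0 : 0 < A by rewrite -arA normr_gt0.
have Amin (p q r : 'rV[int]_d) : X p -> X q -> X r ->
    area i j p q r = 0 \/ A <= `|area i j p q r|.
  move=> Xp Xq Xr; have [->|pqr] := eqVneq (area i j p q r) 0; [by left|right].
  rewrite -abszE lez_nat; apply: mmin; apply/asboolP; exists p, q, r; split=> //.
have rep (x : 'rV[int]_d) : X x -> exists na nb nc : int, na + nb + nc = 1 /\ x = comb a b c na nb nc.
  move=> Xx; have Ex := plan a b c x Xa Xb Xc Xx.
  set ma := area i j x b c in Ex; set mb := area i j a x c in Ex; set mc := area i j a b x in Ex.
  have ms : ma + mb + mc = area i j a b c by rewrite /ma /mb /mc /area; ring.
  (* e is the sign of the area. *)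
  have fin (e : int) : e * area i j a b c = A ->
      exists na nb nc : int, na + nb + nc = 1 /\ x = comb a b c na nb nc.
    move=> eA; have [||na [nb [nc [E1 E2 E3]]]] :=
      @lattice_coords _ X X0 c2 i j A A0 Amin a b c x (e * ma) (e * mb) (e * mc) Xa Xb Xc Xx arA.
    - rewrite -eA; apply: vecP => k; have := congr1 (fun v : 'rV[int]_d => v 0 k) Ex.
      by rewrite !vecE -!mulrA => ->; ring.
    - by rewrite -eA -ms; ring.
    exists na, nb, nc; split.
      apply: (mulfI (lt0r_neq0 A0)); rewrite !mulrDr -E1 -E2 -E3 mulr1 -eA -ms; ring.
    apply: vecP => k; apply: (mulfI (lt0r_neq0 A0)).
    have Ek : area i j a b c * x 0 k = ma * a 0 k + mb * b 0 k + mc * c 0 k.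
      by have := congr1 (fun v : 'rV[int]_d => v 0 k) Ex; rewrite !vecE.
    rewrite -{1}eA -mulrA Ek !vecE !mulrDr !mulrA -E1 -E2 -E3; ring.
  have [p|p] := leP 0 (area i j a b c).
    by apply: (fin 1); rewrite mul1r -arA ger0_norm.
  by apply: (fin (-1)); rewrite mulN1r -arA ltr0_norm.
move=> n v l Xv _ Hl Hv.
have repl : exists na nb nc : int, na + nb + nc = 1 /\ v + \sum_(h <- l) h = comb a b c na nb nc.
  elim: l {Hv} Hl => [|h l IH] Hl; first by rewrite big_nil addr0; exact: rep.
  have [|na [nb [nc [n1 E]]]] := IH; first by move=> k kl; apply: Hl; rewrite inE kl orbT.
  have [p Xp [q Xq pq]] : diffset X h by apply: Hl; rewrite inE eqxx.
  have [pa [pb [pc [p1 Ep]]]] := rep p Xp; have [qa [qb [qc [q1 Eq]]]] := rep q Xq.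
  exists (na + pa - qa), (nb + pb - qb), (nc + pc - qc); split; first by lia.
  rewrite big_cons addrCA E -pq Ep Eq; apply: vecP => k; rewrite !vecE; ring.
have [na [nb [nc [n1 E]]]] := repl; rewrite E in Hv *.
exact: affine_comb_closed.
Qed.

Lemma nonzero_coord d (X : set 'rV[int]_d) (x : 'rV[int]_d) :
  (forall y : 'rV[int]_d, X y -> nonneg y) -> X x -> x != 0 -> exists j : 'I_d, 1 <= x 0 j.
Proof.
move=> X0 Xx; apply: contra_neqP => /forallNP H; apply: vecP => j; rewrite vec0.
by have := X0 x Xx j; have := H j; lia.
Qed.

(** * Bounded sets and their linear relations *)

Section Bounded.
Variable d : nat.
Local Notation vec := 'rV[int]_d.
Variable X : set vec.
Hypothesis X0 : forall x : vec, X x -> nonneg x.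
Hypothesis c2 : closed_upto 2 X.
Variable B : int.
Hypothesis XB : forall (x : vec) j, X x -> x 0 j <= B.
Implicit Types (p q r x y : vec) (m s a b c : int) (j : 'I_d).

Lemma bounded_trivial : X 0 -> forall x, X x -> x = 0.
Proof.
move=> X00 x Xx; have mult (n : nat) : X (n%:Z *: x).
  elim: n => [|n IH]; first by rewrite scale0r.
  have -> : n.+1%:Z *: x = n%:Z *: x + x - 0.
    by apply: vecP => j; rewrite !vecE -addn1 PoszD; ring.
  apply: closed_sub => // j; rewrite !vecE oppr0 addr0 addr_ge0 ?mulr_ge0//; exact: X0.
apply: vecP => j; rewrite vec0; apply/eqP; rewrite eq_le (X0 Xx) andbT leNgt; apply/negP => xj.
have := XB j (mult (absz B).+1); rewrite vecZ -addn1 PoszD abszE.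
have := ler_norm B; nia.
Qed.

(** A point of X in the cone over p, q, r, with the denominator m of its coordinates cleared. It
    lies in the affine span of p, q, r when a + b + c = m. *)
Definition cone_pt p q r m a b c :=
  [/\ 0 <= a, 0 <= b, 0 <= c & exists2 x, X x & m *: x = comb p q r a b c].

Lemma cone_bound p q r m a b c : 0 < m -> X p -> X q -> X r ->
  p != 0 -> q != 0 -> r != 0 -> cone_pt p q r m a b c -> [/\ a <= m * B, b <= m * B & c <= m * B].
Proof.
move=> m0 Xp Xq Xr p0 q0 r0 [a0 b0 c0 [x Xx E]].
have Y j : m * x 0 j = a * p 0 j + b * q 0 j + c * r 0 j.
  by have := congr1 (fun v : vec => v 0 j) E; rewrite !vecE.
have xB j : m * x 0 j <= m * B by rewrite ler_wpM2l ?(ltW m0)// XB.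
split.
- have [j pj] := nonzero_coord X0 Xp p0; apply: le_trans (xB j); rewrite Y -addrA.
  by rewrite -[leLHS]addr0 lerD ?addr_ge0 ?mulr_ge0 ?X0// ler_peMr.
- have [j pj] := nonzero_coord X0 Xq q0; apply: le_trans (xB j); rewrite Y addrAC addrC.
  by rewrite -[leLHS]addr0 lerD ?addr_ge0 ?mulr_ge0 ?X0// ler_peMr.
- have [j pj] := nonzero_coord X0 Xr r0; apply: le_trans (xB j); rewrite Y addrC.
  by rewrite -[leLHS]addr0 lerD ?addr_ge0 ?mulr_ge0 ?X0// ler_peMr.
Qed.

(** Passing from x to 2x - p doubles the excess a + b + c - m; the point p + q + r - 2x of
    [cone_complement] multiplies it by -2. *)
Lemma cone_reflect p q r m a b c : 0 < m -> X p -> X q -> X r ->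
  cone_pt p q r m a b c -> m <= 2 * a -> cone_pt p q r m (2 * a - m) (2 * b) (2 * c).
Proof.
move=> m0 Xp Xq Xr [a0 b0 c0 [x Xx E]] ma; split; [lia..|].
have Y j : m * x 0 j = a * p 0 j + b * q 0 j + c * r 0 j.
  by have := congr1 (fun v : vec => v 0 j) E; rewrite !vecE.
have Z j : m * (x 0 j + x 0 j - p 0 j) = (2 * a - m) * p 0 j + 2 * b * q 0 j + 2 * c * r 0 j.
  transitivity (2 * (m * x 0 j) - m * p 0 j); first by ring.
  by rewrite Y; ring.
exists (x + x - p); last by apply: vecP => j; rewrite !vecE Z.
apply: closed_sub => //; apply: (@nonneg_scale _ _ m) => // j.
by rewrite !vecE Z !addr_ge0 ?mulr_ge0 ?X0//; lia.
Qed.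

Lemma cone_complement p q r m a b c : 0 < m -> X p -> X q -> X r ->
  cone_pt p q r m a b c -> 2 * a <= m -> 2 * b <= m -> 2 * c <= m ->
  cone_pt p q r m (m - 2 * a) (m - 2 * b) (m - 2 * c).
Proof.
move=> m0 Xp Xq Xr [a0 b0 c0 [x Xx E]] ma mb mc; split; [lia..|].
have Y j : m * x 0 j = a * p 0 j + b * q 0 j + c * r 0 j.
  by have := congr1 (fun v : vec => v 0 j) E; rewrite !vecE.
have Z j : m * (p 0 j + q 0 j + r 0 j - x 0 j - x 0 j) =
    (m - 2 * a) * p 0 j + (m - 2 * b) * q 0 j + (m - 2 * c) * r 0 j.
  transitivity (m * p 0 j + m * q 0 j + m * r 0 j - 2 * (m * x 0 j)); first by ring.
  by rewrite Y; ring.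
exists (p + q + r - x - x); last by apply: vecP => j; rewrite !vecE Z.
apply: closed_sub2 => //; apply: (@nonneg_scale _ _ m) => // j.
by rewrite !vecE Z !addr_ge0 ?mulr_ge0 ?X0//; lia.
Qed.

End Bounded.

Section ConeSum.
Variable d : nat.
Local Notation vec := 'rV[int]_d.
Variable X : set vec.
Hypothesis X0 : forall x : vec, X x -> nonneg x.
Hypothesis c2 : closed_upto 2 X.
Variable B : int.
Hypothesis XB : forall (x : vec) j, X x -> x 0 j <= B.
Implicit Types (p q r s x y : vec) (m a b c ma mb mc md : int) (j : 'I_d).

Lemma cone_pt_perm p q r m a b c : cone_pt X p q r m a b c -> cone_pt X q r p m b c a.
Proof. by move=> [a0 b0 c0 [x Xx E]]; split=> //; exists x; rewrite // E comb_perm1. Qed.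

Lemma cone_reflect_any p q r m a b c : 0 < m -> X p -> X q -> X r ->
  cone_pt X p q r m a b c -> m <= 2 * a \/ m <= 2 * b \/ m <= 2 * c ->
  exists a' b' c', cone_pt X p q r m a' b' c' /\ a' + b' + c' = 2 * (a + b + c) - m.
Proof.
move=> m0 Xp Xq Xr Q [H|[H|H]].
- by exists (2 * a - m), (2 * b), (2 * c); split; [exact: (cone_reflect X0 c2 m0 Xp Xq Xr)|lia].
- have Q1 := cone_reflect X0 c2 m0 Xq Xr Xp (cone_pt_perm Q) H.
  exists (2 * a), (2 * b - m), (2 * c); split; last by lia.
  by apply: cone_pt_perm; apply: cone_pt_perm.
- have Q1 := cone_reflect X0 c2 m0 Xr Xp Xq (cone_pt_perm (cone_pt_perm Q)) H.
  exists (2 * a), (2 * b), (2 * c - m); split; last by lia.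
  exact: cone_pt_perm.
Qed.

(* Take the points of the cone maximizing and minimizing the coordinate sum: if it is
   not m, reflecting in a vertex or in the centroid improves one of them. *)
Lemma cone_sum p q r m a b c x : 0 < m -> X p -> X q -> X r -> p != 0 -> q != 0 -> r != 0 ->
  0 <= a -> 0 <= b -> 0 <= c -> X x -> m *: x = comb p q r a b c -> a + b + c = m.
Proof.
move=> m0 Xp Xq Xr p0 q0 r0 a0 b0 c0 Xx E.
have Q : cone_pt X p q r m a b c by split=> //; exists x.
pose P (n : nat) := `[< exists a b c, cone_pt X p q r m a b c /\ a + b + c = n%:Z >].
have toP a' b' c' : cone_pt X p q r m a' b' c' -> P (absz (a' + b' + c')).
  move=> Q'; apply/asboolP; exists a', b', c'; split=> //.
  by have [? ? ? _] := Q'; rewrite abszE; lia.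
have exP : exists n, P n by exists (absz (a + b + c)); exact: toP.
have ubP n : P n -> (n <= absz (3 * (m * B))%R)%N.
  move=> /asboolP[a' [b' [c' [Q' s]]]].
  have [] := cone_bound X0 XB m0 Xp Xq Xr p0 q0 r0 Q'.
  by rewrite -lez_nat -s abszE; lia.
have [u /asboolP[ua [ub [uc [Qu su]]]] umax] := ex_maxnP exP ubP.
have [l /asboolP[la [lb [lc [Ql sl]]]] lmin] := ex_minnP exP.
have umax' a' b' c' : cone_pt X p q r m a' b' c' -> a' + b' + c' <= u%:Z.
  move=> Q'; have := umax _ (toP _ _ _ Q'); rewrite -lez_nat abszE.
  by have [? ? ? _] := Q'; lia.
have lmin' a' b' c' : cone_pt X p q r m a' b' c' -> l%:Z <= a' + b' + c'.
  move=> Q'; have := lmin _ (toP _ _ _ Q'); rewrite -lez_nat abszE.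
  by have [? ? ? _] := Q'; lia.
(* With U and L the extreme excesses over m, maximality excludes a vertex reflection and the
   complement gives L <= -2U. Likewise U >= -2L in [Hl], so U >= 4U: a positive U is impossible. *)
have Hu : m < u%:Z -> l%:Z <= 3 * m - 2 * u%:Z.
  move=> mu; have [H|H] := pselect (m <= 2 * ua \/ m <= 2 * ub \/ m <= 2 * uc).
    have [a' [b' [c' [Q' s']]]] := cone_reflect_any m0 Xp Xq Xr Qu H.
    by have := umax' _ _ _ Q'; lia.
  have [h1 [h2 h3]] : 2 * ua <= m /\ 2 * ub <= m /\ 2 * uc <= m by lia.
  by have := lmin' _ _ _ (cone_complement X0 c2 m0 Xp Xq Xr Qu h1 h2 h3); lia.
have Hl : l%:Z < m -> 3 * m - 2 * l%:Z <= u%:Z.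
  move=> ml; have [H|H] := pselect (m < 2 * la \/ m < 2 * lb \/ m < 2 * lc).
    have [|a' [b' [c' [Q' s']]]] := cone_reflect_any m0 Xp Xq Xr Ql; first by lia.
    by have := lmin' _ _ _ Q'; lia.
  have [h1 [h2 h3]] : 2 * la <= m /\ 2 * lb <= m /\ 2 * lc <= m by lia.
  by have := umax' _ _ _ (cone_complement X0 c2 m0 Xp Xq Xr Ql h1 h2 h3); lia.
by have := umax' _ _ _ Q; have := lmin' _ _ _ Q; lia.
Qed.

Lemma scale_eq0 p m : X p -> p != 0 -> (forall j, m * p 0 j = 0) -> m = 0.
Proof.
move=> Xp p0 H; have [j pj] := nonzero_coord X0 Xp p0.
by have := H j => /eqP; rewrite mulf_eq0 => /orP[/eqP//|/eqP]; lia.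
Qed.

Lemma rel_nonneg p q r s ma mb mc md : X p -> X q -> X r -> X s ->
  p != 0 -> q != 0 -> r != 0 -> s != 0 -> 0 <= ma -> 0 <= mb -> 0 <= mc -> 0 <= md ->
  ma *: p + mb *: q + mc *: r = md *: s -> ma + mb + mc = md.
Proof.
move=> Xp Xq Xr Xs p0 q0 r0 s0 a0 b0 c0 d0 E.
move: d0; rewrite le_eqVlt => /orP[/eqP d0|d0]; last exact: (cone_sum d0 Xp Xq Xr p0 q0 r0 a0 b0 c0 Xs).
have Y j : ma * p 0 j + mb * q 0 j + mc * r 0 j = 0.
  by have := congr1 (fun v : vec => v 0 j) E; rewrite -d0 !vecE mul0r.
have nn (a : int) (v : vec) j : 0 <= a -> X v -> 0 <= a * v 0 j.
  by move=> ? ?; rewrite mulr_ge0// X0.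
have ma0 : ma = 0.
  by apply: (scale_eq0 Xp p0) => j; have := Y j; have := nn _ _ j a0 Xp;
     have := nn _ _ j b0 Xq; have := nn _ _ j c0 Xr; lia.
have mb0 : mb = 0.
  by apply: (scale_eq0 Xq q0) => j; have := Y j; have := nn _ _ j a0 Xp;
     have := nn _ _ j b0 Xq; have := nn _ _ j c0 Xr; lia.
have mc0 : mc = 0.
  by apply: (scale_eq0 Xr r0) => j; have := Y j; have := nn _ _ j a0 Xp;
     have := nn _ _ j b0 Xq; have := nn _ _ j c0 Xr; lia.
by rewrite ma0 mb0 mc0.
Qed.

(** As mc dominates ma and mb, the point p + q - r is nonnegative, hence in X, and mc times it lies
    in the cone over p, q, s. *)
Lemma rel_two_max p q r s ma mb mc md : X p -> X q -> X r -> X s ->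
  p != 0 -> q != 0 -> r != 0 -> s != 0 -> 0 <= ma -> 0 <= mb -> 0 <= mc -> 0 <= md ->
  ma <= mc -> mb <= mc ->
  ma *: p + mb *: q = mc *: r + md *: s -> ma + mb = mc + md.
Proof.
move=> Xp Xq Xr Xs p0 q0 r0 s0 a0 b0 c0 d0 ac bc E.
have Y j : ma * p 0 j + mb * q 0 j = mc * r 0 j + md * s 0 j.
  by have := congr1 (fun v : vec => v 0 j) E; rewrite !vecE.
move: c0; rewrite le_eqVlt => /orP[/eqP c0|c0].
  have [a1 b1] : ma = 0 /\ mb = 0 by split; lia.
  have : md = 0; last by lia.
  by apply: (scale_eq0 Xs s0) => j; have := Y j; rewrite a1 b1 -c0 !mul0r; lia.
have Z j : mc * (p 0 j + q 0 j - r 0 j) = (mc - ma) * p 0 j + (mc - mb) * q 0 j + md * s 0 j.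
  transitivity (mc * p 0 j + mc * q 0 j - mc * r 0 j); first by ring.
  have -> : mc * r 0 j = ma * p 0 j + mb * q 0 j - md * s 0 j by rewrite Y; ring.
  by ring.
have Xt : X (p + q - r).
  apply: closed_sub => //; apply: (@nonneg_scale _ _ mc) => // j.
  by rewrite !vecE Z !addr_ge0 ?mulr_ge0 ?X0//; lia.
have : (mc - ma) + (mc - mb) + md = mc; last by lia.
apply: (@cone_sum p q s mc _ _ _ (p + q - r)) => //; [lia|lia|].
by apply: vecP => j; rewrite !vecE Z.
Qed.

Lemma rel_two p q r s ma mb mc md : X p -> X q -> X r -> X s ->
  p != 0 -> q != 0 -> r != 0 -> s != 0 -> 0 <= ma -> 0 <= mb -> 0 <= mc -> 0 <= md ->
  ma *: p + mb *: q = mc *: r + md *: s -> ma + mb = mc + md.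
Proof.
move=> Xp Xq Xr Xs p0 q0 r0 s0 a0 b0 c0 d0 E.
have [H|[H|[H|H]]] : (ma <= mc /\ mb <= mc) \/ (ma <= md /\ mb <= md) \/
    (mc <= ma /\ md <= ma) \/ (mc <= mb /\ md <= mb) by lia.
- by case: H => H1 H2; exact: (rel_two_max Xp Xq Xr Xs).
- case: H => H1 H2; rewrite [RHS]addrC; apply: (rel_two_max Xp Xq Xs Xr) => //.
  by rewrite E addrC.
- case: H => H1 H2; apply/esym; exact: (rel_two_max Xr Xs Xp Xq).
- case: H => H1 H2; apply/esym; rewrite [RHS]addrC; apply: (rel_two_max Xr Xs Xq Xp) => //.
  by rewrite -E addrC.
Qed.

(** By signs the relation has three terms against one or two against two, or else all terms have the
    same sign and vanish. *)
Lemma bounded_relation p q r s ma mb mc md : X p -> X q -> X r -> X s ->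
  p != 0 -> q != 0 -> r != 0 -> s != 0 ->
  ma *: p + mb *: q + mc *: r + md *: s = 0 -> ma + mb + mc + md = 0.
Proof.
move=> Xp Xq Xr Xs p0 q0 r0 s0.
wlog d0 : ma mb mc md / md <= 0.
  move=> H E; have [d0|d0] := leP md 0; first exact: H.
  have : - ma + - mb + - mc + - md = 0; last by lia.
  apply: H; first by lia.
  apply: vecP => j; have := congr1 (fun v : vec => v 0 j) E; rewrite !vecE; lia.
move=> E; have Y j : ma * p 0 j + mb * q 0 j + mc * r 0 j + md * s 0 j = 0.
  by have := congr1 (fun v : vec => v 0 j) E; rewrite !vecE.
have [a0|a0] := leP 0 ma; have [b0|b0] := leP 0 mb; have [c0|c0] := leP 0 mc.
- have : ma + mb + mc = - md; last by lia.
  by apply: (rel_nonneg Xp Xq Xr Xs) => //; [lia|apply: vecP => j; rewrite !vecE; have := Y j; lia].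
- have : ma + mb = - mc + - md; last by lia.
  by apply: (rel_two Xp Xq Xr Xs) => //; [lia|lia|apply: vecP => j; rewrite !vecE; have := Y j; lia].
- have : ma + mc = - mb + - md; last by lia.
  by apply: (rel_two Xp Xr Xq Xs) => //; [lia|lia|apply: vecP => j; rewrite !vecE; have := Y j; lia].
- have : - mb + - mc + - md = ma; last by lia.
  by apply: (rel_nonneg Xq Xr Xs Xp) => //; [lia|lia|lia|apply: vecP => j; rewrite !vecE; have := Y j; lia].
- have : mb + mc = - ma + - md; last by lia.
  by apply: (rel_two Xq Xr Xp Xs) => //; [lia|lia|apply: vecP => j; rewrite !vecE; have := Y j; lia].
- have : - ma + - mc + - md = mb; last by lia.
  by apply: (rel_nonneg Xp Xr Xs Xq) => //; [lia|lia|lia|apply: vecP => j; rewrite !vecE; have := Y j; lia].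
- have : - ma + - mb + - md = mc; last by lia.
  by apply: (rel_nonneg Xp Xq Xs Xr) => //; [lia|lia|lia|apply: vecP => j; rewrite !vecE; have := Y j; lia].
- have nn (a : int) (v : vec) j : a <= 0 -> X v -> a * v 0 j <= 0.
    by move=> ? ?; rewrite mulr_le0_ge0// X0.
  have : ma = 0; last by lia.
  by apply: (scale_eq0 Xp p0) => j; have := Y j; have := nn _ _ j (ltW a0) Xp;
     have := nn _ _ j (ltW b0) Xq; have := nn _ _ j (ltW c0) Xr; have := nn _ _ j d0 Xs; lia.
Qed.

End ConeSum.

(** * Three-dimensional sets in N_0^3 *)

Section Space.
Local Notation vec := 'rV[int]_3.
Variable X : set vec.
Hypothesis X0 : forall x : vec, X x -> nonneg x.
Hypothesis c2 : closed_upto 2 X.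
Variables i j k : 'I_3.
Hypothesis cover : forall m : 'I_3, m = i \/ m = j \/ m = k.
Implicit Types (a b c e h x y v s p q r : vec) (l : seq vec) (m : 'I_3).

Definition unbounded m := forall M : int, exists2 x : vec, X x & M <= x 0 m.

Definition det2 (u v : vec) : int := u 0 i * v 0 j - u 0 j * v 0 i.

Definition det3 (u v w : vec) : int :=
  w 0 k * det2 u v - v 0 k * det2 u w + u 0 k * det2 v w.

Lemma nonneg_cover x : 0 <= x 0 i -> 0 <= x 0 j -> 0 <= x 0 k -> nonneg x.
Proof. by move=> xi xj xk m; case: (cover m) => [->|[->|->]]. Qed.

Lemma merge_pos a b c e : X a -> X b -> X c -> X e ->
  (exists2 x : vec, X x & nonneg (x + (a - b) + (c - e))) -> diffset X (a - b + (c - e)).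
Proof.
move=> Xa Xb Xc Xe [x Xx Hx].
have Xy : X (x + (a - b) + (c - e)) by apply: closed2P => //; exact: diffsetI.
have -> : a - b + (c - e) = (x + (a - b) + (c - e)) - x.
  by apply: vecP => m; rewrite !vecE; lia.
exact: diffsetI.
Qed.

Lemma merge_neg a b c e : X a -> X b -> X c -> X e ->
  (exists2 x : vec, X x & nonneg (x + (b - a) + (e - c))) -> diffset X (a - b + (c - e)).
Proof.
move=> Xa Xb Xc Xe H; have := merge_pos Xb Xa Xe Xc H => /diffsetN.
by congr (diffset X _); apply: vecP => m; rewrite !vecE; lia.
Qed.

(** A point with a huge j or k coordinate absorbs h + s, or its opposite, unless another coordinate
    obstructs. So the i entry of h + s has strictly the opposite sign to its j and k entries;
    starting from the endpoints of h and s shows that both have that sign at i. *)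
Lemma bad_pair h s v : unbounded j -> unbounded k -> X v -> diffset X h -> diffset X s ->
  ~ diffset X (h + s) ->
  [/\ 0 < h 0 i, 0 < s 0 i, h 0 j + s 0 j < 0, h 0 k + s 0 k < 0 & ~ nonneg (v + (h + s))] \/
  [/\ h 0 i < 0, s 0 i < 0, 0 < h 0 j + s 0 j, 0 < h 0 k + s 0 k & ~ nonneg (v + (h + s))].
Proof.
move=> uj uk Xv [a Xa [b Xb <-]] [c Xc [e Xe <-]] bad.
have pos x : X x -> ~ nonneg (x + (a - b) + (c - e)).
  by move=> Xx Hx; apply: bad; apply: merge_pos => //; exists x.
have neg x : X x -> ~ nonneg (x + (b - a) + (e - c)).
  by move=> Xx Hx; apply: bad; apply: merge_neg => //; exists x.
have [xj Xxj Hj] := uj (`|a 0 j - b 0 j + (c 0 j - e 0 j)|).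
have [xk Xxk Hk] := uk (`|a 0 k - b 0 k + (c 0 k - e 0 k)|).
have n1 : ~ (0 <= a 0 i - b 0 i + (c 0 i - e 0 i) /\ 0 <= a 0 k - b 0 k + (c 0 k - e 0 k)).
  move=> [h1 h2]; apply: (pos _ Xxj); have xi := X0 Xxj i; have xk' := X0 Xxj k.
  by apply: nonneg_cover; rewrite !vecE; lia.
have n2 : ~ (a 0 i - b 0 i + (c 0 i - e 0 i) <= 0 /\ a 0 k - b 0 k + (c 0 k - e 0 k) <= 0).
  move=> [h1 h2]; apply: (neg _ Xxj); have xi := X0 Xxj i; have xk' := X0 Xxj k.
  by apply: nonneg_cover; rewrite !vecE; lia.
have n3 : ~ (0 <= a 0 i - b 0 i + (c 0 i - e 0 i) /\ 0 <= a 0 j - b 0 j + (c 0 j - e 0 j)).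
  move=> [h1 h2]; apply: (pos _ Xxk); have xi := X0 Xxk i; have xk' := X0 Xxk j.
  by apply: nonneg_cover; rewrite !vecE; lia.
have n4 : ~ (a 0 i - b 0 i + (c 0 i - e 0 i) <= 0 /\ a 0 j - b 0 j + (c 0 j - e 0 j) <= 0).
  move=> [h1 h2]; apply: (neg _ Xxk); have xi := X0 Xxk i; have xk' := X0 Xxk j.
  by apply: nonneg_cover; rewrite !vecE; lia.
have nv : ~ nonneg (v + (a - b + (c - e))) by rewrite addrA; exact: pos.
have [ai bi ci ei] := And4 (X0 Xa i) (X0 Xb i) (X0 Xc i) (X0 Xe i).
have [aj bj cj ej] := And4 (X0 Xa j) (X0 Xb j) (X0 Xc j) (X0 Xe j).
have [ak bk ck ek] := And4 (X0 Xa k) (X0 Xb k) (X0 Xc k) (X0 Xe k).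
have [si|si] := ltP 0 (a 0 i - b 0 i + (c 0 i - e 0 i)); [left|right].
  have hi : 0 < a 0 i - b 0 i.
    rewrite ltNge; apply/negP => hi; apply: (neg _ Xc).
    by apply: nonneg_cover; rewrite !vecE; lia.
  have hi' : 0 < c 0 i - e 0 i.
    rewrite ltNge; apply/negP => hi'; apply: (neg _ Xa).
    by apply: nonneg_cover; rewrite !vecE; lia.
  by split=> //; rewrite !vecE; lia.
have hi : a 0 i - b 0 i < 0.
  rewrite ltNge; apply/negP => hi; apply: (pos _ Xe).
  by apply: nonneg_cover; rewrite !vecE; lia.
have hi' : c 0 i - e 0 i < 0.
  rewrite ltNge; apply/negP => hi'; apply: (pos _ Xb).
  by apply: nonneg_cover; rewrite !vecE; lia.
by split=> //; rewrite !vecE; lia.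
Qed.

(** In a minimal sum without mergeable pair, all terms are positive at i and have pairwise negative
    sums at j and k. Yet each term must be positive at j or k, so among three terms two share such a
    coordinate. *)
Lemma space_merge : unbounded j -> unbounded k -> forall n, closed_upto n X.
Proof.
move=> uj uk; apply: closed_of_merge; first exact: closed_le c2.
move=> v l Xv l0 Hl Hv H1 H2; apply: contrapT => noM.
have pair h s : h \in l -> s \in rem h l ->
  [/\ 0 < h 0 i, 0 < s 0 i, h 0 j + s 0 j < 0, h 0 k + s 0 k < 0 & ~ nonneg (v + (h + s))] \/
  [/\ h 0 i < 0, s 0 i < 0, 0 < h 0 j + s 0 j, 0 < h 0 k + s 0 k & ~ nonneg (v + (h + s))].
  move=> hl sl; apply: bad_pair => //; [exact: Hl|exact: Hl (mem_rem sl)|].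
  by move=> D; apply: noM; exists h, s.
case: l => [//|h1 [|h2 l]] in l0 Hl Hv H1 H2 noM pair *.
  by apply: (H1 h1); rewrite ?inE ?eqxx//; rewrite big_seq1 in Hv.
have r1 : rem h1 [:: h1, h2 & l] = h2 :: l by rewrite /= eqxx.
have h1l : h1 \in [:: h1, h2 & l] by rewrite inE eqxx.
have p1 s (sl : s \in h2 :: l) :=
  pair h1 s h1l (etrans (congr1 (fun t : seq vec => s \in t) r1) sl).
have h2l : h2 \in h2 :: l by rewrite inE eqxx.
(* In the negative case all other terms decrease coordinate i as well, so v + h1 + h2 is nonnegative
   because the full sum is. *)
have [[a1 a2 a3 a4 a5]|[a1 a2 a3 a4 a5]] := p1 h2 h2l; last first.
  apply: a5; pose T : vec := \sum_(h <- l) h.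
  have restneg : T 0 i <= 0.
    rewrite summxE big_seq sumr_le0// => s sl.
    have [|[b1 _ _ _ _]|[_ b2 _ _ _]] := p1 s; first by rewrite inE sl orbT.
      by lia.
    exact: ltW.
  have [vi vj vk] := And3 (X0 Xv i) (X0 Xv j) (X0 Xv k).
  have := Hv i; rewrite !big_cons -/T !vecE => Hvi.
  by apply: nonneg_cover; rewrite !vecE; lia.
have posi s : s \in [:: h1, h2 & l] -> 0 < s 0 i.
  rewrite inE => /orP[/eqP ->//|sl].
  by have [[_ b2 _ _ _]|[b1 _ _ _ _]] := p1 s sl; lia.
case: l => [|h3 l] in l0 Hl Hv H1 H2 noM pair r1 h1l p1 h2l posi *.
  by apply: a5; rewrite !big_cons big_nil addr0 in Hv.
have h3l : h3 \in [:: h2, h3 & l] by rewrite !inE eqxx orbT.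
have [[b1 b2 b3 b4 _]|[b1 _ _ _ _]] := p1 h3 h3l; last by lia.
have h23 : h3 \in rem h2 [:: h1, h2, h3 & l].
  by rewrite /= eqxx; case: eqP => [_|_]; rewrite !inE eqxx ?orbT.
have h2L : h2 \in [:: h1, h2, h3 & l] by rewrite !inE eqxx orbT.
have h3L : h3 \in [:: h1, h2, h3 & l] by rewrite !inE eqxx !orbT.
have [[d1 d2 d3 d4 _]|[d1 _ _ _ _]] := pair h2 h3 h2L h23; last by lia.
(* Dropping s leaves N_0^3 at some coordinate, where s must be positive; it is not i, since the
   other terms are positive there. *)
have up s : s \in [:: h1, h2, h3 & l] -> 0 < s 0 j \/ 0 < s 0 k.
  move=> sl; have [m] := not_nonneg (H2 s sl).
  pose T : vec := \sum_(h <- rem s [:: h1, h2, h3 & l]) h; rewrite -/T => Tneg.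
  have remi : 0 <= T 0 i.
    by rewrite summxE big_seq sumr_ge0// => t /mem_rem /posi /ltW.
  have sm : 0 < s 0 m.
    by move: (Hv m) Tneg; rewrite (sum_rem sl) -/T !vecE; clear; lia.
  case: (cover m) => [mi|[<-|<-]]; [exfalso|by left|by right].
  by move: Tneg (X0 Xv i) remi; rewrite mi !vecE; clear; lia.
by have := up h1 h1l; have := up h2 h2L; have := up h3 h3L; lia.
Qed.

(** The Cramer relation between four vectors in dimension 3 has the determinant of their differences
    as coefficient sum. *)
Lemma bounded_det3 (B : int) p q r s : (forall (x : vec) m, X x -> x 0 m <= B) ->
  X p -> X q -> X r -> X s -> det3 (q - p) (r - p) (s - p) = 0.
Proof.
move=> XB Xp Xq Xr Xs.
have [X00|nX0] := pselect (X 0).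
  have Z := bounded_trivial X0 c2 XB X00.
  by rewrite (Z p)// (Z q)// (Z r)// (Z s)// /det3 /det2 !vecE; ring.
have nz x : X x -> x != 0 by move=> Xx; apply: contra_notN nX0 => /eqP <-.
have := @bounded_relation _ X X0 c2 B XB p q r s (det3 q r s) (- det3 p r s) (det3 p q s)
   (- det3 p q r) Xp Xq Xr Xs (nz _ Xp) (nz _ Xq) (nz _ Xr) (nz _ Xs).
move=> H; rewrite -[RHS]H.
  by rewrite /det3 /det2 !vecE; ring.
by apply: vecP => m; rewrite !vecE /det3 /det2; case: (cover m) => [->|[->|->]]; ring.
Qed.

(** There are finitely many columns over the (i, j) plane; with at most one point in each,
    coordinate k would be bounded. *)
Lemma vertical_diff (B : int) : unbounded k ->
  (forall x : vec, X x -> x 0 i <= B /\ x 0 j <= B) ->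
  exists2 h : vec, diffset X h & [/\ h 0 i = 0, h 0 j = 0 & 0 < h 0 k].
Proof.
move=> uk XB; apply: contrapT => H.
have uniqk x y : X x -> X y -> x 0 i = y 0 i -> x 0 j = y 0 j -> x 0 k <= y 0 k.
  move=> Xx Xy ei ej; rewrite leNgt; apply/negP => lt; apply: H.
  by exists (x - y); [exact: diffsetI|rewrite !vecE; split; lia].
have /choice[f Hf] : forall st : nat * nat, exists K : int,
    forall x : vec, X x -> x 0 i = st.1%:Z -> x 0 j = st.2%:Z -> x 0 k <= K.
  move=> st; have [[y Xy [yi yj]]|H'] :=
      pselect (exists2 y : vec, X y & y 0 i = st.1%:Z /\ y 0 j = st.2%:Z).
    by exists (y 0 k) => x Xx xi xj; apply: uniqk => //; rewrite ?xi ?xj.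
  by exists 0 => x Xx xi xj; exfalso; apply: H'; exists x.
pose M := \sum_(s < (absz B).+1) \sum_(t < (absz B).+1) `|f (nat_of_ord s, nat_of_ord t)|.
have [x Xx Mx] := uk (M + 1); have [xi xj] := XB x Xx.
have xi0 := X0 Xx i; have xj0 := X0 Xx j.
have si : (absz (x 0 i)%R < (absz B).+1)%N by lia.
have sj : (absz (x 0 j)%R < (absz B).+1)%N by lia.
have := Hf (absz (x 0 i), absz (x 0 j)) x Xx; rewrite /= !gez0_abs// => /(_ erefl erefl) xk.
have fM : `|f (absz (x 0 i), absz (x 0 j))| <= M.
  rewrite /M (bigD1 (Ordinal si))//= (bigD1 (Ordinal sj))//= -addrA lerDl.
  by rewrite addr_ge0// ?sumr_ge0// => s _; rewrite sumr_ge0.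
by have := ler_norm (f (absz (x 0 i), absz (x 0 j))); lia.
Qed.

(** The coordinate is zeroed rather than removed, so that the results on bounded sets apply without
    changing the ambient space. *)
Definition drop_k (x : vec) : vec := \row_m (if m == k then 0 else x 0 m).

Lemma drop_kB x y : drop_k (x - y) = drop_k x - drop_k y.
Proof. by apply/rowP => m; rewrite !mxE; case: eqP; rewrite ?subr0. Qed.

Lemma drop_kD x y : drop_k (x + y) = drop_k x + drop_k y.
Proof. by apply/rowP => m; rewrite !mxE; case: eqP; rewrite ?addr0. Qed.

Hypotheses (ik : i != k) (jk : j != k).

Lemma drop_kE x : [/\ drop_k x 0 i = x 0 i, drop_k x 0 j = x 0 j & drop_k x 0 k = 0].
Proof. by rewrite !mxE eqxx (negbTE ik) (negbTE jk). Qed.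

(** Adding copies of the vertical difference h raises coordinate k at will, so lifted sums only have
    to be nonnegative at i and j. *)
Lemma drop_k_closed h : diffset X h -> h 0 i = 0 -> h 0 j = 0 -> 0 < h 0 k ->
  closed_upto 2 [set drop_k x | x in X].
Proof.
move=> Dh hi hj hk.
have up (n : nat) x : X x -> X (x + n%:Z *: h).
  move=> Xx; elim: n => [|n IH]; first by rewrite scale0r addr0.
  have -> : x + n.+1%:Z *: h = x + n%:Z *: h + h.
    by have -> : n.+1%:Z = n%:Z + 1 :> int; [lia|rewrite scalerDl scale1r addrA].
  have := c2 (l := [:: h]) IH (isT : (1 <= 2)%N); rewrite big_seq1; apply.
    by move=> s; rewrite inE => /eqP ->.
  have [xi xj xk] := And3 (X0 IH i) (X0 IH j) (X0 IH k).
  by apply: nonneg_cover; rewrite vecD; lia.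
have lift (l : seq vec) : (forall s : vec, s \in l -> diffset [set drop_k x | x in X] s) ->
  exists l' : seq vec, [/\ size l' = size l, forall s, s \in l' -> diffset X s &
    drop_k (\sum_(s <- l') s) = \sum_(s <- l) s].
  elim: l => [|s l IH] H.
    exists [::]; split=> //; rewrite !big_nil; apply/rowP => m; rewrite !mxE.
    by case: eqP.
  have [_ [x Xx <-] [_ [y Xy <-] E]] : diffset [set drop_k x | x in X] s.
    by apply: H; rewrite inE eqxx.
  have [|l' [sl Hl' E']] := IH; first by move=> t tl; apply: H; rewrite inE tl orbT.
  exists ((x - y) :: l'); split; first by rewrite /= sl.
    by move=> t; rewrite inE => /orP[/eqP ->|/Hl'//]; exact: diffsetI.
  by rewrite !big_cons drop_kD E' drop_kB E.
move=> _ l [x Xx <-] ls Hl; have [l' [sl' Hl' E]] := lift l Hl.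
rewrite -E -drop_kD; set s := \sum_(t <- l') t => Hn.
pose n := absz (x 0 k + s 0 k).
exists (x + n%:Z *: h + s); last first.
  apply/rowP => m; rewrite ![drop_k _ _ _]mxE; case: (cover m) => [->|[->|->]].
  - by rewrite (negbTE ik) !mxE hi mulr0 addr0.
  - by rewrite (negbTE jk) !mxE hj mulr0 addr0.
  - by rewrite eqxx.
apply: c2; [exact: up|by rewrite sl'|exact: Hl'|].
have [Ei Ej Ek] := drop_kE (x + s); have := Hn i; have := Hn j; rewrite Ei Ej.
rewrite -/s => hj' hi'; apply: nonneg_cover.
- by move: hi'; rewrite !vecD vecZ hi mulr0 addr0.
- by move: hj'; rewrite !vecD vecZ hj mulr0 addr0.
- rewrite !vecD vecZ /n abszE addrAC -lerBlDl sub0r.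
  rewrite (le_trans (ler_norm _))// normrN ler_peMr//.
Qed.

(** The projection along k is bounded and closed, so its points are collinear and X lies in a
    vertical plane. *)
Lemma half_bounded_det3 (B : int) p q r s : unbounded k ->
  (forall x : vec, X x -> x 0 i <= B /\ x 0 j <= B) ->
  X p -> X q -> X r -> X s -> det3 (q - p) (r - p) (s - p) = 0.
Proof.
move=> uk XB Xp Xq Xr Xs.
have [h Dh [hi hj hk]] := vertical_diff uk XB.
pose Y : set vec := [set drop_k x | x in X].
have Y2 : closed_upto 2 Y := drop_k_closed Dh hi hj hk.
have Y0 x : Y x -> nonneg x.
  move=> [y Xy <-]; have [Ei Ej Ek] := drop_kE y.
  by apply: nonneg_cover; rewrite ?Ei ?Ej ?Ek//; exact: X0.
have YB x m : Y x -> x 0 m <= `|B|.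
  move=> [y Xy <-]; have [Ei Ej Ek] := drop_kE y; have [yi yj] := XB y Xy.
  case: (cover m) => [->|[->|->]]; rewrite ?Ei ?Ej ?Ek//; [lia|lia].
have ar x y z : X x -> X y -> X z -> det2 (y - x) (z - x) = 0.
  move=> Xx Xy Xz.
  have [Yx Yy Yz] : [/\ Y (drop_k x), Y (drop_k y) & Y (drop_k z)].
    by split; [exists x|exists y|exists z].
  have [xi xj xk] := drop_kE x; have [yi yj yk] := drop_kE y; have [zi zj zk] := drop_kE z.
  have [Y00|nY0] := pselect (Y 0).
    have Z := bounded_trivial Y0 Y2 YB Y00.
    rewrite /det2 !vecE -xi -xj -yi -yj -zi -zj (Z _ Yx) (Z _ Yy) (Z _ Yz) !vec0; ring.
  have nz t : Y t -> t != 0 by move=> Yt; apply: contra_notN nY0 => /eqP <-.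
  (* A three-term relation, with x repeated under the coefficient 0. *)
  have := @bounded_relation _ Y Y0 Y2 `|B| YB (drop_k x) (drop_k y) (drop_k z) (drop_k x)
    (det2 y z) (- det2 x z) (det2 x y) 0 Yx Yy Yz Yx (nz _ Yx) (nz _ Yy) (nz _ Yz) (nz _ Yx).
  move=> H; rewrite -[RHS]H; first by rewrite /det2 !vecE; ring.
  apply: vecP => m; rewrite !vecE /det2.
  by case: (cover m) => [->|[->|->]]; rewrite ?xi ?xj ?xk ?yi ?yj ?yk ?zi ?zj ?zk; ring.
by rewrite /det3 (ar p q r)// (ar p q s)// (ar p r s)//; ring.
Qed.

End Space.

Lemma space_closed (X : set 'rV[int]_3) (p q r s : 'rV[int]_3) (i j k : 'I_3) :
  i != j -> i != k -> j != k ->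
  (forall x : 'rV[int]_3, X x -> nonneg x) -> closed_upto 2 X ->
  X p -> X q -> X r -> X s -> det3 i j k (q - p) (r - p) (s - p) != 0 ->
  forall n, closed_upto n X.
Proof.
move=> ij ik jk X0 c2 Xp Xq Xr Xs vol0.
have cov (m : 'I_3) : m = i \/ m = j \/ m = k.
  have : [|| nat_of_ord m == i, nat_of_ord m == j | nat_of_ord m == k].
    have := ltn_ord m; have := ltn_ord i; have := ltn_ord j; have := ltn_ord k.
    by move: ij ik jk; rewrite -!val_eqE /=; lia.
  by case/or3P => /eqP/val_inj; tauto.
have bd m : unbounded X m \/ exists B : int, forall x : 'rV[int]_3, X x -> x 0 m <= B.
  have [u|/existsNP[B HB]] := pselect (unbounded X m); [by left|right].
  by exists B => x Xx; rewrite leNgt; apply/negP => lt; apply: HB; exists x => //; exact: ltW.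
have dperm1 u v w : det3 i k j u v w = - det3 i j k u v w by rewrite /det3 /det2; ring.
have dperm2 u v w : det3 j k i u v w = det3 i j k u v w by rewrite /det3 /det2; ring.
(* Two unbounded coordinates allow merging; with at most one the set is flat, against [vol0]. *)
have [ui|[Bi HBi]] := bd i; have [uj|[Bj HBj]] := bd j; have [uk|[Bk HBk]] := bd k.
- exact: (space_merge X0 c2 cov uj uk).
- apply: (@space_merge X X0 c2 k i j) => // m; case: (cov m) => [->|[->|->]]; tauto.
- apply: (@space_merge X X0 c2 j i k) => // m; case: (cov m) => [->|[->|->]]; tauto.
- exfalso; move/eqP: vol0; apply; rewrite -dperm2.
  apply: (@half_bounded_det3 X X0 c2 j k i _ _ _ (`|Bj| + `|Bk|)) => //.
  + by move=> m; case: (cov m) => [->|[->|->]]; tauto.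
  + by rewrite eq_sym.
  + by rewrite eq_sym.
  + by move=> x Xx; have := HBj x Xx; have := HBk x Xx; lia.
- exact: (space_merge X0 c2 cov uj uk).
- exfalso; move/eqP: vol0; apply; apply/eqP; rewrite -oppr_eq0 -dperm1; apply/eqP.
  apply: (@half_bounded_det3 X X0 c2 i k j _ _ _ (`|Bi| + `|Bk|)) => //.
  + by move=> m; case: (cov m) => [->|[->|->]]; tauto.
  + by rewrite eq_sym.
  + by move=> x Xx; have := HBi x Xx; have := HBk x Xx; lia.
- exfalso; move/eqP: vol0; apply.
  apply: (@half_bounded_det3 X X0 c2 i j k _ _ _ (`|Bi| + `|Bj|)) => //.
  by move=> x Xx; have := HBi x Xx; have := HBj x Xx; lia.
- exfalso; move/eqP: vol0; apply.
  apply: (@bounded_det3 X X0 c2 i j k _ (`|Bi| + `|Bj| + `|Bk|)) => // x m Xx.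
  by have := HBi x Xx; have := HBj x Xx; have := HBk x Xx; case: (cov m) => [->|[->|->]]; lia.
Qed.

(** * From the dimension over the reals to integer points *)

Section Frames.
Variable R : realType.

Lemma affine_frame d (G : set (mindex d)) k : has_dimension R G k ->
  exists a0 (s : seq (mindex d)), [/\ G a0, forall a, a \in s -> G a, size s = k,
    free [seq rvec R a - rvec R a0 | a <- s] &
    forall a, G a -> rvec R a - rvec R a0 \in <<[seq rvec R a - rvec R a0 | a <- s]>>%VS].
Proof.
move=> [[a0 Ga0] [V [[V1 V2] dimV]]]; exists a0.
pose D (s : seq (mindex d)) := [seq rvec R a - rvec R a0 | a <- s].
have sub (s : seq (mindex d)) : (forall a, a \in s -> G a) -> (<<D s>> <= V)%VS.
  by move=> Gs; apply/span_subvP => _ /mapP[a /Gs Ga ->]; exact: V1.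
have [s [Gs sk fs]] : exists s : seq (mindex d),
    [/\ forall a, a \in s -> G a, size s = k & free (D s)].
  suff: forall m, (m <= k)%N -> exists s : seq (mindex d),
      [/\ forall a, a \in s -> G a, size s = m & free (D s)] by move=> /(_ k (leqnn _)).
  elim=> [_|m IH mk]; first by exists [::]; split=> //; exact: nil_free.
  have [s [Gs sm fs]] := IH (ltnW mk).
  have [[a Ga Ha]|H] := pselect (exists2 a, G a & rvec R a - rvec R a0 \notin <<D s>>%VS).
    exists (a :: s); split; last by rewrite /D /= free_cons Ha.
      by move=> b; rewrite inE => /orP[/eqP ->//|]; exact: Gs.
    by rewrite /= sm.
  have dimD : \dim <<D s>>%VS = m by have /eqP := fs; rewrite size_map sm.
  (* No point leaves the span of the chosen differences, so minimality of V bounds its dimension by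
     m < k. *)
  suff /V2/dimvS : forall a b, G a -> G b -> rvec R a - rvec R b \in <<D s>>%VS.
    by rewrite dimD dimV leqNgt mk.
  have in0 a : G a -> rvec R a - rvec R a0 \in <<D s>>%VS.
    by move=> Ga; apply: contrapT => Ha; apply: H; exists a => //; apply/negP.
  move=> a b Ga Gb; have -> : rvec R a - rvec R b =
      (rvec R a - rvec R a0) - (rvec R b - rvec R a0) by rewrite opprB addrA subrK.
  by rewrite rpredB ?in0.
exists s; split=> // a Ga; suff -> : <<[seq rvec R a - rvec R a0 | a <- s]>>%VS = V by exact: V1.
apply/eqP; rewrite eqEdim sub//= dimV; have /eqP := fs.
by rewrite size_map sk => ->.
Qed.

Lemma rvecE d (a : mindex d) i : rvec R a 0 i = (ivec a 0 i)%:~R.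
Proof. by rewrite !mxE. Qed.

Lemma minor_neq0 d (u v : 'rV[R]_d) : free [:: u; v] ->
  exists i j, u 0 i * v 0 j - u 0 j * v 0 i != 0.
Proof.
rewrite free_cons span_seq1 seq1_free => /andP[uv v0].
have [i vi] : exists i, v 0 i != 0.
  apply: contrapT => H; move/eqP: v0; apply; apply/rowP => i; rewrite mxE.
  by apply/eqP; apply: contrapT => vi; apply: H; exists i; apply/negP.
exists i; apply: contrapT => H; move/negP: uv; apply; apply/vlineP.
exists (u 0 i / v 0 i); apply/rowP => j; rewrite !mxE.
have E : u 0 i * v 0 j = u 0 j * v 0 i.
  apply/eqP; rewrite -subr_eq0; apply: contrapT => uv; apply: H; exists j; exact/negP.
by rewrite mulrAC E mulfK.
Qed.

Lemma det3_neq0 (u v w : 'rV[R]_3) : free [:: u; v; w] ->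
  exists i j k : 'I_3, [/\ i != j, i != k, j != k &
    w 0 k * (u 0 i * v 0 j - u 0 j * v 0 i) - v 0 k * (u 0 i * w 0 j - u 0 j * w 0 i) +
    u 0 k * (v 0 i * w 0 j - v 0 j * w 0 i) != 0].
Proof.
rewrite free_cons => /andP[uvw /minor_neq0[i [j]]].
set D := _ - _ => D0.
have ij : i != j by apply: contraNN D0 => /eqP ij; rewrite /D ij mulrC subrr.
have [k ik jk] : exists2 k : 'I_3, i != k & j != k.
  have [k] : exists k, k \notin [set i; j]%SET.
    apply: contrapT => H; have : (#|[set: 'I_3]%SET| <= #|[set i; j]%SET|)%N.
      by apply/subset_leq_card/fintype.subsetP => m _; apply/negPn/negP => Hm; apply: H; exists m.
    by rewrite cardsT card_ord cards2; case: (i != j).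
  by rewrite !inE negb_or eq_sym (eq_sym k) => /andP[]; exists k.
exists i, j, k; split=> //; apply: contraNN uvw => /eqP E.
rewrite span_cons span_seq1; apply/memv_addP.
set a := (u 0 i * w 0 j - u 0 j * w 0 i) / D.
set b := - (u 0 i * v 0 j - u 0 j * v 0 i) / D.
exists (a *: v); first exact: memvZ (memv_line _).
exists (b *: w); first exact: memvZ (memv_line _).
have cov (m : 'I_3) : m = i \/ m = j \/ m = k.
  have : [|| nat_of_ord m == i, nat_of_ord m == j | nat_of_ord m == k].
    have := ltn_ord m; have := ltn_ord i; have := ltn_ord j; have := ltn_ord k.
    by move: ij ik jk; rewrite -!val_eqE /=; lia.
  by case/or3P => /eqP/val_inj; tauto.
apply/rowP => m; rewrite !mxE; apply: (mulIf D0).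
rewrite mulrDl (mulrAC a) (mulrAC b) /a /b !divfK//.
case: (cov m) => [->|[->|->]]; [rewrite /D; ring|rewrite /D; ring|].
apply/eqP; rewrite -subr_eq0 -[X in _ == X]E /D; apply/eqP; ring.
Qed.

Lemma coset_dim1 d (G : set (mindex d)) : has_dimension R G 1 ->
  closed_upto 1 [set ivec a | a in G] -> coset_restriction G.
Proof.
move=> /affine_frame[a0 [s [Ga0 Gs s1 fs sp]]] c1.
case: s => [//|a1 [|//]] /= in Gs s1 fs sp.
have u0 : rvec R a1 - rvec R a0 != 0 by move: fs; rewrite seq1_free.
have {}sp a : G a -> exists c, rvec R a - rvec R a0 = c *: (rvec R a1 - rvec R a0).
  by move=> /sp; rewrite span_seq1 => /vlineP.
have dp h : diffset [set ivec a | a in G] h ->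
    exists c : R, forall i, (h 0 i)%:~R = c * (rvec R a1 - rvec R a0) 0 i.
  move=> [_ [a /sp[x Ea] <-] [_ [b /sp[y Eb] <-] <-]]; exists (x - y) => i.
  have := congr1 (fun v : 'rV[R]_d => v 0 i) Ea.
  have := congr1 (fun v : 'rV[R]_d => v 0 i) Eb.
  rewrite !mxE /= intrB !pmulrn -?pmulrn => eb ea.
  by rewrite mulrBl -ea -eb; ring.
have [j uj] : exists j, (rvec R a1 - rvec R a0) 0 j != 0.
  apply: contrapT => H; move/eqP: u0; apply; apply/rowP => i; rewrite [RHS]mxE.
  by apply/eqP; apply: contrapT => vi; apply: H; exists i; apply/negP.
apply: closed_coset; first by exists a0.
apply: (@parallel_merge _ _ j) => //.
- by move=> _ [a _ <-]; exact: nonneg_ivec.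
- move=> h k /dp[x Ex] /dp[y Ey] i; apply: (@intr_inj R).
  by rewrite !intrM !Ex !Ey; ring.
- move=> h /dp[x Ex] hj; have := Ex j; rewrite hj => /esym/eqP.
  rewrite mulf_eq0 (negbTE uj) orbF => /eqP x0; apply/vecP => i; rewrite vec0.
  by apply: (@intr_inj R); rewrite Ex x0 mul0r.
Qed.

Lemma coset_dim2 d (G : set (mindex d)) : has_dimension R G 2 ->
  closed_upto 2 [set ivec a | a in G] -> coset_restriction G.
Proof.
move=> /affine_frame[a0 [s [Ga0 Gs s2 fs sp]]] c2.
case: s => [//|a1 [//|a2 [|//]]] /= in Gs s2 fs sp.
have [i [j ij0]] := minor_neq0 fs.
set u := rvec R a1 - rvec R a0 in fs sp ij0; set v := rvec R a2 - rvec R a0 in fs sp ij0.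
have co x : [set ivec a | a in G] x ->
    exists al be : R, forall m, (x 0 m)%:~R = rvec R a0 0 m + al * u 0 m + be * v 0 m.
  move=> [a /sp]; rewrite span_cons span_seq1.
  move=> /memv_addP[_ /vlineP[al ->] [_ /vlineP[be ->] E]] <-.
  exists al, be => m; have := congr1 (fun v : 'rV[R]_d => v 0 m) E.
  rewrite [LHS]mxE [RHS]mxE ![(_ *: _ : 'rV_d) _ _]mxE [(- _ : 'rV_d) _ _]mxE -rvecE => H.
  by rewrite -addrA -H addrCA subrr addr0.
apply: closed_coset; first by exists a0.
apply: (@plane_closed _ _ i j) => //.
- by move=> _ [a _ <-]; exact: nonneg_ivec.
- move=> a b c x /co[a1' [a2' Ea]] /co[b1 [b2 Eb]] /co[c1 [c2' Ec]] /co[x1 [x2 Ex]].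
  apply: vecP => m; apply: (@intr_inj R); rewrite /comb /area !vecE.
  rewrite !(intrD, intrM, intrN, intrB) !Ea !Eb !Ec !Ex; ring.
- exists (ivec a0), (ivec a1), (ivec a2); split.
  + by exists a0.
  + by exists a1 => //; apply: Gs; rewrite !inE eqxx.
  + by exists a2 => //; apply: Gs; rewrite !inE eqxx orbT.
  + apply: contraNN ij0 => /eqP E; have := congr1 (fun m : int => m%:~R : R) E.
    rewrite /area !(intrD, intrM, intrN, intrB) -!rvecE => E'.
    by rewrite /u /v ![(_ + _ : 'rV_d) _ _]mxE ![(- _ : 'rV_d) _ _]mxE E'.
Qed.

Lemma coset_dim3 (G : set (mindex 3)) : has_dimension R G 3 ->
  closed_upto 2 [set ivec a | a in G] -> coset_restriction G.
Proof.
move=> /affine_frame[a0 [s [Ga0 Gs s3 fs _]]] c2.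
case: s => [//|a1 [//|a2 [//|a3 [|//]]]] /= in Gs s3 fs.
have [i [j [k [ij ik jk D0]]]] := det3_neq0 fs.
apply: closed_coset; first by exists a0.
apply: (@space_closed _ (ivec a0) (ivec a1) (ivec a2) (ivec a3) i j k) => //.
- by move=> _ [a _ <-]; exact: nonneg_ivec.
- by exists a0.
- by exists a1 => //; apply: Gs; rewrite !inE eqxx.
- by exists a2 => //; apply: Gs; rewrite !inE eqxx orbT.
- by exists a3 => //; apply: Gs; rewrite !inE eqxx !orbT.
apply: contraNN D0 => /eqP E; have := congr1 (fun m : int => m%:~R : R) E.
rewrite /det3 /det2 !vecE !(intrD, intrM, intrN, intrB) -!rvecE => E'.
by rewrite ![(_ + _ : 'rV_3) _ _]mxE ![(- _ : 'rV_3) _ _]mxE E'.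
Qed.

End Frames.

(** * Closed sets that are not coset restrictions *)

Section Cylinders.
Variables (R : realType) (d : nat).
Implicit Types (T : seq (seq nat)) (lo hi n : nat) (j : 'I_d).

Definition entry T i (j : nat) := nth 0%N (nth [::] T i) j.

Definition point T i : mindex d := [ffun j : 'I_d => entry T i j].

(* A row of T lists the first coordinates of a point, the other ones being 0; the
   coordinates in [lo, hi) are then released. *)
Definition cyl T lo hi : set (mindex d) :=
  [set a | exists2 i, (i < size T)%N & forall j, ~~ (lo <= j < hi)%N -> a j = entry T i j].

Lemma cyl_point T lo hi i : (i < size T)%N -> cyl T lo hi (point T i).
Proof. by move=> iT; exists i => // j _; rewrite ffunE. Qed.

(** The obstruction used by all counterexamples: one missing integer affine combination of points of
    G. *)
Lemma coset_affine (G : set (mindex d)) r (g : 'I_r -> mindex d) (m : 'I_r -> int) q :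
  coset_restriction G -> (forall i, G (g i)) -> \sum_i m i = 1 ->
  ivec q = \sum_i m i *: ivec (g i) -> G q.
Proof.
move=> [H [v [H0 [HB HG]]]] Gg m1 E; apply/HG.
have HN x : H x -> H (- x) by move=> Hx; rewrite -sub0r; exact: HB.
have HD x y : H x -> H y -> H (x + y) by move=> Hx /HN Hy; rewrite -[y]opprK; exact: HB.
have HZ (c : int) x : H x -> H (c *: x).
  move=> Hx; have Hn (k : nat) : H (k%:Z *: x).
    elim: k => [|k IH]; first by rewrite scale0r.
    by rewrite intS scalerDl scale1r; exact: HD.
  by case: c => k; [exact: Hn|rewrite NegzE scaleNr; apply: HN; exact: Hn].
have -> : ivec q - v = \sum_i m i *: (ivec (g i) - v).
  rewrite E -[in LHS](scale1r v) -m1 scaler_suml -sumrB.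
  by apply: eq_bigr => i _; rewrite scalerBr.
by elim/big_ind: _ => // i _; apply: HZ; exact/HG.
Qed.

(** A row has coefficients 0 and 1, and each difference moves a coefficient by at most 1. These
    bounds are how the level n enters the counterexamples. *)
Lemma cyl_ext T lo hi n v : ext (cyl T lo hi) n v -> exists m : nat -> int,
  [/\ \sum_(i < size T) m i = 1, forall i, - n%:Z <= m i <= n.+1%:Z &
   forall j, ~~ (lo <= j < hi)%N -> v 0 j = \sum_(i < size T) m i * (entry T i j)%:Z].
Proof.
pose dl (i : nat) (l : nat) : int := (l == i)%:R.
have dl1 i (iT : (i < size T)%N) (F : nat -> int) : \sum_(l < size T) dl i l * F l = F i.
  rewrite (bigD1 (Ordinal iT))//= /dl eqxx mul1r big1 ?addr0// => l.
  by rewrite -val_eqE /= => /negbTE ->; rewrite mul0r.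
have dls i (iT : (i < size T)%N) : \sum_(l < size T) dl i l = 1.
  by rewrite -[RHS](dl1 i iT (fun=> 1)); apply: eq_bigr => l _; rewrite mulr1.
elim: n v => [|n IH] v /=.
  move=> [a [i iT ai] <-]; exists (dl i); split; first exact: dls.
    by move=> l; rewrite /dl; case: (l == i).
  by move=> j /ai aj; rewrite (dl1 _ iT (fun l => (entry T l j)%:Z)) mxE aj.
move=> [x /IH[m [m1 mn mx]] [_ [_ [a [i iT ai] <-] [_ [b [l lT bl] <-] <-]] <-]].
exists (fun t => m t + dl i t - dl l t); split.
- by rewrite sumrB big_split /= m1 !dls// addrK.
- move=> t; have := mn t; rewrite /dl; case: (t == i); case: (t == l); lia.
- move=> j jU; under eq_bigr do rewrite mulrBl mulrDl.
  rewrite sumrB big_split /= (dl1 _ iT (fun t => (entry T t j)%:Z)).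
  rewrite (dl1 _ lT (fun t => (entry T t j)%:Z)) -mx//.
  by rewrite !vecE [ivec a _ _]mxE [ivec b _ _]mxE ai// bl// addrA.
Qed.

Lemma cyl_ext_closed T lo hi n : (lo <= d)%N ->
  (forall m : nat -> int, \sum_(i < size T) m i = 1 -> (forall i, - n%:Z <= m i <= n.+1%:Z) ->
     (forall j : nat, (j < lo)%N -> 0 <= \sum_(i < size T) m i * (entry T i j)%:Z) ->
     exists2 i, (i < size T)%N & forall l, (l < size T)%N -> m l = (l == i)%:R) ->
  ext_closed n (cyl T lo hi).
Proof.
move=> lod H a /cyl_ext[m [m1 mn ma]]; have [j jlo|i iT mi] := H m m1 mn.
  rewrite -(ma (Ordinal (leq_trans jlo lod))); first by rewrite mxE.
  by rewrite negb_and -ltnNge jlo.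
exists i => // j /ma; rewrite mxE => E; suff: (a j)%:Z = (entry T i j)%:Z by case.
rewrite E (bigD1 (Ordinal iT))//= mi// eqxx mul1r big1 ?addr0// => l.
by rewrite -val_eqE /= mi// => /negbTE ->; rewrite mul0r.
Qed.

Lemma free_pivot (v : 'rV[R]_d) (s : seq 'rV[R]_d) j : v 0 j != 0 ->
  (forall w, w \in s -> w 0 j = 0) -> free s -> free (v :: s).
Proof.
move=> vj sj fs; rewrite free_cons fs andbT; apply: contraNN vj => vs.
rewrite (@coord_span _ _ _ (in_tuple s) v vs) summxE big1// => i _; rewrite mxE.
by rewrite (sj _ (mem_nth 0 (ltn_ord i))) mulr0.
Qed.

(** The direction has as basis the unit vectors of the released coordinates and the differences of
    the rows with [r0]. The rows vanish from [lo] on, so [free_pivot] adds the unit vectors one by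
    one; the last hypothesis is independence of the row differences. *)
Lemma has_dimension_cyl r0 T lo hi k : (forall i (j : nat), (lo <= j)%N -> entry (r0 :: T) i j = 0%N) ->
  (lo <= hi <= d)%N -> k = (size T + (hi - lo))%N ->
  (forall c : nat -> R, (forall j : nat, (j < lo)%N ->
      \sum_(i < size T) c i * ((entry T i j)%:R - (nth 0%N r0 j)%:R) = 0) ->
    forall i, (i < size T)%N -> c i = 0) ->
  has_dimension R (cyl (r0 :: T) lo hi) k.
Proof.
move=> Tlo /andP[lohi hid] -> Tfree; set G := cyl _ _ _.
pose a0 := point (r0 :: T) 0.
have Ga0 : G a0 by exact: cyl_point.
pose D := [seq rvec R (point (r0 :: T) i.+1) - rvec R a0 | i <- iota 0 (size T)].
pose U : seq 'I_d := [seq j : 'I_d <- enum 'I_d | (lo <= j < hi)%N].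
pose B : seq 'rV[R]_d := [seq delta_mx 0 j | j <- U] ++ D.
have DE (i : nat) j : (i < size T)%N -> D`_i 0 j = (entry T i j)%:R - (nth 0%N r0 j)%:R.
  by move=> iT; rewrite (nth_map 0%N) ?size_iota// nth_iota// !mxE !ffunE.
have Dlo w j : w \in D -> (lo <= j)%N -> w 0 j = 0.
  move=> wD jlo; rewrite -(nth_index 0 wD) DE; last first.
    by rewrite -[size T](size_iota 0)
      -(size_map (fun i => rvec R (point (r0 :: T) i.+1) - rvec R a0)) index_mem.
  have -> : entry T (index w D) j = 0%N by exact: (Tlo (index w D).+1 j jlo).
  by have := Tlo 0%N j jlo; rewrite /entry /= => ->; rewrite subrr.
have fD : free D.
  have sD : size D = size T by rewrite size_map size_iota.
  apply/(@freeP _ _ _ (in_tuple D)) => c Hc i.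
  pose c' (l : nat) : R := if insub l is Some i then c i else 0.
  have c'E (l : 'I_(size D)) : c' l = c l by rewrite /c' valK.
  rewrite -c'E; apply: Tfree; last by rewrite -sD.
  move=> j jlo; have jd : (j < d)%N by rewrite (leq_trans jlo)// (leq_trans lohi).
  have := congr1 (fun v : 'rV[R]_d => v 0 (Ordinal jd)) Hc.
  rewrite summxE [RHS]mxE -[RHS](mulr0 0) => E; rewrite -[RHS](mulr0 0) -{}E -sD.
  by apply: eq_bigr => l _; rewrite mxE c'E /= DE// -sD.
have sU : size U = (hi - lo)%N.
  rewrite size_filter -[LHS](count_map val (fun j : nat => (lo <= j < hi)%N)) val_enum_ord.
  have -> : iota 0 d = iota 0 (lo + (hi - lo) + (d - hi)) by rewrite subnKC// subnKC.
  rewrite !iotaD !count_cat !add0n subnKC//.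
  rewrite (@eq_in_count _ _ pred0) ?count_pred0; last first.
    by move=> j; rewrite mem_iota /=; lia.
  rewrite (@eq_in_count _ _ predT) ?count_predT ?size_iota; last first.
    by move=> j; rewrite mem_iota /=; lia.
  rewrite (@eq_in_count _ _ pred0) ?count_pred0 ?addn0// => j.
  by rewrite mem_iota /=; lia.
have fB : free B.
  suff gen (s : seq 'I_d) : {subset s <= U} -> uniq s ->
      free ([seq delta_mx 0 j | j <- s] ++ D) by rewrite gen// filter_uniq ?enum_uniq.
  elim: s => [//|j s IH] sub /= /andP[js us].
  apply: (@free_pivot _ _ j); first by rewrite mxE !eqxx oner_neq0.
    move=> w; rewrite mem_cat => /orP[/mapP[l ls ->]|wD].
      rewrite mxE eqxx /=; case: eqP => // jl; by rewrite jl ls in js.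
    apply: Dlo => //; have := sub j; rewrite inE eqxx => /(_ isT).
    by rewrite mem_filter => /andP[/andP[]].
  by apply: IH => // l ls; apply: sub; rewrite inE ls orbT.
split; first by exists a0.
exists <<B>>%VS; split; last first.
  by have /eqP -> := fB; rewrite size_cat !size_map size_iota sU addnC.
have in0 a : G a -> rvec R a - rvec R a0 \in <<B>>%VS.
  move=> [i iT ai].
  have -> : rvec R a - rvec R a0 = rvec R (point (r0 :: T) i) - rvec R a0 +
      \sum_(j <- U) (a j)%:R *: delta_mx 0 j.
    apply/rowP => l; rewrite addrAC; rewrite [LHS]mxE [RHS]mxE; congr (_ + _).
    rewrite [RHS]mxE summxE !mxE ffunE big_filter big_enum_cond /=.
    have [lU|lU] := boolP (lo <= l < hi)%N.
      rewrite (bigD1 l)//= big1 ?addr0 ?mxE ?eqxx ?mulr1.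
        by rewrite (Tlo i l) ?add0r//; case/andP: lU.
      by move=> j /andP[_ /negbTE jl]; rewrite !mxE eq_sym jl mulr0.
    rewrite big1 ?addr0 ?ai// => j jU; rewrite !mxE eqxx /=.
    by case: eqP => [lj|_]; rewrite ?mulr0//; rewrite lj jU in lU.
  rewrite rpredD//; last first.
    rewrite big_seq rpred_sum// => j jU; rewrite rpredZ// memv_span// mem_cat.
    by rewrite (map_f (fun j => delta_mx 0 j : 'rV[R]_d)).
  case: i iT {ai} => [|i] iT; first by rewrite subrr mem0v.
  rewrite memv_span// mem_cat; apply/orP; right.
  by apply/mapP; exists i => //; rewrite mem_iota.
split.
  move=> a b Ga Gb; have -> : rvec R a - rvec R b =
      (rvec R a - rvec R a0) - (rvec R b - rvec R a0) by rewrite opprB addrA subrK.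
  by rewrite rpredB ?in0.
move=> W HW; apply/span_subvP => w; rewrite mem_cat => /orP[/mapP[j jU ->]|/mapP[i iT ->]].
  pose b : mindex d := [ffun l => (a0 l + (l == j))%N].
  have Gb : G b.
    exists 0%N => // l lU; rewrite !ffunE /=.
    case: eqP => [lj|_]; last by rewrite addn0.
    by move: jU lU; rewrite mem_filter lj => /andP[->].
  have := HW _ _ Gb Ga0; congr (_ \in W); apply/rowP => l; rewrite !mxE ffunE.
  by rewrite natrD addrAC subrr add0r eq_sym.
apply: HW => //; apply: cyl_point; by rewrite mem_iota in iT.
Qed.

End Cylinders.

Lemma cyl_not_coset d (T : seq (seq nat)) lo hi (m : nat -> int) (q : nat -> nat) : (lo <= d)%N ->
  \sum_(i < size T) m i = 1 ->
  (forall j, (q j)%:Z = \sum_(i < size T) m i * (entry T i j)%:Z) ->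
  (forall i, (i < size T)%N -> exists2 j, (j < lo)%N & q j != entry T i j) ->
  ~ coset_restriction (cyl (d := d) T lo hi).
Proof.
move=> lod m1 qE qT cG.
have [i iT ai] : cyl T lo hi [ffun j : 'I_d => q j].
  apply: (@coset_affine _ _ _ (fun i : 'I_(size T) => point d T i) (fun i => m i)) => //.
    by move=> i; exact: cyl_point.
  apply: vecP => j; rewrite mxE ffunE qE summxE.
  by apply: eq_bigr => i _; rewrite !mxE ffunE.
have [j jlo] := qT i iT; have jd := leq_trans jlo lod.
have := ai (Ordinal jd); rewrite ffunE /= negb_and -ltnNge jlo => /(_ isT) ->.
by rewrite eqxx.
Qed.

(** The first coordinate is restricted to 0 and 1, so the value 2 = 2 * 1 - 0 is missing. *)
Lemma counterexample2 (R : realType) d k : (1 <= k <= d)%N ->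
  exists2 G : set (mindex d), has_dimension R G k & ~ coset_restriction G.
Proof.
move=> /andP[k1 kd]; exists (cyl [:: [:: 0]; [:: 1]]%N 1 k).
  apply: has_dimension_cyl; rewrite ?k1 ?kd//= ?subnKC//.
    by move=> [|[|i]] [|[|j]] //; rewrite /entry /= ?nth_nil.
  move=> c /(_ 0%N isT); rewrite !big_ord_recr big_ord0 /entry /= => H [|i] // _.
  by move: H; lra.
apply: (@cyl_not_coset _ _ _ _ (fun i => if i == 0%N then -1 else 2)
  (fun j => nth 0 [:: 2] j)%N); rewrite ?(leq_trans k1)//=.
- by rewrite !big_ord_recr big_ord0.
- by move=> [|[|j]]; rewrite !big_ord_recr big_ord0 /entry /= ?nth_nil.
- by move=> [|[|i]] // _; exists 0%N.
Qed.

(* The missing point (0,0,3) = 3 (1,1,1) - (3,0,0) - (0,3,0) needs two differences. *)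
Lemma counterexample4 (R : realType) d k : (3 <= d)%N -> k = 2%N \/ k = 3%N ->
  exists G : set (mindex d), [/\ has_dimension R G k, ext_closed 1 G & ~ coset_restriction G].
Proof.
move=> d3; pose A := [:: 3]%N; pose S := [:: [:: 1; 1; 1]; [:: 0; 3; 0]]%N.
pose q j := nth 0%N [:: 0; 0; 3]%N j.
case=> ->.
  exists (cyl (A :: S) 3 3); split.
  - apply: has_dimension_cyl => //.
      by move=> [|[|[|i]]] [|[|[|j]]] // _; rewrite /entry /= ?nth_nil.
    move=> c Hc; have := Hc 0%N isT; have := Hc 1%N isT.
    rewrite !big_ord_recr !big_ord0 /entry /= => H1 H0 [|[|i]] // _; move: H1 H0; lra.
  - apply: cyl_ext_closed => // m; rewrite !big_ord_recr big_ord0 /= => m1 mb Hm.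
    have := Hm 0%N isT; have := Hm 1%N isT; have := Hm 2%N isT.
    rewrite !big_ord_recr !big_ord0 /entry /= => H2 H1 H0.
    have [[E0 [E1 E2]]|[[E0 [E1 E2]]|[E0 [E1 E2]]]] :
       m 0%N = 1 /\ m 1%N = 0 /\ m 2%N = 0 \/ m 0%N = 0 /\ m 1%N = 1 /\ m 2%N = 0 \/
       m 0%N = 0 /\ m 1%N = 0 /\ m 2%N = 1.
      have := mb 0%N; have := mb 1%N; have := mb 2%N; lia.
    + by exists 0%N => // [] [|[|[|l]]].
    + by exists 1%N => // [] [|[|[|l]]].
    + by exists 2%N => // [] [|[|[|l]]].
  - apply: (@cyl_not_coset _ _ _ _ (fun i => nth 0 [:: -1; 3; -1] i) q) => //=.
    + by rewrite !big_ord_recr big_ord0.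
    + by move=> [|[|[|j]]]; rewrite !big_ord_recr big_ord0 /entry /q /= ?nth_nil.
    + by move=> [|[|[|i]]] // _; [exists 0%N|exists 0%N|exists 1%N].
(* The row (0,0,6) raises the dimension to 3 on the axis of the missing point (0,0,3). *)
exists (cyl (A :: rcons S [:: 0; 0; 6]%N) 3 3); split.
- apply: has_dimension_cyl => //.
    by move=> [|[|[|[|i]]]] [|[|[|j]]] // _; rewrite /entry /= ?nth_nil.
  move=> c Hc; have := Hc 0%N isT; have := Hc 1%N isT; have := Hc 2%N isT.
  rewrite !big_ord_recr !big_ord0 /entry /= => H2 H1 H0 [|[|[|i]]] // _; move: H2 H1 H0; lra.
- apply: cyl_ext_closed => // m; rewrite !big_ord_recr big_ord0 /= => m1 mb Hm.
  have := Hm 0%N isT; have := Hm 1%N isT; have := Hm 2%N isT.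
  rewrite !big_ord_recr !big_ord0 /entry /= => H2 H1 H0.
  have [[E0 [E1 [E2 E3]]]|[[E0 [E1 [E2 E3]]]|[[E0 [E1 [E2 E3]]]|[E0 [E1 [E2 E3]]]]]] :
     m 0%N = 1 /\ m 1%N = 0 /\ m 2%N = 0 /\ m 3%N = 0 \/
     m 0%N = 0 /\ m 1%N = 1 /\ m 2%N = 0 /\ m 3%N = 0 \/
     m 0%N = 0 /\ m 1%N = 0 /\ m 2%N = 1 /\ m 3%N = 0 \/
     m 0%N = 0 /\ m 1%N = 0 /\ m 2%N = 0 /\ m 3%N = 1.
    have := mb 0%N; have := mb 1%N; have := mb 2%N; have := mb 3%N; lia.
  + by exists 0%N => // [] [|[|[|[|l]]]].
  + by exists 1%N => // [] [|[|[|[|l]]]].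
  + by exists 2%N => // [] [|[|[|[|l]]]].
  + by exists 3%N => // [] [|[|[|[|l]]]].
- apply: (@cyl_not_coset _ _ _ _ (fun i => nth 0 [:: -1; 3; -1] i) q) => //=.
  + by rewrite !big_ord_recr big_ord0.
  + by move=> [|[|[|j]]]; rewrite !big_ord_recr big_ord0 /entry /q /= ?nth_nil.
  + by move=> [|[|[|[|i]]]] // _; [exists 0%N|exists 0%N|exists 1%N|exists 2%N].
Qed.

(** The four inequalities are the coordinates of a combination of the rows in [counterexample_even].
    As the coefficients are smaller than n + 3 in size, they force a, b, w and c + e to be
    nonnegative, and the sum 1 leaves only unit vectors. *)
Lemma unit_coefs (n : nat) (a b c e w : int) :
  (forall l, - n%:Z <= nth 0 [:: a; b; c; e; w] l <= n.+1%:Z) ->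
  a + b + c + e + w = 1 -> 0 <= c * n.+3%:Z + e * n.+2%:Z -> 0 <= b * n.+3%:Z + e ->
  0 <= b + c + w * (2 * n.+3)%:Z -> 0 <= a * n.+3%:Z + e ->
  exists2 i, (i < 5)%N & forall l, (l < 5)%N -> nth 0 [:: a; b; c; e; w] l = (l == i)%:R.
Proof.
move=> bd s1 r0 r1 r2 r3.
have [ba bb bc] := And3 (bd 0%N) (bd 1%N) (bd 2%N); have {bd} [be bw] := conj (bd 3%N) (bd 4%N).
rewrite /= in ba bb bc be bw.
have low (x y : int) : y < n.+3%:Z -> 0 <= x * n.+3%:Z + y -> 0 <= x.
  move=> ys h; rewrite leNgt; apply/negP => x0.
  have : x * n.+3%:Z <= -1 * n.+3%:Z by rewrite ler_pM2r//; lia.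
  by lia.
have w0 : 0 <= w by rewrite leNgt; apply/negP => w0; nia.
have a0 : 0 <= a by apply: (low a e) => //; lia.
have b0 : 0 <= b by apply: (low b e) => //; lia.
have ce : (c + e) * n.+3%:Z >= e by lia.
(* A negative e would force a >= 1, b >= 1 and c + e >= 0, so the sum would exceed 1. *)
have [e0|e0] := ltP e 0.
  have cge : - e <= c by have : 0 <= (c + e); [apply: (low _ (- e)); lia|lia].
  have a1 : 1 <= a by nia.
  have b1 : 1 <= b by nia.
  by exfalso; lia.
have c0 : 0 <= c + e by nia.
have [ez|e1] := eqVneq e 0.
  have [[-> [-> [-> ->]]]|[[-> [-> [-> ->]]]|[[-> [-> [-> ->]]]|[-> [-> [-> ->]]]]]] :
      a = 1 /\ b = 0 /\ c = 0 /\ w = 0 \/ a = 0 /\ b = 1 /\ c = 0 /\ w = 0 \/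
      a = 0 /\ b = 0 /\ c = 1 /\ w = 0 \/ a = 0 /\ b = 0 /\ c = 0 /\ w = 1 by lia.
  - by exists 0%N; rewrite ?ez // => -[|[|[|[|[|]]]]].
  - by exists 1%N; rewrite ?ez // => -[|[|[|[|[|]]]]].
  - by exists 2%N; rewrite ?ez // => -[|[|[|[|[|]]]]].
  - by exists 4%N; rewrite ?ez // => -[|[|[|[|[|]]]]].
have ce1 : 1 <= c + e by nia.
have wz : w = 0 by lia.
have [-> [-> [-> ->]]] : a = 0 /\ b = 0 /\ c = 0 /\ e = 1 by nia.
by exists 3%N; rewrite ?wz // => -[|[|[|[|[|]]]]].
Qed.

(* The missing point (0,0,s,0) is a + b + N c - s e, where a, b, c, e are the first four
   rows of the table: a coefficient as large as s = n + 3 is out of reach of n differences. *)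
Lemma counterexample_even (R : realType) d k n : (4 <= d)%N -> (3 <= k <= d)%N ->
  exists G : set (mindex d), [/\ has_dimension R G k, ext_closed n G & ~ coset_restriction G].
Proof.
move=> d4 /andP[k3 kd]; pose s := n.+3; pose N := n.+2.
pose T := [:: [:: 0; s; 1; 0]; [:: s; 0; 1; 0]; [:: N; 1; 0; 1]]%N.
pose q j := nth 0%N [:: 0; 0; s; 0]%N j.
have s0 : s%:R != 0 :> R by rewrite pnatr_eq0.
have sN : s%:R = N%:R + 1 :> R by rewrite -natr1.
have N2 : 2 <= N%:R :> R by rewrite ler_nat.
(* Four rows give dimension 3, and releasing the coordinates from 4 to k adds k - 3; this needs k <
   d. *)
have [kld|dk] := ltnP k d.
  exists (cyl ([:: 0; 0; 0; s]%N :: T) 4 k.+1); split.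
  - apply: has_dimension_cyl => //=; [|lia|lia|].
      by move=> [|[|[|[|i]]]] [|[|[|[|j]]]] // _; rewrite /entry /= ?nth_nil.
    move=> c Hc; have := Hc 0%N isT; have := Hc 1%N isT; have := Hc 2%N isT; have := Hc 3%N isT.
    rewrite !big_ord_recr !big_ord0 /entry /= !subr0 sub0r !mulr0 !mulr1 !add0r !addr0 !sN.
    move=> H3 H2 H1 H0.
    have c2 : c 2%N = 0 by nra.
    have c0 : c 0%N = 0 by nra.
    have c1 : c 1%N = 0 by nra.
    by move=> [|[|[|i]]].
  - apply: cyl_ext_closed => // m; rewrite !big_ord_recr big_ord0 /= => m1 mb Hm.
    have := Hm 0%N isT; have := Hm 1%N isT; have := Hm 2%N isT; have := Hm 3%N isT.
    rewrite !big_ord_recr !big_ord0 /entry /= !mulr0 !mulr1 !add0r !addr0 => H3 H2 H1 H0.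
    have [||||||i i5 Hi] := @unit_coefs n (m 0%N) (m 1%N) (m 2%N) (m 3%N) 0 => //.
    + by move=> [|[|[|[|[|l]]]]]; [exact: mb..|rewrite /=; lia|rewrite /= nth_nil; lia].
    + by rewrite addr0 -[RHS]m1 add0r.
    + by rewrite mul0r addr0.
    + have i4 : (i < 4)%N by move: i5 Hi; case: i => [|[|[|[|[|]]]]] // _ /(_ 4%N isT).
      by exists i => // [] [|[|[|[|l]]]] // _;
        [exact: (Hi 0%N)|exact: (Hi 1%N)|exact: (Hi 2%N)|exact: (Hi 3%N)].
  - apply: (@cyl_not_coset _ _ _ _ (fun i => nth 0 [:: 1; 1; N%:Z; - s%:Z] i) q) => //=.
    + by rewrite !big_ord_recr big_ord0 /=; lia.
    + move=> [|[|[|[|j]]]]; rewrite !big_ord_recr big_ord0 /entry /q /= ?nth_nil; lia.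
    + by move=> [|[|[|[|i]]]] // _; [exists 2%N|exists 1%N|exists 0%N|exists 0%N].
(* All d - 4 further coordinates are released, and the row (0,0,2s,0) supplies the missing
   dimension. *)
have -> : k = d by lia.
exists (cyl ([:: 0; 0; 0; s]%N :: rcons T [:: 0; 0; 2 * s; 0]%N) 4 d); split.
- apply: has_dimension_cyl => //=; [|lia|lia|].
    by move=> [|[|[|[|[|i]]]]] [|[|[|[|j]]]] // _; rewrite /entry /= ?nth_nil.
  move=> c Hc; have := Hc 0%N isT; have := Hc 1%N isT; have := Hc 2%N isT; have := Hc 3%N isT.
  rewrite !big_ord_recr !big_ord0 /entry /= !subr0 sub0r !mulr0 !mulr1 !add0r !addr0 natrM !sN.
  move=> H3 H2 H1 H0.
  have c2 : c 2%N = (2 * N%:R + 2) * c 3%N by nra.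
  have c3 : c 3%N = 0 by nra.
  have {}c2 : c 2%N = 0 by nra.
  have c0 : c 0%N = 0 by nra.
  have c1 : c 1%N = 0 by nra.
  by move=> [|[|[|[|i]]]].
- apply: cyl_ext_closed => // m; rewrite !big_ord_recr big_ord0 /= => m1 mb Hm.
  have := Hm 0%N isT; have := Hm 1%N isT; have := Hm 2%N isT; have := Hm 3%N isT.
  rewrite !big_ord_recr !big_ord0 /entry /= !mulr0 !mulr1 !add0r !addr0 => H3 H2 H1 H0.
  have [||||||i i5 Hi] := @unit_coefs n (m 0%N) (m 1%N) (m 2%N) (m 3%N) (m 4%N) => //.
  + by move=> [|[|[|[|[|l]]]]]; [exact: mb..|rewrite /= nth_nil; lia].
  + by rewrite -[RHS]m1 add0r.
  + exists i => // [] [|[|[|[|[|l]]]]] // _;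
      [exact: (Hi 0%N)|exact: (Hi 1%N)|exact: (Hi 2%N)|exact: (Hi 3%N)|exact: (Hi 4%N)].
- apply: (@cyl_not_coset _ _ _ _ (fun i => nth 0 [:: 1; 1; N%:Z; - s%:Z] i) q) => //=.
  + by rewrite !big_ord_recr big_ord0 /=; lia.
  + move=> [|[|[|[|j]]]]; rewrite !big_ord_recr big_ord0 /entry /q /= ?nth_nil; lia.
  + by move=> [|[|[|[|[|i]]]]] // _; [exists 2%N|exists 1%N|exists 0%N|exists 0%N|
      exists 2%N => //; rewrite /q /entry /= /s; lia].
Qed.

(** * The contractive restriction property *)

Lemma contractive_closed (R : realType) d (p : \bar R) n (G : set (mindex d)) : (1%:E <= p)%E ->
  (forall m, (m < n)%N -> p <> (2 * m.+1%:R)%:E) -> contractive_set p G ->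
  closed_upto n [set ivec a | a in G].
Proof.
move=> p1 pn cG; apply: ext_closed_upto; case: p p1 pn cG => [r| |//] p1 pn cG; last first.
  exact: contractive_infty_ext_closed cG.
rewrite lee_fin in p1.
have pk k : (k < n)%N -> r <> 2 * k.+1%:R by move=> /pn kr E; apply: kr; rewrite E.
apply: (contractive_ext_closed p1 _ _ cG).
  (* A zero of binom(p/2 - 1, n) means p = 2(k + 1) with k < n, which is excluded. For binom(p/2, n)
     it means p = 2k, where k = 0 contradicts p >= 1. *)
  by apply/eqP => /gbin_eq0[k /pk kn E]; apply: kn; rewrite -natr1; lra.
apply/eqP => /gbin_eq0[[|k] kn E]; first by move: p1; lra.
by apply: (pk k (ltnW kn)); lra.
Qed.

Lemma counterexample_property (R : realType) d k n (G : set (mindex d)) :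
  has_dimension R G k -> ext_closed n G -> ~ coset_restriction G ->
  ~ contractive_restriction_property d ((2 * n.+1%:R)%:E : \bar R) k.
Proof. by move=> Gk Gn nG H; apply: nG; apply: H Gk _; exact: ext_closed_contractive. Qed.

Lemma ext_closed0 d (G : set (mindex d)) : ext_closed 0 G.
Proof. by move=> a [g Gg /ivec_inj <-]. Qed.

Theorem theorem1p2 (R : realType) (d k : nat) (p : \bar R) :
  (1 <= d)%N -> (1 <= k <= d)%N -> (1%:E <= p)%E ->
  [/\ ((d = 2%N \/ k = 1%N) ->
        (contractive_restriction_property d p k <-> p <> 2%:E)),
      ((d = 3%N /\ k = 3%N) \/ ((3 <= d)%N /\ k = 2%N) ->
        (contractive_restriction_property d p k <-> p <> 2%:E /\ p <> 4%:E)) &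
      ((4 <= d)%N /\ (3 <= k)%N ->
        (contractive_restriction_property d p k <->
           ~ exists n : nat, p = (2 * n%:R)%:E))].
Proof.
move=> d1 kd p1.
have two : 2%:E = (2 * 1%:R)%:E :> \bar R by rewrite mulr1.
have four : 4%:E = (2 * 2%:R)%:E :> \bar R by congr EFin; ring.
split=> [dk|dk|[d4 k3]]; split.
- move=> H p2; have [G Gk nG] := counterexample2 R kd.
  by apply: (counterexample_property Gk (@ext_closed0 _ G) nG); rewrite -two -p2.
- move=> p2 G Gk cG; have c1 : closed_upto 1 [set ivec a | a in G].
    by apply: contractive_closed cG => // -[|//] _; rewrite -two.
  case: dk => E; last by rewrite E in Gk; exact: coset_dim1 Gk c1.
  subst d; case: Gk => G0 _; apply: closed_coset => //; apply: planar_merge => //.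
  by move=> _ [a _ <-]; exact: nonneg_ivec.
- move=> H; have [d3 k23] : (3 <= d)%N /\ (k = 2%N \/ k = 3%N).
    by case: dk => -[dE kE]; split; rewrite ?dE ?kE//; [right|left].
  have [G [Gk G1 nG]] := counterexample4 R d3 k23.
  split=> pE.
    by apply: (counterexample_property Gk (@ext_closed0 _ G) nG); rewrite -two -pE.
  by apply: (counterexample_property Gk G1 nG); rewrite -four -pE.
- move=> [p2 p4] G Gk cG; have c2 : closed_upto 2 [set ivec a | a in G].
    by apply: contractive_closed cG => // -[|[|//]] _; rewrite -?two -?four.
  case: dk => -[E1 E2]; last by rewrite E2 in Gk; exact: coset_dim2 Gk c2.
  by subst d k; exact: coset_dim3 Gk c2.
(* The even integer 0 is ruled out by p >= 1; the others are 2(n + 1), matched with sets closed at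
   level n. *)
- move=> H [[|n] pE]; first by move: p1; rewrite pE mulr0 lee_fin; lra.
  have [|G [Gk Gn nG]] := counterexample_even R n d4 (k := k); first by rewrite k3; case/andP: kd.
  by apply: (counterexample_property Gk Gn nG); rewrite -pE.
- move=> pn G [G0 _] cG; apply: closed_coset => // n.
  by apply: contractive_closed cG => // m _ pE; apply: pn; exists m.+1.
Qed.
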